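(* Let $n\ge 3$ and let $f:S^{n-1}\to\mathbb{R}$ be a measurable, almost everywhere bounded (i.e. essentially bounded) and even function. If for almost every $u\in S^{n-1}$ the restriction $f|_{S^{n-1}\cap u^{\perp}}$ is isotropic (as a function on the unit sphere $S^{n-1}\cap u^\perp$ of $u^\perp$), then $f$ is almost everywhere equal to a constant.
   Context: $S^{n-1}$ is the unit sphere of $\mathbb{R}^n$ and $u^\perp=\{x\in\mathbb{R}^n:\langle x,u\rangle=0\}$. Spheres and equators $S^{n-1}\cap u^\perp$ carry their usual volume (rotation-invariant) measures, denoted $dx$, $dy$, $du$. ''Even'' means $f(-x)=f(x)$. For a finite-dimensional Euclidean space $H$ with unit sphere $S_H$, a measurable (integrable) function $g:S_H\to\mathbb{R}$ is called isotropic if the signed measure $g\,dx$ is isotropic, i.e. $\int_{S_H} y\,g(y)\,dy=0$ and the map $S_H\ni x\mapsto \int_{S_H}\langle x,y\rangle^2 g(y)\,dy$ is constant. *)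

(* Defs.v *)
From HB Require Import structures.
From mathcomp Require Import all_boot all_order all_algebra.
From mathcomp Require Import all_classical all_reals all_analysis.
Set Implicit Arguments.
Unset Strict Implicit.
Unset Printing Implicit Defensive.
Import Order.TTheory GRing.Theory Num.Theory.
Import numFieldNormedType.Exports.
Local Open Scope classical_set_scope.
Local Open Scope ring_scope.

(* Euclidean structure on 'rV[R]_n.  The library's norm `|x| on matrices is the
   sup norm, so the Euclidean norm gets its own name. *)
Section euclidean.
Context {R : realType} {n : nat}.
Implicit Types u v x y : 'rV[R]_n.

Definition dotv u v : R := \sum_(i < n) u 0 i * v 0 i.

Definition enorm u : R := Num.sqrt (dotv u u).

Definition perpv u : {vspace 'rV[R]_n} :=
  lker (linfun (mulmxr u^T : 'rV[R]_n -> 'rV[R]_1)).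

Lemma mulmx_tr_dotv u v : u *m v^T = (dotv u v)%:M.
Proof.
apply/matrixP => i j; rewrite !ord1 !mxE eqxx mulr1n.
by apply: eq_bigr => k _; rewrite mxE.
Qed.

Lemma mem_perpv u x : (x \in perpv u) = (dotv x u == 0).
Proof.
rewrite memv_ker lfunE /= mulmx_tr_dotv.
apply/eqP/eqP => [/matrixP/(_ 0 0)|->]; first by rewrite !mxE eqxx mulr1n.
by rewrite raddf0.
Qed.

Lemma dotv_eq0 u : (dotv u u == 0) = (u == 0).
Proof.
apply/eqP/eqP => [|->]; last by rewrite /dotv big1 // => i _; rewrite mxE mul0r.
move/eqP; rewrite psumr_eq0 => [/allP u0|i _]; last by rewrite -expr2 sqr_ge0.
apply/rowP => i; rewrite mxE; apply/eqP.
by have := u0 i (mem_index_enum _); rewrite /= mulf_eq0 orbb.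
Qed.

Lemma dim_fullv_row : \dim {: 'rV[R]_n} = n.
Proof. by rewrite dimvf /dim /= mul1n. Qed.

Lemma dim_perpv u : u != 0 -> \dim (perpv u) = n.-1.
Proof.
move=> u0; set f := linfun (mulmxr u^T : 'rV[R]_n -> 'rV[R]_1).
have := limg_ker_dim f fullv; rewrite capfv dim_fullv_row -/(perpv u).
suff -> : \dim (f @: fullv) = 1%N by rewrite addn1 => /(congr1 predn).
have fu0 : f u != 0.
  apply: contra u0; rewrite lfunE /= mulmx_tr_dotv => /eqP/matrixP/(_ 0 0)/eqP.
  by rewrite !mxE eqxx mulr1n dotv_eq0.
apply/eqP; rewrite eqn_leq; apply/andP; split.
  by apply: leq_trans (dimvS (subvf _)) _; rewrite dimvf /dim.
rewrite lt0n dimv_eq0; apply: contra fu0 => /eqP f0.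
by rewrite -memv0 -f0 memv_img // memvf.
Qed.

End euclidean.

(* Hausdorff measures on Euclidean space, normalised (as in Federer) so that
   the s-dimensional one is the s-dimensional volume on s-dimensional
   submanifolds; on a sphere it is the rotation-invariant surface measure. *)
Section hausdorff.
Context {R : realType} {n : nat}.
Local Open Scope ereal_scope.
Implicit Types (A : set 'rV[R]_n) (F : (set 'rV[R]_n)^nat) (s : nat).

(* Volume of the unit ball of R^s, by w_0 = 1, w_1 = 2, w_s = 2 pi / s w_(s-2) *)
Fixpoint ball_volume s : R :=
  match s with
  | 0%N => 1
  | 1%N => 2
  | s'.+2 => 2 * pi / s%:R * ball_volume s'
  end%R.

Definition ediam A : \bar R :=
  ereal_sup [set (enorm (x - y))%:E | x in A & y in A].

(* The case distinction makes the empty set cost 0 also when s = 0. *)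
Definition hausdorff_cost s A : \bar R :=
  if A == set0 then 0 else (ball_volume s / 2 ^+ s)%:E * ediam A ^+ s.

Definition hausdorff_delta s (delta : R) A : \bar R :=
  ereal_inf [set \sum_(k <oo) hausdorff_cost s (F k) | F in
    [set F | (forall k, ediam (F k) <= delta%:E) /\ A `<=` \bigcup_k F k]].

Definition hausdorff s A : \bar R :=
  ereal_sup [set hausdorff_delta s delta A | delta in [set d | (0 < d)%R]].

Lemma ball_volume_gt0 s : (0 < ball_volume s)%R.
Proof.
have [m] := ubnP s; elim: m s => // m IH [|[|s]] /= sm; rewrite ?ltr01 ?ltr0n //.
by rewrite mulr_gt0 ?IH ?divr_gt0 ?mulr_gt0 ?pi_gt0 ?ltr0n // ltnW.
Qed.

Lemma hausdorff_cost_ge0 s A : 0 <= hausdorff_cost s A.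
Proof.
rewrite /hausdorff_cost; case: eqVneq => // /set0P[x Ax].
rewrite mule_ge0 ?lee_fin ?divr_ge0 ?exprn_ge0 ?(ltW (ball_volume_gt0 _)) //.
apply: expe_ge0; apply: ereal_sup_ubound; exists x => //; exists x => //.
rewrite subrr /enorm (_ : dotv 0 0 = 0)%R ?sqrtr0 //.
by apply/eqP; rewrite dotv_eq0.
Qed.

Let cost_delta s (delta : R) (A : set (g_sigma_algebraType [set: set 'rV[R]_n])) :=
  if `[< ediam A <= delta%:E >] then hausdorff_cost s A else +oo.

Let cost_delta_ge0 s delta A : 0 <= cost_delta s delta A.
Proof. by rewrite /cost_delta; case: ifP => // _; exact: hausdorff_cost_ge0. Qed.

Let cost_delta0 s delta : cost_delta s delta set0 = 0.
Proof.
rewrite /cost_delta /hausdorff_cost eqxx ifT //; apply/asboolP.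
rewrite (_ : ediam set0 = -oo) ?leNye //.
rewrite /ediam (_ : [set _ | _ in _ & _ in _] = set0) ?ereal_sup0 //.
by rewrite -subset0 => _ [x []].
Qed.

Let hausdorff_deltaE s delta : hausdorff_delta s delta = mu_ext (cost_delta s delta).
Proof.
apply/funext => A; apply/eqP; rewrite eq_le; apply/andP; split.
- apply: le_ereal_inf_tmp => _ [F [_ AF] <-].
  have [Fd|/existsNP[k Fk]] := pselect (forall k, ediam (F k) <= delta%:E).
    apply: ereal_inf_lbound; exists F => //=; apply: eq_eseriesr => k _.
    by rewrite /cost_delta ifT //; apply/asboolP.
  rewrite (eseries_pinfty (k := k)) ?leey //.
    by move=> m _; rewrite -ltNye (lt_le_trans _ (cost_delta_ge0 _ _ _)).
  by rewrite /cost_delta ifF //; apply/asboolPn.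
- apply: ereal_inf_le_tmp => _ [F [Fd AF] <-]; exists F.
    by split => // k; exact: sub_sigma_algebra.
  by apply: eq_eseriesr => k _; rewrite /cost_delta ifT //; apply/asboolP.
Qed.

Let hausdorff_delta_ge0 s delta A : 0 <= hausdorff_delta s delta A.
Proof. by rewrite hausdorff_deltaE; apply: mu_ext_ge0; exact: cost_delta_ge0. Qed.

Let le_hausdorff s delta A : (0 < delta)%R -> hausdorff_delta s delta A <= hausdorff s A.
Proof. by move=> d0; apply: ereal_sup_ubound; exists delta. Qed.

Let hausdorff_ge0 s A : 0 <= hausdorff s A.
Proof. by apply: le_trans (le_hausdorff s A ltr01); exact: hausdorff_delta_ge0. Qed.

Let hausdorff0 s : hausdorff s set0 = 0.
Proof.
apply/eqP; rewrite eq_le hausdorff_ge0 andbT.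
apply: ge_ereal_sup => _ [delta _ <-].
by rewrite hausdorff_deltaE mu_ext0 //; exact: cost_delta_ge0.
Qed.

Let hausdorff_homo s : {homo hausdorff s : A B / A `<=` B >-> A <= B}.
Proof.
move=> A B AB; apply: ge_ereal_sup => _ [delta d0 <-].
by apply: le_trans (le_hausdorff s B d0); rewrite hausdorff_deltaE; exact: le_mu_ext.
Qed.

Let hausdorff_subadditive s : sigma_subadditive (hausdorff s).
Proof.
move=> F; apply: ge_ereal_sup => _ [delta d0 <-].
rewrite hausdorff_deltaE.
have /le_trans := mu_ext_sigma_subadditive (mu := cost_delta s delta)
  (cost_delta_ge0 s delta) F; apply.
rewrite -hausdorff_deltaE; apply: lee_nneseries => k _ //.
exact: le_hausdorff.
Qed.

HB.instance Definition _ s := isOuterMeasure.Build R 'rV[R]_n (hausdorff s)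
  (hausdorff0 s) (@hausdorff_ge0 s) (@hausdorff_homo s) (@hausdorff_subadditive s).

End hausdorff.

Section isotropic.
Context {R : realType} {n : nat}.
Implicit Type H : {vspace 'rV[R]_n}.

(* The sphere of H has dimension \dim H - 1. *)
Definition sphere_outer H : {outer_measure set 'rV[R]_n -> \bar R} :=
  hausdorff (\dim H).-1.

(* R^n with the Caratheodory (hence complete, Borel-containing) sigma-algebra
   of that outer measure. *)
Definition sphere_type H := caratheodory_type (sphere_outer H).

Definition sphere_measure H : {measure set (sphere_type H) -> \bar R} :=
  (sphere_outer H : set (caratheodory_type (sphere_outer H)) -> \bar R).

Definition unit_sphere H : set 'rV[R]_n := [set x | x \in H /\ enorm x = 1].
Arguments unit_sphere H _ : clear implicits.

(* Functions on the unit sphere of H are total functions of which only the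
   values on that sphere matter; thus restriction to a smaller sphere is
   implicit. *)
Definition isotropic H (g : 'rV[R]_n -> R) : Prop :=
  [/\ (sphere_measure H).-integrable (unit_sphere H) (EFin \o g),
      (forall i, \int[sphere_measure H]_(y in unit_sphere H)
                   ((y : 'rV[R]_n) 0 i * g y) = 0) &
      (exists c : R, forall x, unit_sphere H x ->
         \int[sphere_measure H]_(y in unit_sphere H) (dotv x y ^+ 2 * g y) = c)].

End isotropic.

(* Main.v *)
Require Import Defs.
From HB Require Import structures.
From mathcomp Require Import all_boot all_order all_algebra.
From mathcomp Require Import all_classical all_reals all_analysis.
From mathcomp Require Import measurable_realfun measurable_fun_approximation.
From mathcomp Require Import lra ring zify.
Set Implicit Arguments.
Unset Strict Implicit.
Unset Printing Implicit Defensive.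
Import Order.TTheory GRing.Theory Num.Theory.
Import numFieldNormedType.Exports.
Local Open Scope classical_set_scope.
Local Open Scope ring_scope.

(** Write [T g u] for the integral of [g] over the equator of [u]. For
almost every [u], isotropy gives
[(n - 1) T (f <a,.>^2) u = (1 - <a,u>^2) T f u] for every unit vector [a].
Multiply by [<a,u>^(2k)] and integrate over [u]. Since [T] is self-adjoint and
[T <a,.>^(2k) = m_k (1 - <a,.>^2)^k] by rotation invariance, the integrals
[M_k] of [g (1 - <a,.>^2)^k], where [g] is [f] minus its mean, satisfy
[(n - 2) m_k M_k = ((n - 1) m_k - m_(k+1)) M_(k+1)]. As [M_0 = 0], all of them
vanish, so [g] is orthogonal to all powers [<a,.>^(2N)]. Normalised, these are
an approximate identity on even functions, hence [g = 0]. The same approximate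
identity shows that [T] is self-adjoint: [T <v,.>^(2N) u] is symmetric in [u]
and [v].

The volumes being Hausdorff measures, this is done with a Borel
representative of [f]: null sets have Borel null hulls, and a null set of the
sphere is null in almost every equator because [T] is self-adjoint. *)

(** * Bounded measurable functions *)

(** Isotropy gives the displayed identity by splitting [a] into <a,u> u and a component p orthogonal
    to u. On the equator of u only p matters, |p|^2 = 1 - <a,u>^2, and summing over an orthonormal
    basis shows that the isotropy constant is T f u / (n - 1). Constants satisfy the same identity,
    as m_0 = (n - 1) m_1, so the mean can be subtracted. The recursion determines M_(k+1) because
    m_(k+1) <= m_k: its coefficient is at least (n - 2) m_k, which is positive for n >= 3. On the
    circle an equator is a pair of antipodal points and the coefficient vanishes.

    No rotation group appears. The reflection in u - v exchanges the unit vectors u and v, and the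
    measures are only asked to be invariant under reflections and under the antipodal map. Instead
    of a family of measures on all equators there is one measure on the equator of e0, carried to
    the equator of u by the reflection in u - e0. This depends measurably on u, so Fubini's theorem
    on a product is enough. *)

Definition bounded_mfun d (T : measurableType d) (R : realType) (S : set T) (f : T -> R) :=
  measurable_fun setT f /\ exists M : R, forall x, S x -> `|f x| <= M.

Section bounded_mfun.
Context d (T : measurableType d) (R : realType) (S : set T).
Implicit Types f g : T -> R.
Local Notation bm := (bounded_mfun S).

Lemma bounded_mfun_cst (c : R) : bm (cst c).
Proof. by split => //; exists `|c|. Qed.

Lemma bounded_mfunD f g : bm f -> bm g -> bm (fun x => f x + g x).
Proof.
move=> [mf [M fM]] [mg [N gN]]; split; first exact: measurable_funD.
exists (M + N) => x Sx; rewrite (le_trans (ler_normD _ _))//.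
by rewrite lerD ?fM ?gN.
Qed.

Lemma bounded_mfunM f g : bm f -> bm g -> bm (fun x => f x * g x).
Proof.
move=> [mf [M fM]] [mg [N gN]]; split; first exact: measurable_funM.
by exists (M * N) => x Sx; rewrite normrM ler_pM ?fM ?gN.
Qed.

Lemma bounded_mfunN f : bm f -> bm (fun x => - f x).
Proof.
move=> bf; rewrite (_ : (fun _ => _) = fun x => cst (-1) x * f x).
  by apply: bounded_mfunM => //; exact: bounded_mfun_cst.
by apply/funext => x; rewrite mulN1r.
Qed.

Lemma bounded_mfunB f g : bm f -> bm g -> bm (fun x => f x - g x).
Proof. by move=> bf bg; apply: bounded_mfunD => //; exact: bounded_mfunN. Qed.

Lemma bounded_mfunX f k : bm f -> bm (fun x => f x ^+ k).
Proof.
move=> bf; elim: k => [|k IH]; first exact: bounded_mfun_cst.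
rewrite (_ : (fun _ => _) = fun x => f x * f x ^+ k); first exact: bounded_mfunM.
by apply/funext => x; rewrite exprS.
Qed.

Lemma bounded_mfun_sum (I : Type) (r : seq I) (F : I -> T -> R) :
  (forall i, bm (F i)) -> bm (fun x => \sum_(i <- r) F i x).
Proof.
move=> bF; elim: r => [|i r IH].
  rewrite (_ : (fun _ => _) = cst 0); first exact: bounded_mfun_cst.
  by apply/funext => x; rewrite big_nil.
rewrite (_ : (fun _ => _) = fun x => F i x + \sum_(j <- r) F j x).
  exact: bounded_mfunD.
by apply/funext => x; rewrite big_cons.
Qed.

End bounded_mfun.

(** * Layer-cake approximation and the functional monotone class theorem *)

Section layer_cake.
Context {R : realType}.

(** For [t >= 0] this is the integer part of [t], capped at [N]. *)
Let layer (N : nat) (t : R) : R := \sum_(1 <= k < N.+1) (k%:R <= t)%R%:R.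

Let layer_bound N t : 0 <= t ->
  (N%:R <= t -> layer N t = N%:R) /\ (t < N%:R -> t - 1 < layer N t <= t).
Proof.
move=> t0; elim: N => [|N [IH1 IH2]].
  by split => [_|]; [rewrite /layer big_geq|rewrite ltNge t0].
have LS : layer N.+1 t = layer N t + (N.+1%:R <= t)%R%:R.
  by rewrite /layer big_nat_recr.
have NS : N.+1%:R = N%:R + 1 :> R by rewrite natr1.
split => Nt; rewrite LS.
  by rewrite Nt IH1 ?natr1// (le_trans _ Nt)// ler_nat.
rewrite leNgt Nt /= addr0; have [tN|tN] := leP N%:R t; last exact: IH2.
by rewrite IH1//; rewrite NS in Nt; apply/andP; split => //; lra.
Qed.

Lemma layer_cake_approx (N : nat) (t : R) : (0 < N)%N -> 0 <= t <= 1 ->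
  `|t - N%:R^-1 * \sum_(1 <= k < N.+1) (k%:R <= N%:R * t)%R%:R| <= N%:R^-1.
Proof.
move=> N0 /andP[t0 t1]; have Np : 0 < N%:R :> R by rewrite ltr0n.
have Nt0 : 0 <= N%:R * t by rewrite mulr_ge0// ltW.
have [H1 H2] := layer_bound N Nt0.
rewrite -/(layer N (N%:R * t)); set L := layer _ _ in H1 H2 *.
rewrite (_ : t - _ = N%:R^-1 * (N%:R * t - L)); last first.
  by rewrite mulrBr mulrA mulVf ?mul1r// lt0r_neq0.
rewrite normrM ger0_norm ?invr_ge0 ?ler0n// -[leRHS]mulr1 ler_wpM2l ?invr_ge0 ?ler0n//.
have [Nt|/H2 /andP[La Lb]] := leP N%:R (N%:R * t).
  have ? : N%:R * t <= N%:R by rewrite ler_piMr// ltW.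
  rewrite (H1 Nt).
  by rewrite ler_norml; apply/andP; split; lra.
by rewrite ler_norml; apply/andP; split; lra.
Qed.

End layer_cake.

(** Dynkin's theorem reaches the indicators of all measurable sets, uniform limits of layer sums
    reach the functions with values in [0, 1], and an affine change of scale reaches the rest. *)
Lemma bounded_mfun_ind d (T : measurableType d) (R : realType)
    (G : set (set T)) (P : (T -> R) -> Prop) :
  @measurable _ T = <<s G >> -> setI_closed G ->
  (forall A, G A -> P \1_A) -> P (cst 1) ->
  (forall a f g, bounded_mfun setT f -> bounded_mfun setT g ->
     P f -> P g -> P (fun x => f x + a * g x)) ->
  (forall (F : nat -> T -> R) (f : T -> R) (M : R), (forall n, measurable_fun setT (F n)) ->
     measurable_fun setT f -> (forall n x, `|F n x| <= M) ->
     (forall n, P (F n)) -> (forall x, F n x @[n --> \oo] --> f x) -> P f) ->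
  forall f, bounded_mfun setT f -> P f.
Proof.
move=> GE GI PG P1 Plin Plim.
have b1 A : measurable A -> bounded_mfun setT (\1_A : T -> R).
  move=> mA; split; first exact: measurable_indic.
  by exists 1 => x _; rewrite indicE; case: (x \in A); rewrite ?normr1 ?normr0.
have bc c : bounded_mfun setT (cst c : T -> R) by exact: bounded_mfun_cst.
have P0 : P (cst 0).
  rewrite (_ : cst 0 = fun x => cst 1 x + (-1) * cst 1 x).
    exact: Plin.
  by apply/funext => x /=; rewrite mulr1 subrr.
have Psum (I : Type) (r : seq I) (F : I -> T -> R) :
    (forall i, bounded_mfun setT (F i)) -> (forall i, P (F i)) ->
    P (fun x => \sum_(i <- r) F i x).
  move=> bF PF; elim: r => [|i r IH].
    rewrite (_ : (fun _ => _) = cst 0)//.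
    by apply/funext => x; rewrite big_nil.
  rewrite (_ : (fun _ => _) = fun x => \sum_(j <- r) F j x + 1 * F i x).
    by apply: Plin => //; exact: bounded_mfun_sum.
  by apply/funext => x; rewrite big_cons mul1r addrC.
have Pset A : measurable A -> P \1_A.
  rewrite {1}GE; apply: (dynkin_induction (P := fun A => P \1_A) GE GI) => //.
  - by rewrite (_ : \1_ _ = cst 1)//; apply/funext => x; rewrite indicT.
  - move=> S mS PS; rewrite (_ : \1_ _ = fun x => cst 1 x + (-1) * \1_S x).
      by apply: Plin => //; exact: b1.
    apply/funext => x; rewrite !indicE in_setC; case: (x \in S) => /=; lra.
  - move=> F mF tF PF.
    apply: (Plim (fun n => \1_(\big[setU/set0]_(i < n) F i)) _ 1).
    + by move=> n; apply: measurable_indic; exact: bigsetU_measurable.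
    + by apply: measurable_indic; exact: bigcup_measurable.
    + by move=> n x; rewrite indicE; case: (x \in _); rewrite ?normr1 ?normr0.
    + elim => [|n IH]; first by rewrite big_ord0 indic0.
      rewrite big_ord_recr /= (_ : \1_ _ = fun x => \1_(\big[setU/set0]_(i < n) F i) x + 1 * \1_(F n) x).
        apply: Plin => //; last exact: b1.
        by apply: b1; exact: bigsetU_measurable.
      apply/funext => x; rewrite mul1r !indicE in_setU.
      have : ~ (x \in \big[setU/set0]_(i < n) F i /\ x \in F n).
        rewrite !inE -bigcup_mkord => -[[k /= kn Fk] Fn].
        by have /eqP := tF k n I I (ex_intro _ x (conj Fk Fn)); rewrite ltn_eqF.
      case: (x \in \big[setU/set0]_(i < n) F i); case: (x \in F n) => //= nn.
      - by exfalso; apply: nn.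
      - by rewrite addr0.
      - by rewrite add0r.
      - by rewrite addr0.
    + move=> x; have [[k _ Fkx]|nF] := pselect ((\bigcup_k F k) x).
        apply: cvg_near_cst; exists k.+1 => // m /= km.
        by rewrite !indicE !mem_set//; [exists k|rewrite -bigcup_mkord; exists k].
      apply: cvg_near_cst; apply: nearW => m.
      rewrite !indicE !memNset// -bigcup_mkord => -[k _ Fkx]; apply: nF; by exists k.
have P01 (f : T -> R) : measurable_fun setT f -> (forall x, 0 <= f x <= 1) -> P f.
  move=> mf f01.
  pose E N k := [set x | k%:R <= N%:R * f x].
  have mE N k : measurable (E N k).
    rewrite -[E N k]setTI; apply: (@measurable_fun_le _ _ _ _ (cst k%:R)) => //.
    by apply: measurable_funM.
  pose F (N : nat) (x : T) : R := N.+1%:R^-1 * \sum_(1 <= k < N.+2) \1_(E N.+1 k) x.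
  have FE N x : F N x = N.+1%:R^-1 * \sum_(1 <= k < N.+2) (k%:R <= N.+1%:R * f x)%R%:R.
    congr (_ * _); apply: eq_bigr => k _; rewrite indicE; congr (nat_of_bool _)%:R.
    by apply/idP/idP => [/set_mem//|/mem_set].
  have bS N : bounded_mfun setT (fun x => \sum_(1 <= k < N.+2) (\1_(E N.+1 k) x : R)).
    apply: bounded_mfun_sum => k; have := b1 _ (mE N.+1 k); exact.
  have Fx N x := @layer_cake_approx R N.+1 (f x) isT (f01 x).
  (* The bound 2 is 1 for [f] plus the layer error, which is at most 1. *)
  apply: (Plim F _ 2) => //.
  - by move=> N; apply: measurable_funM => //; case: (bS N).
  - move=> N x; have := Fx N x; rewrite -FE => Fx'.
    have -> : F N x = f x - (f x - F N x) by lra.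
    rewrite (le_trans (ler_normB _ _))// (_ : 2 = 1 + 1 :> R)//.
    rewrite lerD//; first by rewrite ger0_norm; case/andP: (f01 x).
    by rewrite (le_trans Fx')// invf_le1 ?ltr0n// ler1n.
  - move=> N; rewrite (_ : F N = fun x => cst 0 x + N.+1%:R^-1 *
      \sum_(1 <= k < N.+2) \1_(E N.+1 k) x); last by apply/funext => x; rewrite add0r.
    apply: Plin => //; apply: Psum => k; last exact: Pset.
    exact: (b1 _ (mE N.+1 k)).
  - move=> x; apply/cvgrPdist_le => e e0.
    near=> N; rewrite FE; apply: le_trans (Fx N x) _; apply: ltW.
    near: N; exact: (near_infty_natSinv_lt (PosNum e0)).

move=> f [mf [M fM]]; have [M0|M0] := leP M 0.
  rewrite (_ : f = cst 0)//; apply/funext => x; apply/eqP; rewrite -normr_eq0.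
  by rewrite eq_le normr_ge0 (le_trans (fM _ I)).
pose g x := (f x + M) / (2 * M).
have mg : measurable_fun setT g.
  by apply: measurable_funM => //; exact: measurable_funD.
have fb x : - M <= f x <= M by rewrite -ler_norml fM.
have g01 x : 0 <= g x <= 1.
  have /andP[a b] := fb x.
  rewrite divr_ge0 ?ler_pdivrMr ?mulr_gt0//=; lra.
have -> : f = fun x => (fun y => cst 0 y + (- M) * cst 1 y) x + (2 * M) * g x.
  apply/funext => x /=; rewrite /g [2 * M * _]mulrC divfK ?lt0r_neq0 ?mulr_gt0//.
  by rewrite add0r mulr1 addrC addrK.
have bg : bounded_mfun setT g.
  by split => //; exists 1 => x _; have /andP[a b] := g01 x; rewrite ger0_norm.
apply: (Plin) => //; [|exact: Plin|exact: P01].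
rewrite (_ : (fun _ => _) = cst (- M))//; by apply/funext => x /=; rewrite add0r mulr1.
Unshelve. all: by end_near. Qed.

(** * Integrals of bounded functions for a finite measure *)

Section Rintegral_bounded_mfun.
Context d (T : measurableType d) (R : realType) (nu : {finite_measure set T -> \bar R}).
Variables (S : set T) (mS : measurable S).
Implicit Types f g : T -> R.
Local Notation bm := (bounded_mfun S).

Lemma bounded_mfun_integrable f : bm f -> nu.-integrable S (EFin \o f).
Proof.
move=> [mf [M fM]].
have iM : nu.-integrable S (EFin \o cst M).
  apply: (measurable_bounded_integrable (mu := nu)) => //.
  - by rewrite -ge0_fin_numE// fin_num_measure.
  - by exists `|M|; split; rewrite ?num_real// => M' MM' x _ /=; rewrite ltW.
apply: (le_integrable mS _ _ iM).
  by apply/measurable_EFinP; exact: measurable_funTS.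
by move=> x Sx /=; rewrite lee_fin (le_trans (fM x Sx))// ler_norm.
Qed.
Let int := bounded_mfun_integrable.

Lemma RintegralD_bounded f g : bm f -> bm g ->
  \int[nu]_(x in S) (f x + g x) = \int[nu]_(x in S) f x + \int[nu]_(x in S) g x.
Proof. by move=> bf bg; apply: RintegralD => //; exact: int. Qed.

Lemma RintegralB_bounded f g : bm f -> bm g ->
  \int[nu]_(x in S) (f x - g x) = \int[nu]_(x in S) f x - \int[nu]_(x in S) g x.
Proof. by move=> bf bg; apply: RintegralB => //; exact: int. Qed.

Lemma RintegralZl_bounded c f : bm f ->
  \int[nu]_(x in S) (c * f x) = c * \int[nu]_(x in S) f x.
Proof. by move=> bf; apply: RintegralZl => //; exact: int. Qed.

Lemma RintegralZr_bounded c f : bm f ->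
  \int[nu]_(x in S) (f x * c) = \int[nu]_(x in S) f x * c.
Proof. by move=> bf; apply: RintegralZr => //; exact: int. Qed.

Lemma le_Rintegral_bounded f g : bm f -> bm g -> (forall x, S x -> f x <= g x) ->
  \int[nu]_(x in S) f x <= \int[nu]_(x in S) g x.
Proof. by move=> bf bg; apply: le_Rintegral => //; exact: int. Qed.

Lemma Rintegral_sum_bounded (I : Type) (r : seq I) (F : I -> T -> R) :
  (forall i, bm (F i)) ->
  \int[nu]_(x in S) (\sum_(i <- r) F i x) = \sum_(i <- r) \int[nu]_(x in S) F i x.
Proof.
move=> bF; elim: r => [|i r IH].
  rewrite big_nil (_ : Rintegral _ _ _ = \int[nu]_(x in S) 0).
    by rewrite Rintegral_cst// mul0r.
  by apply: eq_Rintegral => x _; rewrite big_nil.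
rewrite big_cons -IH -RintegralD_bounded//; last exact: bounded_mfun_sum.
by apply: eq_Rintegral => x _; rewrite big_cons.
Qed.

Lemma ler_norm_Rintegral_bounded f (M : R) : bm f -> (forall x, S x -> `|f x| <= M) ->
  `|\int[nu]_(x in S) f x| <= M * fine (nu S).
Proof.
move=> bf fM; rewrite -(@Rintegral_cst _ _ _ nu)//.
apply: le_trans (le_normr_Rintegral mS (int bf)) _.
apply: le_Rintegral_bounded => //; last exact: bounded_mfun_cst.
case: bf => mf [N fN]; split; first exact: measurableT_comp.
by exists N => x Sx; rewrite normr_id fN.
Qed.

Lemma Rintegral_bounded_cvg (F : nat -> T -> R) f (M : R) :
  (forall n, measurable_fun setT (F n)) -> measurable_fun setT f ->
  (forall n x, S x -> `|F n x| <= M) ->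
  (forall x, S x -> F n x @[n --> \oo] --> f x) ->
  \int[nu]_(x in S) F n x @[n --> \oo] --> \int[nu]_(x in S) f x.
Proof.
move=> mF mf FM Ff.
have [|||||_ _] := @dominated_convergence _ _ _ nu S mS
  (fun n x => (F n x)%:E) (fun x => (f x)%:E) (cst M%:E).
- by move=> n; apply/measurable_EFinP; exact: measurable_funTS.
- by apply/measurable_EFinP; exact: measurable_funTS.
- by apply: aeW => x Sx; apply/fine_cvgP; split; [exact: nearW|exact: Ff].
- by have := int (bounded_mfun_cst S M).
- by apply: aeW => x n Sx; rewrite lee_fin FM.
have fM x : S x -> `|f x| <= M.
  move=> Sx; apply: (@closed_cvg _ _ \oo _ (fun n => `|F n x|) (fun v => v <= M)).
  - exact: closed_le.
  - by apply: nearW => n; exact: FM.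
  - by apply: cvg_norm; exact: Ff.
have bf : bm f by split => //; exists M.
rewrite -[X in _ --> X]fineK; last first.
  by have := integrable_fin_num mS (int bf).
by move/fine_cvgP => [].
Qed.

Lemma Rintegral_ae_eq_bounded f g : bm f -> bm g ->
  {ae nu, forall x, S x -> f x = g x} ->
  \int[nu]_(x in S) f x = \int[nu]_(x in S) g x.
Proof.
move=> [mf _] [mg _] fg; congr fine; apply: ae_eq_integral => //.
- by apply/measurable_EFinP; exact: measurable_funTS.
- by apply/measurable_EFinP; exact: measurable_funTS.
- by apply: filterS fg => x /= H Sx; rewrite H.
Qed.

Lemma Rintegral_eq0_bounded f : bm f -> (forall x, S x -> 0 <= f x) ->
  \int[nu]_(x in S) f x = 0 -> {ae nu, forall x, S x -> f x = 0}.
Proof.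
move=> bf f0 If.
have mf : measurable_fun S (EFin \o f).
  by apply/measurable_EFinP/measurable_funTS; case: bf.
have /(@ae_eq_integral_abs _ _ _ nu S mS) : measurable_fun S (EFin \o f) by [].
case=> + _; move=> H.
have /H : (\int[nu]_(x in S) `|(EFin \o f) x| = 0)%E.
  transitivity (\int[nu]_(x in S) (f x)%:E)%E.
    by apply: eq_integral => x /set_mem Sx /=; rewrite ger0_norm// f0.
  move/eqP: If; rewrite /Rintegral fine_eq0 => [/eqP //|].
  by have := integrable_fin_num mS (int bf).
by apply: filterS => x /= H1 /H1[].
Qed.

Lemma Rintegral_transform (phi : T -> T) f :
  measurable_fun setT phi -> phi @^-1` S = S ->
  (forall A, measurable A -> nu (phi @^-1` A) = nu A) -> bm f ->
  \int[nu]_(x in S) f (phi x) = \int[nu]_(x in S) f x.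
Proof.
move=> mphi phiS nuphi bf; congr fine.
rewrite -[LHS]/(\int[nu]_(x in S) ((EFin \o f) \o phi) x)%E -{1}phiS.
rewrite -integral_pushforward//.
- apply: eq_measure_integral => A mA _; exact: nuphi.
- by apply/measurable_EFinP; case: bf.
- rewrite phiS; apply: int; case: bf => mf [M fM]; split.
    exact: measurableT_comp.
  by exists M => x Sx; apply: fM; rewrite -[S _]/((phi @^-1` S) x) phiS.
Qed.

End Rintegral_bounded_mfun.

(** * Fubini's theorem on a product of subsets *)

Section Rintegral_Fubini.
Context d (T : measurableType d) d' (T' : measurableType d') (R : realType).
Variables (mu : {finite_measure set T -> \bar R}) (nu : {finite_measure set T' -> \bar R}).
Variables (S : set T) (S' : set T') (mS : measurable S) (mS' : measurable S').
Variable F : T * T' -> R.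
Hypothesis bF : bounded_mfun (S `*` S') F.

(** Extension by zero turns the integrals over [S] and [S'] into integrals over the whole spaces,
    where Fubini's theorem is stated. *)
Let G : T * T' -> R := F \_ (S `*` S').

Let mG : measurable_fun setT G.
Proof.
apply/(measurable_restrictT F) => //; first exact: measurableX.
by apply: measurable_funTS; case: bF.
Qed.

Let bG : exists M : R, forall z, `|G z| <= M.
Proof.
case: bF => _ [M FM]; exists `|M| => z; rewrite /G /restrict; case: ifPn => [/set_mem zS|_].
  by rewrite (le_trans (FM z zS))// ler_norm.
by rewrite normr0.
Qed.

Let int1 x : S x -> \int[nu]_y G (x, y) = \int[nu]_(y in S') F (x, y).
Proof.
move=> Sx; rewrite [RHS]Rintegral_mkcond; apply: eq_Rintegral => y _.
rewrite /G /restrict; have -> : ((x, y) \in S `*` S') = (y \in S') => //.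
by apply/idP/idP; rewrite !inE /=; [case|move=> ?; split].
Qed.

Let int1' x : ~ S x -> \int[nu]_y G (x, y) = 0.
Proof.
move=> Sx; transitivity (\int[nu]_y 0 : R); last by rewrite Rintegral_cst// mul0r.
by apply: eq_Rintegral => y _; rewrite /G /restrict memNset//= => -[].
Qed.

Let int2 y : S' y -> \int[mu]_x G (x, y) = \int[mu]_(x in S) F (x, y).
Proof.
move=> Sy; rewrite [RHS]Rintegral_mkcond; apply: eq_Rintegral => x _.
rewrite /G /restrict; have -> : ((x, y) \in S `*` S') = (x \in S) => //.
by apply/idP/idP; rewrite !inE /=; [case|move=> ?; split].
Qed.

Let int2' y : ~ S' y -> \int[mu]_x G (x, y) = 0.
Proof.
move=> Sy; transitivity (\int[mu]_x 0 : R); last by rewrite Rintegral_cst// mul0r.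
by apply: eq_Rintegral => x _; rewrite /G /restrict memNset//= => -[].
Qed.

Let intG : (mu \x nu)%E.-integrable setT (EFin \o G).
Proof.
have fT : ((mu \x nu) (setT `*` setT) < +oo)%E.
  rewrite product_measure1E// lte_mul_pinfty// ?fin_num_measure//.
  by rewrite -ge0_fin_numE// fin_num_measure.
apply: (measurable_bounded_integrable (mu := (mu \x nu)%E)) => //.
  by rewrite -setXTT.
case: bG => M GM; exists M; split; rewrite ?num_real// => M' MM' z _.
by rewrite /= ltW// (le_lt_trans (GM _)).
Qed.

Let fin1 x : (\int[nu]_y (G (x, y))%:E)%E \is a fin_num.
Proof.
apply: integrable_fin_num => //.
apply: (@bounded_mfun_integrable _ _ _ nu setT _ (fun y => G (x, y))) => //; split.
  exact: measurableT_comp.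
by case: bG => M GM; exists M => y _.
Qed.

Let fin2 y : (\int[mu]_x (G (x, y))%:E)%E \is a fin_num.
Proof.
apply: integrable_fin_num => //.
apply: (@bounded_mfun_integrable _ _ _ mu setT _ (fun x => G (x, y))) => //; split.
  exact: measurableT_comp.
by case: bG => M GM; exists M => x _.
Qed.

Lemma Rintegral_Fubini :
  \int[mu]_(x in S) (\int[nu]_(y in S') F (x, y)) =
  \int[nu]_(y in S') (\int[mu]_(x in S) F (x, y)).
Proof.
have := Fubini intG => /(congr1 fine).
rewrite (eq_integral (fun x => (\int[nu]_y G (x, y))%:E)); last first.
  by move=> x _; rewrite fineK.
rewrite [X in _ = fine X](eq_integral (fun y => (\int[mu]_x G (x, y))%:E)); last first.
  by move=> y _; rewrite fineK.
rewrite -!/(Rintegral _ _ _) => E.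
rewrite Rintegral_mkcond [RHS]Rintegral_mkcond.
transitivity (\int[mu]_x \int[nu]_y G (x, y)).
  apply: eq_Rintegral => x _; rewrite /restrict; case: ifPn => [/set_mem /int1 //|].
  by move/negP; rewrite inE => /int1' ->.
transitivity (\int[nu]_y \int[mu]_x G (x, y)); first exact: E.
apply: eq_Rintegral => y _; rewrite /restrict; case: ifPn => [/set_mem /int2 //|].
by move/negP; rewrite inE => /int2' ->.
Qed.

(* Off [S] the partial integral may be that of an unbounded function, hence the
   restriction. *)
Lemma bounded_mfun_Rintegral :
  bounded_mfun setT ((fun x => \int[nu]_(y in S') F (x, y)) \_ S).
Proof.
rewrite (_ : _ \_ _ = fun x => \int[nu]_y G (x, y)); last first.
  apply/funext => x; rewrite /restrict; case: ifPn => [/set_mem /int1 //|].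
  by move/negP; rewrite inE => /int1' ->.
split; first by apply: measurableT_comp => //; exact: measurable_fubini_F intG.
case: bG => M GM; exists (M * fine (nu setT)) => x _.
apply: ler_norm_Rintegral_bounded => //; split; first exact: measurableT_comp.
by exists M.
Qed.

End Rintegral_Fubini.

(** * Reflections *)

Section reflection.
Context {R : realType} {n : nat}.
Implicit Types u v w x y : 'rV[R]_n.

Lemma dotvC u v : dotv u v = dotv v u.
Proof. by apply: eq_bigr => i _; rewrite mulrC. Qed.

Lemma dotvDl u v w : dotv (u + v) w = dotv u w + dotv v w.
Proof. by rewrite -big_split; apply: eq_bigr => i _; rewrite mxE mulrDl. Qed.

Lemma dotvDr u v w : dotv w (u + v) = dotv w u + dotv w v.
Proof. by rewrite dotvC dotvDl !(dotvC w). Qed.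

Lemma dotvZl a u v : dotv (a *: u) v = a * dotv u v.
Proof. by rewrite mulr_sumr; apply: eq_bigr => i _; rewrite mxE mulrA. Qed.

Lemma dotvZr a u v : dotv u (a *: v) = a * dotv u v.
Proof. by rewrite dotvC dotvZl dotvC. Qed.

Lemma dotvNl u v : dotv (- u) v = - dotv u v.
Proof. by rewrite -scaleN1r dotvZl mulN1r. Qed.

Lemma dotvNr u v : dotv u (- v) = - dotv u v.
Proof. by rewrite dotvC dotvNl dotvC. Qed.

Lemma dotvBl u v w : dotv (u - v) w = dotv u w - dotv v w.
Proof. by rewrite dotvDl dotvNl. Qed.

Lemma dotvBr u v w : dotv w (u - v) = dotv w u - dotv w v.
Proof. by rewrite dotvDr dotvNr. Qed.

Lemma dotv0l u : dotv 0 u = 0.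
Proof. by rewrite -(scale0r 0) dotvZl mul0r. Qed.

Lemma dotv_ge0 u : 0 <= dotv u u.
Proof. by apply: sumr_ge0 => i _; rewrite -expr2 sqr_ge0. Qed.

Lemma dotv_delta u i : dotv (delta_mx 0 i) u = u 0 i.
Proof.
rewrite /dotv (bigD1 i)//= mxE !eqxx mul1r big1 ?addr0// => j ji.
by rewrite mxE (negbTE ji) andbF mul0r.
Qed.

Lemma sum_dotv_delta u : \sum_(i < n) dotv (delta_mx 0 i) u ^+ 2 = dotv u u.
Proof. by apply: eq_bigr => i _; rewrite dotv_delta expr2. Qed.

Lemma sqr_coord_le u i : u 0 i ^+ 2 <= dotv u u.
Proof.
rewrite /dotv (bigD1 i)//= -expr2 lerDl sumr_ge0// => j _.
by rewrite -expr2 sqr_ge0.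
Qed.

Lemma dotv_CS u v : dotv u v ^+ 2 <= dotv u u * dotv v v.
Proof.
have [v0|v0] := eqVneq v 0; first by rewrite v0 dotvC !dotv0l expr0n mulr0.
have vp : 0 < dotv v v by rewrite lt_neqAle eq_sym dotv_eq0 v0 dotv_ge0.
have := dotv_ge0 (dotv v v *: u - dotv u v *: v).
rewrite dotvBl !dotvBr !dotvZl !dotvZr (dotvC v u).
set a := dotv u v; set b := dotv u u; set c := dotv v v in vp *.
rewrite [X in 0 <= X -> _](_ : _ = c * (b * c - a ^+ 2)); last by ring.
by rewrite pmulr_rge0// subr_ge0.
Qed.

(* For [w = 0] the division by zero makes this the identity. *)
Definition refl w y : 'rV[R]_n := y - (2 * dotv y w / dotv w w) *: w.

Lemma dotv_refl w x y : dotv (refl w x) (refl w y) = dotv x y.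
Proof.
have [->|w0] := eqVneq w 0; first by rewrite /refl !scaler0 !subr0.
have wp : dotv w w != 0 by rewrite dotv_eq0.
rewrite /refl dotvBl !dotvBr !dotvZl !dotvZr (dotvC w y).
by field.
Qed.

Lemma reflD w x y : refl w (x + y) = refl w x + refl w y.
Proof.
by rewrite /refl dotvDl mulrDr mulrDl scalerDl opprD addrACA.
Qed.

Lemma reflZ w a y : refl w (a *: y) = a *: refl w y.
Proof.
rewrite /refl dotvZl scalerBr scalerA; congr (_ - _ *: _).
by rewrite mulrCA !mulrA.
Qed.

Lemma reflN w y : refl w (- y) = - refl w y.
Proof. by rewrite -scaleN1r reflZ scaleN1r. Qed.

Lemma reflK w : involutive (refl w).
Proof.
move=> y; have [->|w0] := eqVneq w 0; first by rewrite /refl !scaler0 !subr0.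
have wp : dotv w w != 0 by rewrite dotv_eq0.
rewrite /refl; set k := 2 * dotv y w / dotv w w.
rewrite dotvBl dotvZl (_ : 2 * _ / _ = - k); first by rewrite scaleNr opprK subrK.
by rewrite /k; field.
Qed.

Lemma refl_perp w y : dotv y w = 0 -> refl w y = y.
Proof. by move=> yw; rewrite /refl yw mulr0 mul0r scale0r subr0. Qed.

(** Reflections thus act transitively on each sphere, which is the only form in which rotation
    invariance is used. For [u = v] the mirror direction is 0 and the reflection is the identity, so
    uses need no case distinction. *)
Lemma refl_sub u v : dotv u u = dotv v v -> refl (u - v) u = v.
Proof.
move=> uv; have [e|uv0] := eqVneq u v.
  by rewrite e subrr /refl scaler0 subr0.
rewrite /refl; have -> : 2 * dotv u (u - v) / dotv (u - v) (u - v) = 1.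
  have : dotv (u - v) (u - v) != 0 by rewrite dotv_eq0 subr_eq0.
  rewrite !dotvBl !dotvBr (dotvC v u) -uv => H.
  apply: (canLR (mulfK H)); rewrite mul1r; ring.
by rewrite scale1r opprB addrC subrK.
Qed.

Lemma refl_subr u v : dotv u u = dotv v v -> refl (u - v) v = u.
Proof. by move=> uv; rewrite -{2}(refl_sub uv) reflK. Qed.

Lemma refl_dotvr w x y : dotv x (refl w y) = dotv (refl w x) y.
Proof. by rewrite -{1}(reflK w x) dotv_refl. Qed.

(** The squared norm keeps square roots out of the invariance arguments; [usphere_enorm] gives the
    link with [enorm]. *)
Definition usphere : set 'rV[R]_n := [set x | dotv x x = 1].

Lemma usphere_refl w : refl w @^-1` usphere = usphere.
Proof. by apply/seteqP; split => x; rewrite /usphere /= dotv_refl. Qed.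

Lemma usphereN : -%R @^-1` usphere = usphere.
Proof. by apply/seteqP; split => x; rewrite /usphere /= dotvNl dotvNr opprK. Qed.

Lemma usphere_dotv u v : usphere u -> usphere v -> `|dotv u v| <= 1.
Proof.
rewrite /usphere /= => u1 v1; have := dotv_CS u v; rewrite u1 v1 mul1r.
by move=> h; rewrite -(@ler_pXn2r _ 2) ?nnegrE// real_normK ?num_real// expr1n.
Qed.

End reflection.

(** * The Borel sigma-algebra generated by orthants *)

Section boxes.
Context {R : realType} {n : nat}.

(** Lower bounds alone generate the Borel sets, and two orthants meet in an orthant: this is the
    pi-system to which [bounded_mfun_ind] is applied. *)
Definition orthants : set (set 'rV[R]_n) :=
  [set A | exists c : 'I_n -> R, A = [set x : 'rV[R]_n | forall i, c i < x 0 i]].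

Definition vecT : measurableType _ := g_sigma_algebraType orthants.

Lemma orthants_setI : setI_closed orthants.
Proof.
move=> _ _ [c ->] [c' ->]; exists (fun i => Num.max (c i) (c' i)).
apply/seteqP; split => [x [H H'] i|x H]; first by rewrite gt_max H H'.
by split => i; have := H i; rewrite gt_max => /andP[].
Qed.

Lemma measurable_coord i : measurable_fun setT (fun x : vecT => (x : 'rV[R]_n) 0 i).
Proof.
apply: (measurability _ (RGenOInfty.measurableE R)) => _ [_ [c ->] <-].
(* A coordinate half-space is the union of the orthants whose other bounds are -m. *)
rewrite setTI (_ : _ @^-1` _ = \bigcup_m
   [set x : 'rV[R]_n | forall j, (if j == i then c else - m%:R) < x 0 j]).
  apply: bigcup_measurable => m _; apply: sub_sigma_algebra.
  by exists (fun j => if j == i then c else - m%:R).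
apply/seteqP; split => [x /=|x [m _ /(_ i)]]; last by rewrite eqxx /= in_itv/= andbT.
rewrite in_itv/= andbT => cx.
exists (Num.trunc (\sum_(j < n) `|x 0 j|)).+1 => // j; case: eqP => [->//|_].
rewrite ltrNl; apply: le_lt_trans (truncnS_gt _).
rewrite (bigD1 j)//=; apply: le_trans (ler_norm _) _; rewrite normrN lerDl.
exact: sumr_ge0.
Qed.

Lemma measurable_vecP d (X : measurableType d) (h : X -> vecT) :
  (forall i, measurable_fun setT (fun x => (h x : 'rV[R]_n) 0 i)) -> measurable_fun setT h.
Proof.
move=> mh; apply: (@measurability _ _ _ vecT setT h orthants erefl).
move=> _ [_ [c ->] <-]; rewrite setTI.
rewrite (_ : _ @^-1` _ = \big[setI/setT]_(i < n) [set x | c i < (h x : 'rV[R]_n) 0 i]).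
  apply: bigsetI_measurable => i _.
  rewrite (_ : [set _ | _] = (fun x => (h x : 'rV[R]_n) 0 i) @^-1` `]c i, +oo[%classic).
    by rewrite -[X in measurable X]setTI; apply: mh.
  by apply/seteqP; split => x /=; rewrite in_itv/= andbT.
rewrite -bigcap_seq; apply/seteqP; split => x /= H i; first by move=> _; exact: H.
by apply: (H i); rewrite /= mem_index_enum.
Qed.

Lemma measurable_dotv d (X : measurableType d) (g h : X -> vecT) :
  measurable_fun setT g -> measurable_fun setT h ->
  measurable_fun setT (fun x => dotv (g x : 'rV[R]_n) (h x)).
Proof.
move=> mg mh; apply: measurable_sum => i; apply: measurable_funM.
  exact: (measurableT_comp (measurable_coord i) mg).
exact: (measurableT_comp (measurable_coord i) mh).
Qed.

Lemma measurable_invr : measurable_fun setT (fun x : R => x^-1).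
Proof.
rewrite -(setvU [set 0]); apply/measurable_funU.
- by apply: measurableC; exact: measurable_set1.
- exact: measurable_set1.
split; last exact: measurable_fun_set1.
apply: open_continuous_measurable_fun.
  by rewrite openC; exact: closed_eq.
by move=> x /set_mem/= x0; apply: inv_continuous; apply/eqP.
Qed.

(** Joint measurability in the mirror direction and the point makes the transported equator integral
    accessible to Fubini's theorem. *)
Lemma measurable_refl d (X : measurableType d) (g h : X -> vecT) :
  measurable_fun setT g -> measurable_fun setT h ->
  measurable_fun setT (fun x => refl (g x : 'rV[R]_n) (h x) : vecT).
Proof.
move=> mg mh; apply: measurable_vecP => i.
rewrite (_ : (fun _ => _) = fun x => (h x : 'rV[R]_n) 0 i -
    2 * dotv (h x : 'rV[R]_n) (g x) * (dotv (g x : 'rV[R]_n) (g x))^-1 * (g x : 'rV[R]_n) 0 i); last first.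
  by apply/funext => x; rewrite !mxE.
apply: measurable_funB; first exact: (measurableT_comp (measurable_coord i) mh).
apply: measurable_funM; last exact: (measurableT_comp (measurable_coord i) mg).
apply: measurable_funM.
  by apply: measurable_funM => //; exact: measurable_dotv.
by apply: (measurableT_comp measurable_invr); exact: measurable_dotv.
Qed.

Lemma measurable_reflr w : measurable_fun setT (refl w : vecT -> vecT).
Proof. by apply: (@measurable_refl _ _ (fun=> w) id); first exact: measurable_cst. Qed.

Lemma measurable_subv d (X : measurableType d) (g h : X -> vecT) :
  measurable_fun setT g -> measurable_fun setT h ->
  measurable_fun setT (fun x => (g x : 'rV[R]_n) - h x : vecT).
Proof.
move=> mg mh; apply: measurable_vecP => i.
rewrite (_ : (fun _ => _) = fun x => (g x : 'rV[R]_n) 0 i - (h x : 'rV[R]_n) 0 i); last first.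
  by apply/funext => x; rewrite !mxE.
apply: measurable_funB; first exact: (measurableT_comp (measurable_coord i) mg).
exact: (measurableT_comp (measurable_coord i) mh).
Qed.

Lemma measurable_oppv : measurable_fun setT (fun x : vecT => - (x : 'rV[R]_n) : vecT).
Proof.
apply: measurable_vecP => i.
rewrite (_ : (fun _ => _) = fun x : vecT => - (x : 'rV[R]_n) 0 i); last first.
  by apply/funext => x; rewrite !mxE.
by apply: measurable_funN; exact: measurable_coord.
Qed.

Lemma measurable_usphere : measurable (usphere : set vecT).
Proof.
rewrite (_ : usphere = (fun x : vecT => dotv (x : 'rV[R]_n) x) @^-1` [set 1]).
  by rewrite -[X in measurable X]setTI; apply: measurable_dotv.
by [].
Qed.

End boxes.
Arguments vecT : clear implicits.

(** * Functions on the sphere *)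

Section sphere_functions.
Context {R : realType} {n : nat}.
Implicit Types (a x v : 'rV[R]_n) (psi : 'rV[R]_n -> R).
Local Notation S := (usphere : set (vecT R n)).

Lemma usphere_normrX_le1 x v k : usphere x -> usphere v -> `|dotv x v ^+ k| <= 1.
Proof. by move=> xS vS; rewrite normrX exprn_ile1// usphere_dotv. Qed.

(** For [a != 0] this function is unbounded off the sphere, which is why [bounded_mfun] asks for a
    bound on [S] only, but for measurability everywhere. *)
Lemma bounded_mfun_dotv a : bounded_mfun S (fun v : vecT R n => dotv a v).
Proof.
split; first exact: measurable_dotv.
exists (1 + dotv a a) => v vS; have := dotv_CS a v; rewrite (vS : dotv v v = 1) mulr1.
have := dotv_ge0 a; set d := dotv a v; set c := dotv a a => c0 dc.
by rewrite ler_norml; apply/andP; split; nra.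
Qed.

Lemma bounded_mfun_dotvX a k : bounded_mfun S (fun v : vecT R n => dotv a v ^+ k).
Proof. by apply: bounded_mfunX; exact: bounded_mfun_dotv. Qed.

(** On unit vectors |x - v|^2 = 2 - 2 <x,v>, so this is continuity on the sphere, with closeness
    measured in the same way as the concentration of the kernel <x,v>^(2N). *)
Definition sphere_cont psi := forall x, usphere x -> forall e, 0 < e ->
  exists2 del : R, 0 < del & forall v, usphere v -> 1 - del < dotv x v -> `|psi v - psi x| <= e.

Lemma usphere_dist x v : usphere x -> usphere v -> dotv (x - v) (x - v) = 2 - 2 * dotv x v.
Proof. by move=> x1 v1; rewrite dotvBl !dotvBr (dotvC v x) (x1 : dotv x x = 1) (v1 : dotv v v = 1); ring. Qed.

Lemma sphere_contM f g (M : R) : (forall x, usphere x -> `|f x| <= M) ->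
  (forall x, usphere x -> `|g x| <= M) ->
  sphere_cont f -> sphere_cont g -> sphere_cont (fun x => f x * g x).
Proof.
move=> fM gM cf cg x xS e e0.
have M0 : 0 <= M by apply: le_trans (fM x xS).
have e'0 : 0 < e / (2 * (M + 1)) by rewrite divr_gt0// mulr_gt0// ltr_wpDl.
have [d1 d10 H1] := cf x xS _ e'0; have [d2 d20 H2] := cg x xS _ e'0.
exists (Num.min d1 d2); first by rewrite lt_min d10.
move=> v vS xv.
have {H1} H1 : `|f v - f x| <= e / (2 * (M + 1)).
  by apply: H1 => //; apply: le_lt_trans xv; rewrite lerB// ge_min lexx.
have {H2} H2 : `|g v - g x| <= e / (2 * (M + 1)).
  by apply: H2 => //; apply: le_lt_trans xv; rewrite lerB// ge_min lexx orbT.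
have -> : f v * g v - f x * g x = f v * (g v - g x) + g x * (f v - f x) by ring.
apply: le_trans (ler_normD _ _) _; rewrite !normrM.
have -> : e = M * (e / (2 * (M + 1))) + M * (e / (2 * (M + 1))) + 2 * (e / (2 * (M + 1))).
  by field; lra.
apply: (@le_trans _ _ (M * (e / (2 * (M + 1))) + M * (e / (2 * (M + 1))))); last first.
  by rewrite lerDl mulr_ge0// ltW.
by apply: lerD; apply: ler_pM => //; [exact: fM|exact: gM].
Qed.

Lemma sphere_cont_dotv a : sphere_cont (fun v => dotv a v).
Proof.
(* By Cauchy-Schwarz <a, v - x>^2 <= |a|^2 (2 - 2 <x,v>), which this radius keeps below e^2; the
   summand 1 covers [a = 0]. *)
move=> x xS e e0; exists (e ^+ 2 / (2 * (1 + dotv a a))).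
  by rewrite divr_gt0 ?exprn_gt0// mulr_gt0// ltr_wpDr// dotv_ge0.
move=> v vS xv; rewrite -dotvBr -(@ler_pXn2r _ 2) ?nnegrE ?(ltW e0)// real_normK ?num_real//.
apply: le_trans (dotv_CS _ _) _.
rewrite -opprB dotvNl dotvNr opprK usphere_dist//.
have a0 := dotv_ge0 a; set c := dotv a a in xv a0 *.
have /= : 1 - dotv x v < e ^+ 2 / (2 * (1 + c)) by lra.
rewrite ltr_pdivlMr; last lra.
have : 0 <= 1 - dotv x v by rewrite subr_ge0 (le_trans (ler_norm _))// usphere_dotv.
set t := 1 - dotv x v => t0 ht; have -> : 2 - 2 * dotv x v = 2 * t by rewrite /t; ring.
nra.
Qed.

Lemma sphere_cont_comp psi (h : R -> R) (k : R) :
  (forall s t, `|h s - h t| <= k * `|s - t|) -> sphere_cont psi -> sphere_cont (h \o psi).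
Proof.
move=> hk cp x xS e e0.
have k0 : 0 <= k by have := hk 1 0; rewrite subr0 normr1 mulr1; apply: le_trans.
have [d d0 H] := cp x xS (e / (k + 1)) (divr_gt0 e0 (ltr_wpDl k0 ltr01)).
exists d => // v vS xv; apply: le_trans (hk _ _) _.
apply: le_trans (ler_wpM2l k0 (H v vS xv)) _.
by rewrite mulrCA ger_pMr// ler_pdivrMr ?mul1r ?ltr_wpDl// lerDl.
Qed.

Lemma sphere_cont_cst (c : R) : sphere_cont (fun=> c).
Proof. by move=> x xS e e0; exists 1 => // v _ _; rewrite subrr normr0 ltW. Qed.

Lemma sphere_contX a k : usphere a -> sphere_cont (fun v => dotv a v ^+ k).
Proof.
move=> aS; elim: k => [|k IH]; first exact: sphere_cont_cst.
rewrite (_ : (fun _ => _) = fun v => dotv a v * dotv a v ^+ k); last first.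
  by apply/funext => v; rewrite exprS.
apply: (@sphere_contM _ _ 1) => //; last exact: sphere_cont_dotv.
- by move=> x xS; exact: usphere_dotv.
- by move=> x xS; exact: usphere_normrX_le1.
Qed.

End sphere_functions.

(** * Normalised even powers as an approximate identity *)

Section approximate_identity.
Context {R : realType} {n : nat}.
Variable mu : {finite_measure set (vecT R n) -> \bar R}.
Hypothesis mu_refl : forall w (A : set (vecT R n)), measurable A ->
  mu (refl w @^-1` A) = mu A.
Hypothesis mu_gt0 : mu usphere != 0%E.
Variables (e0 : 'rV[R]_n) (e0S : usphere e0).
Local Notation S := (usphere : set (vecT R n)).
Let mS : measurable S := measurable_usphere.

Lemma Rintegral_refl w f : bounded_mfun S f ->
  \int[mu]_(x in S) f (refl w x) = \int[mu]_(x in S) f x.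
Proof.
move=> bf; apply: (@Rintegral_transform _ _ _ mu S mS (refl w)) => //.
- apply: measurable_refl => //; exact: measurable_cst.
- exact: usphere_refl.
- by move=> A mA; exact: mu_refl.
Qed.

(** The normalising constant of the kernel <x,v>^(2N); by reflection invariance it is the same for
    all unit vectors x ([power_massE]). *)
Definition power_mass (N : nat) : R := \int[mu]_(v in S) dotv e0 v ^+ (2 * N).

Lemma power_massE N x : S x -> \int[mu]_(v in S) dotv x v ^+ (2 * N) = power_mass N.
Proof.
move=> xS; rewrite /power_mass -(@Rintegral_refl (x - e0) (fun v => dotv e0 v ^+ (2 * N))).
  apply: eq_Rintegral => v _; congr (_ ^+ _).
  by rewrite refl_dotvr refl_subr// (xS : dotv x x = 1) e0S.
exact: bounded_mfun_dotvX.
Qed.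

Let cap x (del : R) := S `&` [set v | 1 - del < dotv x v].

Let mcap x del : measurable (cap x del : set (vecT R n)).
Proof.
have -> : cap x del = S `&` (fun v : vecT R n => dotv x v) @^-1` `]1 - del, +oo[%classic.
  by congr setI; apply/seteqP; split => v /=; rewrite in_itv/= andbT.
apply: measurableI => //; rewrite -[X in measurable X]setTI.
exact: measurable_dotv.
Qed.

Let capE x del : S x -> mu (cap x del) = mu (cap e0 del).
Proof.
move=> xS; rewrite -(mu_refl (x - e0) (mcap e0 del)); congr (mu _).
rewrite /cap preimage_setI usphere_refl; congr setI; apply/seteqP; split => v /=;
by rewrite refl_dotvr refl_subr// (xS : dotv x x = 1) e0S.
Qed.

(** All caps of one size have the same measure. A grid cuts the sphere into finitely many cells,
    each inside the cap centred at any of its points, so a null cap would make the whole sphere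
    null. *)
Let cap_gt0 del : 0 < del -> (0 < mu (cap e0 del))%E.
Proof.
move=> d0; rewrite lt0e measure_ge0 andbT; apply/eqP => cap0.
move/eqP : mu_gt0; apply.
(* The squared diameter of a cell, at most n / (N + 1)^2, has to stay below 2 [del], the squared
   chordal radius of the cap. *)
have [N HN] : exists N : nat, n%:R * N.+1%:R^-1 ^+ 2 < 2 * del :> R.
  exists (Num.trunc (n%:R / (2 * del) : R)).
  have := truncnS_gt (n%:R / (2 * del) : R); set m := (Num.trunc _).+1%:R.
  have m1 : 1 <= m :> R by rewrite ler1n.
  have m0 : 0 < m by lra.
  rewrite ltr_pdivrMr ?mulr_gt0// => H.
  rewrite exprVn ltr_pdivrMr ?exprn_gt0//; nra.
(* On the sphere (N + 1) (v_i + 1) ranges over the closed interval from 0 to 2 (N + 1); its right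
   end point accounts for the additional index. *)
pose cell (k : {ffun 'I_n -> 'I_(2 * N.+1).+1}) :=
  [set v : 'rV[R]_n | forall i, (k i)%:R <= N.+1%:R * (v 0 i + 1) < (k i).+1%:R].
have Hcell k : {ae mu, forall v, S v -> ~ cell k v}.
  have [[x [xS xk]]|nx] := pselect (exists x, S x /\ cell k x); last first.
    by apply: aeW => v vS vk; apply: nx; exists v.
  exists (cap x del); split; [exact: mcap|by rewrite capE|].
  move=> v /= /not_implyP[vS /contrapT vk]; split => //=.
  have : dotv (x - v) (x - v) <= n%:R * N.+1%:R^-1 ^+ 2.
    apply: (@le_trans _ _ (\sum_(i < n) N.+1%:R^-1 ^+ 2)); last first.
      by rewrite sumr_const card_ord -[leLHS]mulr_natl.
    apply: ler_sum => i _; rewrite -expr2 !mxE.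
    have := xk i; have := vk i => /andP[a1 a2] /andP[b1 b2].
    have : `|N.+1%:R * (x 0 i - v 0 i)| <= 1 by rewrite ler_norml; apply/andP; split; nra.
    rewrite normrM ger0_norm// -ler_pdivlMl ?ltr0n// mulr1 => h.
    rewrite -[leLHS]real_normK ?num_real//; apply: lerXn2r; rewrite ?nnegrE ?normr_ge0 ?invr_ge0 ?mulr_ge0 ?ler0n//.
  rewrite usphere_dist// => hd; have {hd} := le_lt_trans hd HN.
  by rewrite -/(dotv x v); set t := dotv x v; lra.
have : {ae mu, forall v, forall k, S v -> ~ cell k v} by apply: filter_forall => k; exact: Hcell.
case=> A [mA A0 sA]; apply/eqP; rewrite -measure_le0 -A0; apply: le_measure; rewrite ?inE//.
move=> v vS; apply: sA => /= H.
have hv i : 0 <= N.+1%:R * (v 0 i + 1) < (2 * N.+1).+1%:R.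
  have : v 0 i ^+ 2 <= 1 by rewrite -(vS : dotv v v = 1) sqr_coord_le.
  rewrite -[(2 * N.+1).+1%:R]natr1 natrM => h; have N0 : 0 < N.+1%:R :> R by rewrite ltr0n.
  have /andP[v1 v2] : - 1 <= v 0 i <= 1 by apply/andP; split; nra.
  rewrite mulr_ge0 ?(ltW N0)//=; last lra.
  have v3 : v 0 i + 1 <= 2 by lra.
  have := ler_wpM2l (ltW N0) v3; lra.
have lt (i : 'I_n) : (Num.trunc (N.+1%:R * (v 0 i + 1))%R < (2 * N.+1).+1)%N.
  by have /andP[h0 h1] := hv i; rewrite truncn_lt_nat.
apply: (H [ffun i => Ordinal (lt i)] vS) => i; rewrite ffunE /=.
by have /andP[h0 h1] := hv i; exact: truncn_itv.
Qed.

(** Only the cap around [e0] is kept, and its measure is the constant [c]. The rate 1 - [del] can be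
    chosen as close to 1 as desired, which beats the decay of the kernel off a larger cap in
    [smooth_cvg]. *)
Lemma power_mass_ge (del : R) : 0 < del <= 1 ->
  exists2 c : R, 0 < c & forall N, c * (1 - del) ^+ (2 * N) <= power_mass N.
Proof.
move=> /andP[d0 d1]; exists (fine (mu (cap e0 del))).
  apply: fine_gt0; rewrite cap_gt0//= -ge0_fin_numE// fin_num_measure//; exact: mcap.
move=> N; rewrite mulrC -(@Rintegral_cst _ _ _ mu)//.
rewrite (_ : Rintegral _ _ _ = \int[mu]_(v in S) ((cst ((1 - del) ^+ (2 * N))) \_ [set v | 1 - del < dotv e0 v]) v).
  have bI : bounded_mfun S ((cst ((1 - del) ^+ (2 * N))) \_ [set v : vecT R n | 1 - del < dotv e0 v]).
    split.
      apply/(measurable_restrictT (cst _)) => //.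
      rewrite (_ : [set _ | _] = (fun v : vecT R n => dotv e0 v) @^-1` `]1 - del, +oo[%classic).
        by rewrite -[X in measurable X]setTI; apply: measurable_dotv.
      by apply/seteqP; split => v /=; rewrite in_itv/= andbT.
    exists `|(1 - del) ^+ (2 * N)| => v _; rewrite /restrict; case: ifP => //.
    by rewrite normr0.
  apply: le_Rintegral_bounded => //; first exact: bounded_mfun_dotvX.
  move=> v vS; rewrite /restrict; case: ifPn => [/set_mem/= h|_].
    by rewrite lerXn2r ?nnegrE; lra.
  by rewrite exprM exprn_ge0// sqr_ge0.
by rewrite -Rintegral_mkcondr.
Qed.

Lemma power_mass_gt0 N : 0 < power_mass N.
Proof.
have [|c c0 /(_ N)] := @power_mass_ge (1 / 2); first lra.
by apply: lt_le_trans; rewrite mulr_gt0// exprn_gt0//; lra.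
Qed.

Definition smooth (N : nat) (psi : 'rV[R]_n -> R) (x : 'rV[R]_n) : R :=
  (power_mass N)^-1 * \int[mu]_(v in S) (dotv x v ^+ (2 * N) * psi v).

Let bmX x N f : bounded_mfun S f ->
  bounded_mfun S (fun v : vecT R n => dotv x v ^+ (2 * N) * f v).
Proof. by move=> bf; apply: bounded_mfunM => //; exact: bounded_mfun_dotvX. Qed.

Lemma smooth_bound N psi (M : R) x : measurable_fun setT (psi : vecT R n -> R) ->
  (forall v, S v -> `|psi v| <= M) -> S x -> `|smooth N psi x| <= M.
Proof.
move=> mpsi psiM xS.
have bpsi : bounded_mfun S (psi : vecT R n -> R) by split => //; exists M.
rewrite normrM gtr0_norm ?invr_gt0 ?power_mass_gt0// ler_pdivrMl ?power_mass_gt0//.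
rewrite mulrC -(power_massE N xS) -RintegralZl_bounded//; last exact: bounded_mfun_dotvX.
have bi := bounded_mfun_integrable mu mS (bmX x N bpsi).
apply: le_trans (le_normr_Rintegral mS bi) _.
apply: le_Rintegral_bounded => //.
- case: (bmX x N bpsi) => m1 [M' b1]; split; first exact: measurableT_comp.
  by exists M' => v vS; rewrite normr_id b1.
- by apply: bounded_mfunM; [exact: bounded_mfun_cst|exact: bounded_mfun_dotvX].
- move=> v vS; have p0 : 0 <= dotv x v ^+ (2 * N) by rewrite exprM exprn_ge0// sqr_ge0.
  by rewrite normrM (ger0_norm p0) mulrC ler_wpM2r// psiM.
Qed.

(** The kernel <x,v>^(2N) concentrates at x and at -x alike, hence the restriction to even
    functions. *)
Lemma smooth_cvg psi x : bounded_mfun S (psi : vecT R n -> R) ->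
  (forall v, S v -> psi (- v) = psi v) -> sphere_cont psi -> S x ->
  smooth N psi x @[N --> \oo] --> psi x.
Proof.
move=> bpsi evenpsi cpsi xS; have [mpsi [M psiM]] := bpsi.
have M0 : 0 <= M by apply: le_trans (psiM x xS).
apply/cvgrPdist_le => eps eps0.
have eps20 : 0 < eps / 2 by lra.
have [d' d'0 Hd'] := cpsi x xS _ eps20.
pose d := Num.min d' (1 / 2).
have d0 : 0 < d by rewrite lt_min d'0/=; lra.
have d1 : d <= 1 / 2 by rewrite ge_min lexx orbT.
have dd' : d <= d' by rewrite ge_min lexx.
have [|c c0 Hc] := @power_mass_ge (d / 2); first by apply/andP; split; lra.
(* Off the two caps of size [d] the kernel is at most (1 - d)^(2N), whereas its mass is at least c
   (1 - d/2)^(2N); the quotient is q^N / c. *)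
pose q := ((1 - d) / (1 - d / 2)) ^+ 2.
have q1 : `|q| < 1.
  rewrite normrX exprn_ilt1// ger0_norm ?divr_ge0 ?ltr_pdivrMr; lra.
have key N : `|psi x - smooth N psi x| <= eps / 2 + 2 * M * fine (mu S) / c * q ^+ N.
  have pN := power_mass_gt0 N.
  have -> : psi x - smooth N psi x =
      - ((power_mass N)^-1 * \int[mu]_(v in S) (dotv x v ^+ (2 * N) * (psi v - psi x))).
    rewrite (_ : Rintegral _ _ _ = \int[mu]_(v in S)
        (dotv x v ^+ (2 * N) * psi v - dotv x v ^+ (2 * N) * psi x)); last first.
      by apply: eq_Rintegral => v _; rewrite mulrBr.
    rewrite RintegralB_bounded//; [|exact: bmX|by apply: bmX; exact: bounded_mfun_cst].
    rewrite RintegralZr_bounded//; last exact: bounded_mfun_dotvX.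
    rewrite power_massE// /smooth; field; lra.
  have bB : bounded_mfun S (fun v : vecT R n => psi v - psi x).
    by apply: bounded_mfunB => //; exact: bounded_mfun_cst.
  rewrite normrN normrM gtr0_norm ?invr_gt0// ler_pdivrMl//.
  apply: le_trans (le_normr_Rintegral mS (bounded_mfun_integrable mu mS (bmX x N bB))) _.
  have -> : power_mass N * (eps / 2 + 2 * M * fine (mu S) / c * q ^+ N) =
     eps / 2 * power_mass N + power_mass N * (2 * M * fine (mu S) / c * q ^+ N) by ring.
  apply: (@le_trans _ _ (\int[mu]_(v in S)
      (eps / 2 * dotv x v ^+ (2 * N) + 2 * M * (1 - d) ^+ (2 * N)))).
    apply: le_Rintegral_bounded => //.
    - case: (bmX x N bB) => m1 [M' b1]; split; first exact: measurableT_comp.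
      by exists M' => v vS; rewrite normr_id b1.
    - apply: bounded_mfunD; last exact: bounded_mfun_cst.
      by apply: bounded_mfunM; [exact: bounded_mfun_cst|exact: bounded_mfun_dotvX].
    move=> v vS; rewrite normrM (@ger0_norm _ (_ ^+ (2 * N))); last first.
      by rewrite exprM exprn_ge0// sqr_ge0.
    have p0 : 0 <= dotv x v ^+ (2 * N) by rewrite exprM exprn_ge0// sqr_ge0.
    have p1 : 0 <= (1 - d) ^+ (2 * N) by rewrite exprM exprn_ge0// sqr_ge0.
    have [h|h] := ltP (1 - d) `|dotv x v|.
      rewrite mulrC -[leLHS]addr0 lerD ?mulr_ge0// ler_wpM2r//.
      have [s|s] := leP 0 (dotv x v).
        by apply: Hd' => //; rewrite ger0_norm// in h; lra.
      rewrite -evenpsi//; apply: Hd'; last by rewrite dotvNr; rewrite ltr0_norm// in h; lra.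
      by rewrite -[S _]/((-%R @^-1` S) v) usphereN.
    rewrite -[leLHS]add0r lerD ?mulr_ge0//; first lra.
    rewrite mulrC ler_pM//.
      rewrite (le_trans (ler_normB _ _))// (_ : 2 * M = M + M); last ring.
      by rewrite lerD// psiM.
    by rewrite !exprM lerXn2r ?nnegrE ?sqr_ge0// -[leLHS]real_normK ?num_real// lerXn2r ?nnegrE//; lra.
  rewrite RintegralD_bounded//; last 2 first.
  - by apply: bounded_mfunM; [exact: bounded_mfun_cst|exact: bounded_mfun_dotvX].
  - exact: bounded_mfun_cst.
  rewrite (RintegralZl_bounded mu mS (eps / 2) (bounded_mfun_dotvX x (2 * N))).
  rewrite power_massE// Rintegral_cst// lerD2l.
  have muS0 : 0 <= fine (mu S) by rewrite fine_ge0.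
  apply: le_trans (ler_wpM2r _ (Hc N)); last first.
    apply: mulr_ge0; last by rewrite exprn_ge0 ?sqr_ge0.
    by rewrite divr_ge0 ?(ltW c0)// !mulr_ge0.
  rewrite le_eqVlt; apply/orP; left; apply/eqP.
  rewrite /q -exprM expr_div_n; field; rewrite ?expf_neq0; lra.
near=> N; apply: le_trans (key N) _.
rewrite [leRHS](_ : eps = eps / 2 + eps / 2); last by field.
rewrite lerD2l; near: N.
have : (2 * M * fine (mu S) / c * q ^+ N) @[N --> \oo] --> 2 * M * fine (mu S) / c * 0.
  by apply: cvgMr; exact: cvg_expr.
rewrite mulr0 => /cvgrPdist_le/(_ _ eps20); apply: filterS => N.
by rewrite sub0r normrN; apply: le_trans; exact: ler_norm.
Unshelve. all: by end_near. Qed.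

End approximate_identity.

(** * From continuous to bounded measurable functions *)

Section sphere_induction.
Context {R : realType} {n : nat}.
Local Notation S := (usphere : set (vecT R n)).

Lemma usphere_reflP w (y : 'rV[R]_n) : S (refl w y) <-> S y.
Proof. by rewrite -[S (refl w y)]/((refl w @^-1` usphere) y) usphere_refl. Qed.

Lemma usphereNP (y : 'rV[R]_n) : S (- y) <-> S y.
Proof. by rewrite -[S (- y)]/((-%R @^-1` usphere) y) usphereN. Qed.

Lemma bounded_mfun_oppr (g : 'rV[R]_n -> R) : bounded_mfun S (g : vecT R n -> R) ->
  bounded_mfun S ((fun x => g (- x)) : vecT R n -> R).
Proof.
move=> [mg [M gM]]; split; first exact: (measurableT_comp mg measurable_oppv).
by exists M => x xS; apply: gM; exact/usphereNP.
Qed.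

Lemma sphere_contDN (g : 'rV[R]_n -> R) : sphere_cont g -> sphere_cont (fun x => g x + g (- x)).
Proof.
move=> cg x xS e ep; have e2 : 0 < e / 2 by lra.
have [d1 d10 H1] := cg x xS _ e2.
have [|d2 d20 H2] := cg (- x) _ _ e2; first exact/usphereNP.
exists (Num.min d1 d2); first by rewrite lt_min d10.
move=> v vS xv; rewrite opprD addrACA (le_trans (ler_normD _ _))//.
rewrite [leRHS](_ : e = e / 2 + e / 2); last by field.
apply: lerD; [apply: H1|apply: H2] => //.
- by apply: le_lt_trans xv; rewrite lerB// ge_min lexx.
- exact/usphereNP.
- by rewrite dotvNl dotvNr opprK; apply: le_lt_trans xv; rewrite lerB// ge_min lexx orbT.
Qed.

Let clip (t : R) : R := Num.max 0 (Num.min 1 t).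

Let clip_lip s t : `|clip s - clip t| <= `|s - t|.
Proof.
rewrite /clip; have [s1|s1] := leP 1 s; have [t1|t1] := leP 1 t;
 rewrite ?(max_r (ltW ltr01)) ?subrr ?normr0//.
- by have [t0|t0] := leP 0 t; rewrite !ger0_norm; lra.
- by have [s0|s0] := leP 0 s; rewrite !ler0_norm; lra.
- have [s0|s0] := leP 0 s; have [t0|t0] := leP 0 t => //.
  + by rewrite !ger0_norm; lra.
  + by rewrite !ler0_norm; lra.
  + by rewrite subrr normr0.
Qed.

Let clip01 t : 0 <= clip t <= 1.
Proof. by rewrite /clip le_max lexx/= ge_max ler01/= ge_min lexx. Qed.

(** Continuous functions that converge to the indicator of the open orthant with corner [c] as [m]
    grows. *)
Let ramp (c : 'I_n -> R) (m : nat) (x : 'rV[R]_n) :=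
  \prod_(i < n) clip (m%:R * (x 0 i - c i)).

Let ramp01 c m (r : seq 'I_n) (x : 'rV[R]_n) : 0 <= \prod_(i <- r) clip (m%:R * (x 0 i - c i)) <= 1.
Proof.
elim: r => [|i r /andP[IH1 IH2]]; first by rewrite big_nil ler01 lexx.
have /andP[h1 h2] := clip01 (m%:R * (x 0 i - c i)).
by rewrite big_cons mulr_ge0//= mulr_ile1.
Qed.

Let ramp_cont c m : sphere_cont (ramp c m).
Proof.
rewrite /ramp; elim: (index_enum _) => [|i r IH].
  rewrite (_ : (fun _ => _) = fun=> 1); first exact: sphere_cont_cst.
  by apply/funext => x; rewrite big_nil.
rewrite (_ : (fun _ => _) = fun x : 'rV[R]_n => clip (m%:R * (x 0 i - c i)) *
    \prod_(i <- r) clip (m%:R * (x 0 i - c i))); last first.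
  by apply/funext => x; rewrite big_cons.
apply: (@sphere_contM _ _ _ _ 1) => //.
- by move=> x _; have /andP[h1 h2] := clip01 (m%:R * (x 0 i - c i)); rewrite ger0_norm.
- by move=> x _; have /andP[h1 h2] := ramp01 c m r x; rewrite ger0_norm.
rewrite (_ : (fun _ => _) = (fun t => clip (m%:R * (t - c i))) \o dotv (delta_mx 0 i)).
  apply: (@sphere_cont_comp _ _ _ _ m%:R); last exact: sphere_cont_dotv.
  move=> s t; apply: le_trans (clip_lip _ _) _.
  by rewrite -mulrBr normrM ger0_norm// ler_wpM2l// opprB addrA subrK.
by apply/funext => x /=; rewrite dotv_delta.
Qed.

Let ramp_measurable c m : measurable_fun setT (ramp c m : vecT R n -> R).
Proof.
apply: measurable_prod => i _.
apply: measurable_maxr => //; apply: measurable_minr => //.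
apply: measurable_funM => //; apply: measurable_funB => //; exact: measurable_coord.
Qed.

Let ramp_cvg c x : ramp c m x @[m --> \oo] --> (\1_[set x : 'rV[R]_n | forall i, c i < x 0 i] x : R).
Proof.
rewrite indicE; have [cx|ncx] := pselect (forall i, c i < x 0 i).
  rewrite mem_set//; apply: cvg_near_cst.
  have : \forall m \near \oo, forall i : 'I_n, 1 <= m%:R * (x 0 i - c i).
    apply: filter_forall => i; have d0 : 0 < x 0 i - c i by rewrite subr_gt0.
    near=> m; rewrite -ler_pdivrMr// mul1r.
    by near: m; exact: nbhs_infty_ger.
  apply: filterS => m H; rewrite /ramp big1// => i _.
  by rewrite /clip min_l// max_r.
rewrite memNset//; apply: cvg_near_cst; apply: nearW => m.
have [i ni] := (existsNP _).2 ncx.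
rewrite /ramp (bigD1 i)//= /clip min_r ?max_l ?mul0r//.
  by rewrite mulr_ge0_le0// subr_le0 leNgt; exact/negP.
rewrite (@le_trans _ _ 0)// mulr_ge0_le0// subr_le0 leNgt; exact/negP.
Unshelve. all: by end_near. Qed.

(** The monotone class theorem with continuous generators: ramps approximate the indicators of
    orthants. The bound on the limit [f] follows from the convergence and is handed to the user for
    convenience. *)
Lemma sphere_cont_ind (P : (vecT R n -> R) -> Prop) :
  (forall f : vecT R n -> R, bounded_mfun setT f -> sphere_cont f -> P f) ->
  (forall (a : R) (f g : vecT R n -> R), bounded_mfun setT f -> bounded_mfun setT g ->
     P f -> P g -> P (fun x => f x + a * g x)) ->
  (forall (F : nat -> vecT R n -> R) (f : vecT R n -> R) (M : R),
     (forall m, measurable_fun setT (F m)) ->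
     measurable_fun setT f -> (forall m x, `|F m x| <= M) -> (forall x, `|f x| <= M) ->
     (forall m, P (F m)) -> (forall x, F m x @[m --> \oo] --> f x) -> P f) ->
  forall f, bounded_mfun setT f -> P f.
Proof.
move=> Pcont Plin Plim0.
have Plim (F : nat -> vecT R n -> R) (f : vecT R n -> R) (M : R) :
    (forall m, measurable_fun setT (F m)) -> measurable_fun setT f ->
    (forall m x, `|F m x| <= M) -> (forall m, P (F m)) ->
    (forall x, F m x @[m --> \oo] --> f x) -> P f.
  move=> mF mf FM sF Ff; apply: (Plim0 F f M) => // x.
  apply: (@closed_cvg _ _ \oo _ (fun m => `|F m x|) (fun v => v <= M)).
  - exact: closed_le.
  - by apply: nearW => m; exact: FM.
  - by apply: cvg_norm; exact: Ff.
apply: (@bounded_mfun_ind _ (vecT R n) R orthants P erefl orthants_setI) => //.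
- move=> _ [c ->]; apply: (Plim (ramp c) _ 1).
  + by move=> m; exact: ramp_measurable.
  + by apply: measurable_indic; apply: sub_sigma_algebra; exists c.
  + by move=> m x; have /andP[h1 h2] := ramp01 c m (index_enum _) x; rewrite ger0_norm.
  + move=> m; apply: Pcont; last exact: ramp_cont.
    split; first exact: ramp_measurable.
    by exists 1 => x _; have /andP[h1 h2] := ramp01 c m (index_enum _) x; rewrite ger0_norm.
  + by move=> x; exact: ramp_cvg.
- by apply: Pcont; [exact: bounded_mfun_cst|exact: sphere_cont_cst].
Qed.

End sphere_induction.

(** * Integration over equators *)

Section equator_transform.
Context {R : realType} {n : nat}.
Variables mu sig : {finite_measure set (vecT R n) -> \bar R}.
Local Notation S := (usphere : set (vecT R n)).
Hypothesis mu_refl : forall w (A : set (vecT R n)), measurable A -> mu (refl w @^-1` A) = mu A.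
Hypothesis mu_opp : forall A : set (vecT R n), measurable A -> mu (-%R @^-1` A) = mu A.
Hypothesis mu_gt0 : mu S != 0%E.
Variables (e0 e1 : 'rV[R]_n) (e0S : usphere e0) (e1S : usphere e1) (e10 : dotv e1 e0 = 0).
Hypothesis sig_refl : forall w (A : set (vecT R n)), dotv w e0 = 0 -> measurable A ->
  sig (refl w @^-1` A) = sig A.
Hypothesis sig_opp : forall A : set (vecT R n), measurable A -> sig (-%R @^-1` A) = sig A.
Hypothesis sig_perp : {ae sig, forall y, S y -> dotv y e0 = 0}.
Hypothesis sig_gt0 : sig S != 0%E.

Let mS : measurable S := measurable_usphere.
Local Notation bm := (bounded_mfun S).

(* The integral of [g] over the equator of [u], the measure [sig] of the
   equator of [e0] being transported by the reflection exchanging [e0] and [u]. *)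
Definition equator_int (g : 'rV[R]_n -> R) : 'rV[R]_n -> R :=
  (fun u => \int[sig]_(y in S) g (refl (u - e0) y)) \_ S.

Lemma equator_intE g u : S u ->
  equator_int g u = \int[sig]_(y in S) g (refl (u - e0) y).
Proof. by move=> uS; rewrite /equator_int /restrict mem_set. Qed.

Lemma bounded_mfun_reflr w (g : vecT R n -> R) : bm g -> bm (fun y => g (refl w y)).
Proof.
move=> [mg [M gM]]; split.
  exact: (measurableT_comp mg (measurable_reflr w)).
by exists M => y yS; apply: gM; exact/usphere_reflP.
Qed.

Let bounded_mfun_flag (g : vecT R n -> R) : bm g ->
  bounded_mfun (S `*` S) (fun z : vecT R n * vecT R n => g (refl ((z.1 : 'rV[R]_n) - e0) z.2)).
Proof.
move=> [mg [M gM]]; split.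
  apply: (measurableT_comp mg); apply: measurable_refl => //.
  by apply: measurable_subv => //; exact: measurable_cst.
by exists M => -[u y] [/= uS yS]; apply: gM; exact/usphere_reflP.
Qed.

Lemma bounded_mfun_equator_int g : bm g -> bm (equator_int g : vecT R n -> R).
Proof.
move=> bg; have [mT [M TM]] := bounded_mfun_Rintegral mu sig mS mS (bounded_mfun_flag bg).
by split => //; exists M => x xS; exact: TM.
Qed.

Lemma equator_int_bound g (M : R) u : bm g -> (forall x, S x -> `|g x| <= M) -> S u ->
  `|equator_int g u| <= M * fine (sig S).
Proof.
move=> bg gM uS; rewrite equator_intE//; apply: ler_norm_Rintegral_bounded => //.
  exact: bounded_mfun_reflr.
by move=> x xS; apply: gM; exact/usphere_reflP.
Qed.

Lemma equator_intD f g u : bm f -> bm g -> S u ->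
  equator_int (fun x => f x + g x) u = equator_int f u + equator_int g u.
Proof.
move=> bf bg uS; rewrite !equator_intE//.
by rewrite RintegralD_bounded//; exact: bounded_mfun_reflr.
Qed.

Lemma equator_intZ c f u : bm f -> S u ->
  equator_int (fun x => c * f x) u = c * equator_int f u.
Proof.
move=> bf uS; rewrite !equator_intE//.
by rewrite (RintegralZl_bounded sig mS c (bounded_mfun_reflr (u - e0) bf)).
Qed.

Lemma eq_equator_int f g u : S u -> (forall x, S x -> f x = g x) ->
  equator_int f u = equator_int g u.
Proof.
move=> uS fg; rewrite !equator_intE//; apply: eq_Rintegral => y /set_mem yS.
by apply: fg; exact/usphere_reflP.
Qed.

Lemma equator_intN g u : bm g -> S u -> equator_int (fun x => g (- x)) u = equator_int g u.
Proof.
move=> bg uS; rewrite !equator_intE//.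
rewrite -(@Rintegral_transform _ _ _ sig S mS -%R (fun y => g (refl (u - e0) y))).
- by apply: eq_Rintegral => y _; rewrite reflN.
- exact: measurable_oppv.
- exact: usphereN.
- by move=> A mA; exact: sig_opp.
- exact: bounded_mfun_reflr.
Qed.

Lemma equator_int_cvg (F : nat -> 'rV[R]_n -> R) f (M : R) u :
  (forall k, measurable_fun setT (F k : vecT R n -> R)) ->
  measurable_fun setT (f : vecT R n -> R) ->
  (forall k x, S x -> `|F k x| <= M) ->
  (forall x, S x -> F k x @[k --> \oo] --> f x) -> S u ->
  equator_int (F k) u @[k --> \oo] --> equator_int f u.
Proof.
move=> mF mf FM Ff uS; rewrite equator_intE//.
under eq_fun do rewrite equator_intE//.
have mr : measurable_fun setT (refl (u - e0) : vecT R n -> vecT R n).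
  exact: measurable_reflr.
apply: (@Rintegral_bounded_cvg _ _ _ sig S mS _ _ M).
- by move=> k; exact: (measurableT_comp (mF k) mr).
- exact: (measurableT_comp mf mr).
- by move=> k x xS; apply: FM; exact/usphere_reflP.
- by move=> x xS; apply: Ff; exact/usphere_reflP.
Qed.

(** The constant m_k; by [sig_moment] any unit vector orthogonal to [e0] may replace [e1]. *)
Definition equator_moment k : R := \int[sig]_(y in S) dotv e1 y ^+ (2 * k).

(** By homogeneity p may be taken of length 1. The reflection exchanging it with [e1] has its mirror
    direction orthogonal to [e0], hence preserves [sig]. *)
Let sig_moment p k : dotv p e0 = 0 ->
  \int[sig]_(y in S) dotv p y ^+ (2 * k) = dotv p p ^+ k * equator_moment k.
Proof.
move=> pe0; have [p0|p0] := eqVneq p 0.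
  rewrite p0 dotv0l; case: k => [|k].
    by rewrite mul1r; apply: eq_Rintegral => y _; rewrite !expr0.
  rewrite expr0n mul0r (_ : Rintegral _ _ _ = \int[sig]_(y in S) 0).
    by rewrite Rintegral_cst// mul0r.
  by apply: eq_Rintegral => y _; rewrite dotv0l exprM expr0n/= expr0n.
have pp : 0 < dotv p p by rewrite lt_neqAle eq_sym dotv_eq0 p0 dotv_ge0.
pose r := Num.sqrt (dotv p p); have r0 : 0 < r by rewrite sqrtr_gt0.
have rr : r ^+ 2 = dotv p p by rewrite sqr_sqrtr// ltW.
pose x := r^-1 *: p.
have xS : dotv x x = 1 by rewrite dotvZl dotvZr -rr; field; rewrite lt0r_neq0.
have -> : p = r *: x by rewrite scalerA mulfV ?scale1r// lt0r_neq0.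
have xe0 : dotv (x - e1) e0 = 0 by rewrite dotvBl e10 dotvZl pe0 mulr0 subr0.
rewrite dotvZl dotvZr xS mulr1 -expr2 -exprM.
rewrite -RintegralZl_bounded//; last exact: bounded_mfun_dotvX.
have bx := bounded_mfun_dotvX (r *: x) (2 * k).
rewrite -(@Rintegral_transform _ _ _ sig S mS (refl (x - e1)) _ _ _ _ bx).
- apply: eq_Rintegral => y _; rewrite dotvZl exprMn; congr (_ * _ ^+ _).
  by rewrite refl_dotvr refl_sub// xS e1S.
- by apply: measurable_refl => //; exact: measurable_cst.
- exact: usphere_refl.
- by move=> A mA; exact: sig_refl.
Qed.

(** Carried back to the equator of [e0], the vector [a] becomes [b], of which only the component [p]
    orthogonal to [e0] is seen there; its squared length is |a|^2 - <a,u>^2. *)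
Lemma equator_int_dotvX a u k : S u ->
  equator_int (fun y => dotv a y ^+ (2 * k)) u =
  (dotv a a - dotv a u ^+ 2) ^+ k * equator_moment k.
Proof.
move=> uS; rewrite equator_intE//.
have ue : dotv u u = dotv e0 e0 by rewrite (uS : dotv u u = 1) e0S.
set b := refl (u - e0) a; pose p := b - dotv b e0 *: e0.
have be0 : dotv b e0 = dotv a u by rewrite -refl_dotvr refl_subr.
have pe0 : dotv p e0 = 0 by rewrite dotvBl dotvZl (e0S : dotv e0 e0 = 1) mulr1 subrr.
have pp : dotv p p = dotv a a - dotv a u ^+ 2.
  rewrite {2}/p dotvBr dotvZr pe0 mulr0 subr0 dotvBl dotvZl (dotvC e0) be0.
  by rewrite dotv_refl expr2.
rewrite -pp -(sig_moment _ pe0).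
apply: Rintegral_ae_eq_bounded => //.
- rewrite (_ : (fun _ => _) = fun x : vecT R n => dotv b x ^+ (2 * k)).
    exact: bounded_mfun_dotvX.
  by apply/funext => y; rewrite refl_dotvr.
- exact: bounded_mfun_dotvX.
apply: filterS sig_perp => y H yS; rewrite refl_dotvr -/b.
have -> : dotv p y = dotv b y - dotv b e0 * dotv e0 y by rewrite -dotvZl -dotvBl.
by rewrite (dotvC e0) H// mulr0 subr0.
Qed.

Lemma equator_int1 u : S u -> equator_int (fun=> 1) u = equator_moment 0.
Proof.
move=> uS; rewrite equator_intE//; apply: eq_Rintegral => y _; by rewrite mulr1n expr0.
Qed.

Lemma equator_moment_ge0 k : 0 <= equator_moment k.
Proof. by apply: Rintegral_ge0 => y yS; rewrite exprM exprn_ge0// sqr_ge0. Qed.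

Lemma equator_momentS_le k : equator_moment k.+1 <= equator_moment k.
Proof.
apply: le_Rintegral_bounded => //; try exact: bounded_mfun_dotvX.
move=> y yS; rewrite !exprM exprS; apply: ler_piMl; first by rewrite exprn_ge0 ?sqr_ge0.
by rewrite -[leLHS]real_normK ?num_real// exprn_ile1// usphere_dotv.
Qed.

Lemma equator_moment0_gt0 : 0 < equator_moment 0.
Proof.
rewrite /equator_moment (_ : Rintegral _ _ _ = \int[sig]_(y in S) 1).
  rewrite Rintegral_cst// mul1r fine_gt0// lt0e sig_gt0 measure_ge0/=.
  by rewrite -ge0_fin_numE// fin_num_measure.
by apply: eq_Rintegral => y _; rewrite expr0.
Qed.

Let sum_moment k : \int[sig]_(y in S) (\sum_(i < n) dotv (delta_mx 0 i) y ^+ (2 * k)) =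
  equator_moment k * \sum_(i < n) (1 - e0 0 i ^+ 2) ^+ k.
Proof.
rewrite Rintegral_sum_bounded//; last by move=> i; exact: bounded_mfun_dotvX.
rewrite mulr_sumr; apply: eq_bigr => i _.
(* For [u = e0] the mirror direction is 0, so the transported measure is [sig] itself. *)
have := equator_int_dotvX (delta_mx 0 i) k e0S; rewrite equator_intE// subrr.
rewrite [in RHS]dotv_delta mxE !eqxx [dotv _ e0]dotv_delta mulrC => <-.
by apply: eq_Rintegral => y _; rewrite /refl scaler0 subr0.
Qed.

(** Some squared coordinate of a unit vector is at least 1/n, so the sum in [sum_moment] has an
    integrand bounded below by n^(-k); it would vanish if m_k did. *)
Lemma equator_moment_gt0 k : 0 < equator_moment k.
Proof.
rewrite lt_neqAle equator_moment_ge0 andbT eq_sym; apply/eqP => mk0.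
have := sum_moment k; rewrite mk0 mul0r; apply/eqP; rewrite gt_eqF//.
have n0 : (0 < n)%N.
  case: (posnP n) => // n0; have := e0S; rewrite /usphere/= /dotv big1.
    by move/eqP; rewrite eq_sym oner_eq0.
  by move=> [i /= ilt]; exfalso; rewrite n0 in ilt.
have np : 0 < n%:R :> R by rewrite ltr0n.
apply: (@lt_le_trans _ _ (\int[sig]_(y in S) ((n%:R^-1 ^+ k) * 1))).
  rewrite RintegralZl_bounded//; last exact: bounded_mfun_cst.
  rewrite mulr_gt0 ?exprn_gt0 ?invr_gt0//.
  rewrite (_ : Rintegral _ _ _ = equator_moment 0) ?equator_moment0_gt0//.
apply: le_Rintegral_bounded => //; first exact: bounded_mfun_cst.
  by apply: bounded_mfun_sum => i; exact: bounded_mfun_dotvX.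
move=> y yS; rewrite mulr1.
have [i hi] : exists i, n%:R^-1 <= dotv (delta_mx 0 i) y ^+ 2.
  apply: contrapT => /forallNP H.
  have : \sum_(i < n) dotv (delta_mx 0 i) y ^+ 2 < \sum_(i < n) n%:R^-1.
    apply: ltr_sum => [|i _]; last by rewrite ltNge; apply/negP/H.
    by apply/hasP; exists (Ordinal n0) => //; rewrite mem_index_enum.
  rewrite sum_dotv_delta (yS : dotv y y = 1) sumr_const card_ord -[X in _ < X]mulr_natl.
  by rewrite mulfV ?ltxx// gt_eqF.
rewrite (bigD1 i)//= -[leLHS]addr0 lerD//.
  by rewrite exprM lerXn2r ?nnegrE ?invr_ge0 ?ler0n ?sqr_ge0.
by apply: sumr_ge0 => j _; rewrite exprM exprn_ge0// sqr_ge0.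
Qed.

(** A trace: the squared coordinates of [y] sum to 1, while the numbers 1 - e0_i^2 sum to n - 1. *)
Lemma equator_moment1 : equator_moment 0 = (n%:R - 1) * equator_moment 1.
Proof.
have := sum_moment 1; rewrite mulrC (eq_bigr (fun i => 1 - e0 0 i ^+ 2)); last first.
  by move=> i _; rewrite expr1.
rewrite sumrB sumr_const card_ord (_ : \sum_(i < n) e0 0 i ^+ 2 = 1); last first.
  by rewrite -[RHS](e0S : dotv e0 e0 = 1); apply: eq_bigr => i _; rewrite expr2.
move=> <-; apply: eq_Rintegral => y /set_mem yS.
by rewrite expr0 muln1 sum_dotv_delta (yS : dotv y y = 1).
Qed.

Local Notation c_ := (power_mass mu e0).

Definition sphere_smooth N (g : 'rV[R]_n -> R) : 'rV[R]_n -> R := smooth mu e0 N g \_ S.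

Let bounded_mfun_fst (f : vecT R n -> R) : bm f ->
  bounded_mfun (S `*` S) (fun z : vecT R n * vecT R n => f z.1).
Proof.
move=> [mf [M fM]]; split; first exact: measurableT_comp.
by exists M => -[x y] [/= xS _]; exact: fM.
Qed.

Let bounded_mfun_snd (f : vecT R n -> R) : bm f ->
  bounded_mfun (S `*` S) (fun z : vecT R n * vecT R n => f z.2).
Proof.
move=> [mf [M fM]]; split; first exact: measurableT_comp.
by exists M => -[x y] [/= _ yS]; exact: fM.
Qed.

Let bounded_mfun_dotv2 :
  bounded_mfun (S `*` S) (fun z : vecT R n * vecT R n => dotv (z.1 : 'rV[R]_n) z.2).
Proof.
split; first exact: measurable_dotv.
by exists 1 => -[x y] [/= xS yS]; exact: usphere_dotv.
Qed.

Lemma bounded_mfun_sphere_smooth N g : bm (g : vecT R n -> R) ->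
  bm (sphere_smooth N g : vecT R n -> R).
Proof.
move=> bg.
have bF : bounded_mfun (S `*` S) (fun z : vecT R n * vecT R n =>
    (dotv (z.1 : 'rV[R]_n) z.2) ^+ (2 * N) * g z.2).
  by apply: bounded_mfunM; [exact: bounded_mfunX|exact: bounded_mfun_snd].
have [mT [M TM]] := bounded_mfun_Rintegral mu mu mS mS bF.
have -> : sphere_smooth N g = fun x : vecT R n => (c_ N)^-1 *
    ((fun x : vecT R n => \int[mu]_(y in S) (dotv x y ^+ (2 * N) * g y)) \_ S) x.
  by apply/funext => x; rewrite /sphere_smooth /restrict; case: ifP; rewrite ?mulr0.
apply: bounded_mfunM; first exact: bounded_mfun_cst.
by split => //; exists M => x _; exact: TM.
Qed.

(** The equator integral over [x], at [u], of the normalised kernel <x,v>^(2N), in the closed form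
    given by [equator_int_dotvX]. *)
Let kern N (u v : 'rV[R]_n) := (c_ N)^-1 * ((1 - dotv u v ^+ 2) ^+ N * equator_moment N).

Let equator_int_smooth N g u : bm (g : vecT R n -> R) -> S u ->
  equator_int (sphere_smooth N g) u = \int[mu]_(v in S) (g v * kern N u v).
Proof.
move=> bg uS; rewrite (@eq_equator_int _ (smooth mu e0 N g))//; last first.
  by move=> x xS; rewrite /sphere_smooth /restrict mem_set.
rewrite equator_intE//.
pose r y : vecT R n := refl (u - e0) y.
have mr : measurable_fun setT (r : vecT R n -> vecT R n) by exact: measurable_reflr.
have bF : bounded_mfun (S `*` S) (fun z : vecT R n * vecT R n =>
    (c_ N)^-1 * (dotv (r z.1 : 'rV[R]_n) z.2 ^+ (2 * N) * g z.2)).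
  apply: bounded_mfunM; first exact: bounded_mfun_cst.
  apply: bounded_mfunM; last exact: bounded_mfun_snd.
  apply: bounded_mfunX; split.
    by apply: measurable_dotv => //; exact: (measurableT_comp mr).
  by exists 1 => -[x y] [/= xS yS]; apply: usphere_dotv => //; exact/usphere_reflP.
transitivity (\int[sig]_(y in S) \int[mu]_(v in S)
    ((c_ N)^-1 * (dotv (r y) v ^+ (2 * N) * g v))).
  apply: eq_Rintegral => y _; rewrite (RintegralZl_bounded mu mS)//.
  by apply: bounded_mfunM => //; exact: bounded_mfun_dotvX.
rewrite (Rintegral_Fubini sig mu mS mS bF); apply: eq_Rintegral => v /set_mem vS /=.
transitivity ((c_ N)^-1 * g v * \int[sig]_(y in S) (dotv v (r y) ^+ (2 * N))).
  rewrite -RintegralZl_bounded//.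
    by apply: eq_Rintegral => y _; rewrite (dotvC v); ring.
  exact: (bounded_mfun_reflr _ (bounded_mfun_dotvX v (2 * N))).
rewrite -(equator_intE (fun y => dotv v y ^+ (2 * N)) uS) equator_int_dotvX//.
rewrite (vS : dotv v v = 1) (dotvC v) /kern; ring.
Qed.

Let bounded_mfun_kern N : bounded_mfun (S `*` S)
  (fun z : vecT R n * vecT R n => kern N z.1 z.2).
Proof.
apply: bounded_mfunM; first exact: bounded_mfun_cst.
apply: bounded_mfunM; last exact: bounded_mfun_cst.
apply: bounded_mfunX; apply: bounded_mfunB; first exact: bounded_mfun_cst.
exact: bounded_mfunX.
Qed.

Let bounded_mfun_kernr N u : S u -> bm (fun v : vecT R n => kern N u v).
Proof.
move=> uS; apply: bounded_mfunM; first exact: bounded_mfun_cst.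
apply: bounded_mfunM; last exact: bounded_mfun_cst.
apply: bounded_mfunX; apply: bounded_mfunB; first exact: bounded_mfun_cst.
exact: bounded_mfun_dotvX.
Qed.

(* The averaged kernel depends on [u] and [v] through [dotv u v] only, hence is
   symmetric. *)
Let equator_int_symm_smooth N f g : bm (f : vecT R n -> R) -> bm (g : vecT R n -> R) ->
  \int[mu]_(u in S) (f u * equator_int (sphere_smooth N g) u) =
  \int[mu]_(u in S) (g u * equator_int (sphere_smooth N f) u).
Proof.
move=> bf bg.
transitivity (\int[mu]_(u in S) \int[mu]_(v in S) (f u * (g v * kern N u v))).
  apply: eq_Rintegral => u /set_mem uS; rewrite equator_int_smooth//.
  rewrite RintegralZl_bounded//; apply: bounded_mfunM => //; exact: bounded_mfun_kernr.
have bF : bounded_mfun (S `*` S)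
    (fun z : vecT R n * vecT R n => f z.1 * (g z.2 * kern N z.1 z.2)).
  apply: bounded_mfunM; first exact: bounded_mfun_fst.
  by apply: bounded_mfunM => //; exact: bounded_mfun_snd.
rewrite (Rintegral_Fubini mu mu mS mS bF).
apply: eq_Rintegral => v /set_mem vS; rewrite equator_int_smooth//=.
rewrite -RintegralZl_bounded//.
  by apply: eq_Rintegral => u _; rewrite /kern (dotvC v); ring.
apply: bounded_mfunM => //; exact: bounded_mfun_kernr.
Qed.

(** Both sides are limits of their smoothed versions, which agree for every N. Evenness is needed
    for the smoothing to converge to the function. *)
Let equator_int_symm_cont f g : bm (f : vecT R n -> R) -> bm (g : vecT R n -> R) ->
  (forall v, S v -> f (- v) = f v) -> (forall v, S v -> g (- v) = g v) ->
  sphere_cont f -> sphere_cont g ->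
  \int[mu]_(u in S) (f u * equator_int g u) = \int[mu]_(u in S) (g u * equator_int f u).
Proof.
move: f g; have cv f g : bm (f : vecT R n -> R) -> bm (g : vecT R n -> R) ->
    (forall v, S v -> g (- v) = g v) -> sphere_cont g ->
    \int[mu]_(u in S) (f u * equator_int (sphere_smooth N g) u) @[N --> \oo] -->
    \int[mu]_(u in S) (f u * equator_int g u).
  move=> bf bg eg cg; have [mf [Mf fM]] := bf; have [mg [Mg gM]] := bg.
  have sM N x : S x -> `|sphere_smooth N g x| <= Mg.
    by move=> xS; rewrite /sphere_smooth /restrict mem_set//; exact: smooth_bound.
  apply: (@Rintegral_bounded_cvg _ _ _ mu S mS _ _ (Mf * (Mg * fine (sig S)))) => //.
  - move=> N; apply: measurable_funM => //.
    by have [] := bounded_mfun_equator_int (bounded_mfun_sphere_smooth N bg).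
  - by apply: measurable_funM => //; have [] := bounded_mfun_equator_int bg.
  - move=> N x xS; rewrite normrM ler_pM// ?fM//.
    by apply: equator_int_bound => //; [exact: bounded_mfun_sphere_smooth|exact: sM].
  - move=> x xS; apply: cvgMr; apply: (@equator_int_cvg _ _ Mg) => //.
    + by move=> N; have [] := bounded_mfun_sphere_smooth N bg.
    + move=> y yS; rewrite /sphere_smooth /restrict mem_set//.
      exact: smooth_cvg.
move=> f g bf bg ef eg cf cg; apply: (cvg_unique _ (cv f g bf bg eg cg)) => //.
have H := cv g f bg bf ef cf.
by apply: cvg_trans H; apply: near_eq_cvg; apply: nearW => N; exact: equator_int_symm_smooth.
Qed.

Section symmetry.
Variables (a : 'rV[R]_n) (k : nat) (aS : usphere a).
Let phi (u : 'rV[R]_n) : R := dotv a u ^+ (2 * k).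
Let bphi : bm (phi : vecT R n -> R). Proof. exact: bounded_mfun_dotvX. Qed.
(** One function stays an even power, whose transform is explicit and even; only [g] is generalised,
    from even continuous to bounded measurable. *)
Let symm (g : 'rV[R]_n -> R) := \int[mu]_(u in S) (phi u * equator_int g u) =
  \int[mu]_(u in S) (g u * equator_int phi u).

Let symmD (c : R) f g : bm (f : vecT R n -> R) -> bm (g : vecT R n -> R) ->
  symm f -> symm g -> symm (fun x => f x + c * g x).
Proof.
move=> bf bg sf sg; rewrite /symm.
have bT h : bm (h : vecT R n -> R) -> bm (fun u : vecT R n => phi u * equator_int h u).
  by move=> bh; exact: (bounded_mfunM bphi (bounded_mfun_equator_int bh)).
have bT' h : bm (h : vecT R n -> R) -> bm (fun u : vecT R n => h u * equator_int phi u).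
  by move=> bh; exact: (bounded_mfunM bh (bounded_mfun_equator_int bphi)).
have bcg : bm (fun x : vecT R n => c * g x).
  exact: (bounded_mfunM (bounded_mfun_cst S c) bg).
have bcT : bm (fun u : vecT R n => c * (phi u * equator_int g u)).
  exact: (bounded_mfunM (bounded_mfun_cst S c) (bT g bg)).
have bcT' : bm (fun u : vecT R n => c * (g u * equator_int phi u)).
  exact: (bounded_mfunM (bounded_mfun_cst S c) (bT' g bg)).
have E u : S u -> phi u * equator_int (fun x => f x + c * g x) u =
    phi u * equator_int f u + c * (phi u * equator_int g u).
  by move=> uS; rewrite (equator_intD bf bcg uS) (equator_intZ c bg uS); ring.
rewrite (@eq_Rintegral _ _ _ mu S (fun u => phi u * equator_int f u + c * (phi u * equator_int g u))); last first.
  by move=> u /set_mem /E.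
rewrite (RintegralD_bounded mu mS (bT f bf) bcT) (RintegralZl_bounded mu mS c (bT g bg)).
rewrite /symm in sf sg; rewrite sf sg.
rewrite -(RintegralZl_bounded mu mS c (bT' g bg)) -(RintegralD_bounded mu mS (bT' f bf) bcT').
by apply: eq_Rintegral => u _; ring.
Qed.

(** Replacing [g] by g(x) + g(-x) doubles both sides: on the left since an equator is symmetric, on
    the right since the transform of [phi] is even. *)
Let symm_cont g : bm (g : vecT R n -> R) -> sphere_cont g -> symm g.
Proof.
move=> bg cg.
have bgN := bounded_mfun_oppr bg.
pose h x := g x + g (- x).
have bh : bm (h : vecT R n -> R) by exact: bounded_mfunD.
have sh : symm h.
  apply: equator_int_symm_cont => //.
  - by move=> v _; rewrite /phi dotvNr exprM sqrrN -exprM.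
  - by move=> v _; rewrite /h opprK addrC.
  - exact: sphere_contX.
  - exact: sphere_contDN.
have hL : \int[mu]_(u in S) (phi u * equator_int h u) =
    2 * \int[mu]_(u in S) (phi u * equator_int g u).
  rewrite -(RintegralZl_bounded mu mS 2 (bounded_mfunM bphi (bounded_mfun_equator_int bg))).
  apply: eq_Rintegral => u /set_mem uS.
  rewrite (equator_intD bg bgN uS) (equator_intN bg uS); ring.
have hR : \int[mu]_(u in S) (h u * equator_int phi u) =
    2 * \int[mu]_(u in S) (g u * equator_int phi u).
  transitivity (\int[mu]_(u in S) (g u * equator_int phi u) +
                \int[mu]_(u in S) (g (- u) * equator_int phi u)).
    rewrite -(RintegralD_bounded mu mS (bounded_mfunM bg (bounded_mfun_equator_int bphi))
      (bounded_mfunM bgN (bounded_mfun_equator_int bphi))).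
    by apply: eq_Rintegral => u _; rewrite mulrDl.
  have bgT := bounded_mfunM bg (bounded_mfun_equator_int bphi).
  have T := Rintegral_transform mS measurable_oppv usphereN (fun A mA => mu_opp mA) bgT.
  have E : \int[mu]_(u in S) (g (- u) * equator_int phi u) =
      \int[mu]_(u in S) (g u * equator_int phi u).
    apply: (etrans _ T); apply: eq_Rintegral => u /set_mem uS /=.
    have := equator_int_dotvX a k (proj2 (usphereNP u) uS).
    by rewrite dotvNr sqrrN -(equator_int_dotvX a k uS) => ->.
  by rewrite E -mulr2n mulr_natl.
have two : 2 != 0 :> R by rewrite pnatr_eq0.
exact: (mulfI two (etrans (esym hL) (etrans sh hR))).
Qed.

Let symm_bounded g : bounded_mfun setT (g : vecT R n -> R) -> symm g.
Proof.
have sT (h : vecT R n -> R) : bounded_mfun setT h -> bm h.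
  by move=> [mh [M hM]]; split => //; exists M => x _; exact: hM.
apply: (@sphere_cont_ind R n symm).
- by move=> f /sT; exact: symm_cont.
- by move=> c f h /sT bf /sT bh; exact: symmD.
move=> F f M mF mf FM fM sF Ff.
have bf : bm f by split => //; exists M.
have bF m : bm (F m) by split => //; exists M.
have [mphi [Mp pM]] := bphi.
have [mT [MT TM]] := bounded_mfun_equator_int bphi.
have L1 : \int[mu]_(u in S) (phi u * equator_int (F m) u) @[m --> \oo] -->
    \int[mu]_(u in S) (phi u * equator_int f u).
  apply: (@Rintegral_bounded_cvg _ _ _ mu S mS _ _ (Mp * (M * fine (sig S)))) => //.
  - by move=> m; apply: measurable_funM => //; have [] := bounded_mfun_equator_int (bF m).
  - by apply: measurable_funM => //; have [] := bounded_mfun_equator_int bf.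
  - move=> m x xS; rewrite normrM ler_pM// ?pM//; exact: equator_int_bound.
  - by move=> x xS; apply: cvgMr; exact: (@equator_int_cvg _ _ M).
have L2 : \int[mu]_(u in S) (F m u * equator_int phi u) @[m --> \oo] -->
    \int[mu]_(u in S) (f u * equator_int phi u).
  apply: (@Rintegral_bounded_cvg _ _ _ mu S mS _ _ (M * MT)) => //.
  - by move=> m; exact: measurable_funM.
  - exact: measurable_funM.
  - by move=> m x xS; rewrite normrM ler_pM// ?TM.
  - by move=> x xS; apply: cvgMl; exact: Ff.
have L3 : \int[mu]_(u in S) (phi u * equator_int (F m) u) @[m --> \oo] -->
    \int[mu]_(u in S) (f u * equator_int phi u).
  by apply: cvg_trans L2; apply: near_eq_cvg; apply: nearW => m; exact: esym (sF m).
by rewrite /symm; exact: (cvg_unique _ L1 L3).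
Qed.

Lemma equator_int_dual g : bm (g : vecT R n -> R) ->
  \int[mu]_(u in S) (dotv a u ^+ (2 * k) * equator_int g u) =
  equator_moment k * \int[mu]_(y in S) (g y * (1 - dotv a y ^+ 2) ^+ k).
Proof.
move=> bg; have [mg [M gM]] := bg.
(* [symm_bounded] asks for a bound on the whole space; both integrals see the values on [S] only. *)
have : symm (g \_ S).
  apply: symm_bounded; split.
    by apply/(measurable_restrictT g) => //; exact: measurable_funTS.
  exists `|M| => x _; rewrite /restrict; case: ifPn => [/set_mem xS|_].
    by rewrite (le_trans (gM x xS))// ler_norm.
  by rewrite normr0.
have gS x : S x -> (g \_ S) x = g x by move=> xS; rewrite /restrict mem_set.
rewrite /symm.
rewrite (@eq_Rintegral _ _ _ mu S (fun u => dotv a u ^+ (2 * k) * equator_int g u)); last first.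
  by move=> u /set_mem uS; congr (_ * _); exact: eq_equator_int.
move=> ->; rewrite -RintegralZl_bounded//.
  apply: eq_Rintegral => y /set_mem yS; rewrite gS// equator_int_dotvX// (aS : dotv a a = 1).
  ring.
apply: bounded_mfunM => //; apply: bounded_mfunX; apply: bounded_mfunB.
  exact: bounded_mfun_cst.
exact: bounded_mfun_dotvX.
Qed.

End symmetry.

End equator_transform.

(** * Even moments *)

Section moment_uniqueness.
Context {R : realType} {n : nat}.
Variable mu : {finite_measure set (vecT R n) -> \bar R}.
Local Notation S := (usphere : set (vecT R n)).
Hypothesis mu_refl : forall w (A : set (vecT R n)), measurable A -> mu (refl w @^-1` A) = mu A.
Hypothesis mu_opp : forall A : set (vecT R n), measurable A -> mu (-%R @^-1` A) = mu A.
Hypothesis mu_gt0 : mu S != 0%E.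
Variables (e0 : 'rV[R]_n) (e0S : usphere e0).
Let mS : measurable S := measurable_usphere.
Local Notation bm := (bounded_mfun S).

Variable g : 'rV[R]_n -> R.
Hypotheses (bg : bm (g : vecT R n -> R)) (even_g : forall v, S v -> g (- v) = g v).
Hypothesis g0 : forall a N, S a -> \int[mu]_(y in S) (g y * dotv a y ^+ (2 * N)) = 0.

(** Exchanging the integrals makes the inner one a moment of [g], which is 0 by [g0]. *)
Let orth_smooth N psi : bm (psi : vecT R n -> R) ->
  \int[mu]_(x in S) (g x * sphere_smooth mu e0 N psi x) = 0.
Proof.
move=> bpsi.
have bF : bounded_mfun (S `*` S) (fun z : vecT R n * vecT R n =>
    g z.1 * ((power_mass mu e0 N)^-1 * (dotv (z.1 : 'rV[R]_n) z.2 ^+ (2 * N) * psi z.2))).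
  apply: bounded_mfunM.
    have [mg [M gM]] := bg; split; first exact: (measurableT_comp mg).
    by exists M => -[x y] [/= xS _]; exact: gM.
  apply: bounded_mfunM; first exact: bounded_mfun_cst.
  apply: bounded_mfunM.
    apply: bounded_mfunX; split; first exact: measurable_dotv.
    by exists 1 => -[x y] [/= xS yS]; exact: usphere_dotv.
  have [mp [M pM]] := bpsi; split; first exact: (measurableT_comp mp).
  by exists M => -[x y] [/= _ yS]; exact: pM.
have bx x : bm (fun y : vecT R n => (power_mass mu e0 N)^-1 * (dotv x y ^+ (2 * N) * psi y)).
  apply: bounded_mfunM; first exact: bounded_mfun_cst.
  by apply: bounded_mfunM => //; exact: bounded_mfun_dotvX.
transitivity (\int[mu]_(x in S) \int[mu]_(y in S)
    (g x * ((power_mass mu e0 N)^-1 * (dotv x y ^+ (2 * N) * psi y)))).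
  apply: eq_Rintegral => x /set_mem xS; rewrite (RintegralZl_bounded mu mS (g x) (bx x)).
  rewrite /sphere_smooth /restrict mem_set// /smooth RintegralZl_bounded//.
  by apply: bounded_mfunM => //; exact: bounded_mfun_dotvX.
rewrite (Rintegral_Fubini mu mu mS mS bF).
transitivity (\int[mu]_(y in S) (0 : R)); last by rewrite Rintegral_cst// mul0r.
apply: eq_Rintegral => y /set_mem yS.
transitivity ((power_mass mu e0 N)^-1 * psi y * \int[mu]_(x in S) (g x * dotv y x ^+ (2 * N))).
  rewrite -RintegralZl_bounded//; last first.
    by apply: bounded_mfunM => //; exact: bounded_mfun_dotvX.
  by apply: eq_Rintegral => x _ /=; rewrite (dotvC x); ring.
by rewrite g0// mulr0.
Qed.

Let orth_cont psi : bm (psi : vecT R n -> R) -> sphere_cont psi ->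
  \int[mu]_(x in S) (psi x * g x) = 0.
Proof.
move=> bpsi cpsi; have bN := bounded_mfun_oppr bpsi.
pose h x := psi x + psi (- x).
have bh : bm (h : vecT R n -> R) by exact: bounded_mfunD.
have [mh [M hM]] := bh; have [mg [Mg gM]] := bg.
have sM N x : S x -> `|sphere_smooth mu e0 N h x| <= M.
  move=> xS; rewrite /sphere_smooth /restrict mem_set//.
  exact: (smooth_bound mu_refl mu_gt0 e0S).
have h0 : \int[mu]_(x in S) (g x * h x) = 0.
  have cv : \int[mu]_(x in S) (g x * sphere_smooth mu e0 N h x) @[N --> \oo] -->
      \int[mu]_(x in S) (g x * h x).
    apply: (@Rintegral_bounded_cvg _ _ _ mu S mS _ _ (Mg * M)).
    - by move=> N; apply: measurable_funM => //; have [] := bounded_mfun_sphere_smooth mu e0 N bh.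
    - exact: measurable_funM.
    - by move=> N x xS; rewrite normrM ler_pM// ?gM// sM.
    - move=> x xS; apply: cvgMr; rewrite /sphere_smooth /restrict mem_set//.
      apply: (smooth_cvg mu_refl mu_gt0 e0S) => //; last exact: sphere_contDN.
      by move=> v _; rewrite /h opprK addrC.
  apply: (cvg_unique _ cv) => //.
  rewrite (_ : (fun N => _) = fun=> 0); first exact: cvg_cst.
  by apply/funext => N; exact: orth_smooth.
have bpg := bounded_mfunM bpsi bg; have bNg := bounded_mfunM bN bg.
have E : \int[mu]_(x in S) (psi (- x) * g x) = \int[mu]_(x in S) (psi x * g x).
  have T := Rintegral_transform mS measurable_oppv usphereN (fun A mA => mu_opp mA) bpg.
  by apply: (etrans _ T); apply: eq_Rintegral => u /set_mem uS /=; rewrite even_g.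
have two : 2 != 0 :> R by rewrite pnatr_eq0.
apply: (mulfI two); rewrite mulr0 -[RHS]h0 mulr_natl mulr2n -{2}E.
rewrite -(RintegralD_bounded mu mS bpg bNg).
by apply: eq_Rintegral => x _; rewrite /h /= mulrDr !(mulrC (g x)).
Qed.

(** Orthogonality to smoothed functions passes to continuous ones, whose even part alone matters
    since [g] is even, and then to bounded measurable ones. One of these is [g] itself, so g^2 has
    integral 0. *)
Lemma even_moments_unique : {ae mu, forall x, S x -> g x = 0}.
Proof.
have sT (h : vecT R n -> R) : bounded_mfun setT h -> bm h.
  by move=> [mh [M hM]]; split => //; exists M => x _; exact: hM.
have [mg [Mg gM]] := bg.
have all0 psi : bounded_mfun setT (psi : vecT R n -> R) ->
    \int[mu]_(x in S) (psi x * g x) = 0.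
  apply: (@sphere_cont_ind R n (fun psi => \int[mu]_(x in S) (psi x * g x) = 0)).
  - by move=> f /sT bf cf; exact: orth_cont.
  - move=> a f h /sT bf /sT bh f0 h0.
    have bfg := bounded_mfunM bf bg; have bhg := bounded_mfunM bh bg.
    have bahg := bounded_mfunM (bounded_mfun_cst S a) bhg.
    transitivity (\int[mu]_(x in S) (f x * g x) + a * \int[mu]_(x in S) (h x * g x)).
      rewrite -(RintegralZl_bounded mu mS a bhg) -(RintegralD_bounded mu mS bfg bahg).
      by apply: eq_Rintegral => x _ /=; ring.
    by rewrite f0 h0 mulr0 addr0.
  - move=> F f M mF mf FM fM F0 Ff.
    have cv : \int[mu]_(x in S) (F m x * g x) @[m --> \oo] --> \int[mu]_(x in S) (f x * g x).
      apply: (@Rintegral_bounded_cvg _ _ _ mu S mS _ _ (M * Mg)).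
      - by move=> m; exact: measurable_funM.
      - exact: measurable_funM.
      - by move=> m x xS; rewrite normrM ler_pM// gM.
      - by move=> x xS; apply: cvgMl; exact: Ff.
    apply: (cvg_unique _ cv) => //.
    rewrite (_ : (fun m => _) = fun=> 0); first exact: cvg_cst.
    by apply/funext => m; exact: F0.
have bgS : bounded_mfun setT (g \_ S : vecT R n -> R).
  split; first by apply/(measurable_restrictT (g : vecT R n -> R)) => //; exact: measurable_funTS.
  exists `|Mg| => x _; rewrite /restrict; case: ifPn => [/set_mem xS|_].
    by rewrite (le_trans (gM x xS))// ler_norm.
  by rewrite normr0.
have g2 : \int[mu]_(x in S) (g x * g x) = 0.
  rewrite -(all0 _ bgS); apply: eq_Rintegral => x xS; by rewrite /restrict xS.
have := Rintegral_eq0_bounded mS (bounded_mfunM bg bg) (fun x _ => _) g2.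
move=> /(_ (fun x => ltac:(by rewrite -expr2 sqr_ge0))).
apply: filterS => x H xS; apply/eqP; have /eqP := H xS.
by rewrite mulf_eq0 orbb.
Qed.

End moment_uniqueness.

(** * The moment recursion *)

Section equator_isotropic.
Context {R : realType} {n : nat}.
Variables mu sig : {finite_measure set (vecT R n) -> \bar R}.
Local Notation S := (usphere : set (vecT R n)).
Hypothesis mu_refl : forall w (A : set (vecT R n)), measurable A -> mu (refl w @^-1` A) = mu A.
Hypothesis mu_opp : forall A : set (vecT R n), measurable A -> mu (-%R @^-1` A) = mu A.
Variables (e0 e1 : 'rV[R]_n) (e0S : usphere e0) (e1S : usphere e1) (e10 : dotv e1 e0 = 0).
Hypothesis sig_refl : forall w (A : set (vecT R n)), dotv w e0 = 0 -> measurable A ->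
  sig (refl w @^-1` A) = sig A.
Hypothesis sig_opp : forall A : set (vecT R n), measurable A -> sig (-%R @^-1` A) = sig A.
Hypothesis sig_perp : {ae sig, forall y, S y -> dotv y e0 = 0}.
Hypothesis sig_gt0 : sig S != 0%E.
Let mS : measurable S := measurable_usphere.
Local Notation bm := (bounded_mfun S).
Local Notation Tr := (equator_int sig e0).
Local Notation m_ := (equator_moment sig e1).

Let dual (mu_gt0 : mu S != 0%E) := equator_int_dual mu_refl mu_opp mu_gt0 e0S e1S e10 sig_refl sig_opp sig_perp.
Let mom_gt0 := equator_moment_gt0 e0S e1S e10 sig_refl sig_perp sig_gt0.

(** Duality against the constant 1, that is [k = 0]: the non-negative function T 1_N has integral
    m_0 mu(N) = 0. *)
Lemma null_equator_int (N : set (vecT R n)) : measurable N -> mu N = 0%E ->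
  {ae mu, forall u, S u -> Tr \1_N u = 0}.
Proof.
move=> mN N0.
have [muS0|muS] := eqVneq (mu S) 0%E.
  by exists S; split => // u /= /not_implyP[].
have b1 : bm (\1_N : vecT R n -> R).
  split; first exact: measurable_indic.
  by exists 1 => x _; rewrite indicE; case: (x \in N); rewrite ?normr1 ?normr0.
have bT := bounded_mfun_equator_int mu sig e0 b1.
have T0 : \int[mu]_(u in S) Tr \1_N u = 0.
  have := dual muS 0 e0S b1.
  rewrite (@eq_Rintegral _ _ _ mu S (Tr \1_N)); last first.
    by move=> u _; rewrite expr0 mul1r.
  move=> ->; rewrite (_ : Rintegral _ _ _ = 0) ?mulr0//.
  transitivity (\int[mu]_(y in S) (0 : R)); last by rewrite Rintegral_cst// mul0r.
  apply: Rintegral_ae_eq_bounded => //.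
  - by apply: bounded_mfunM => //; exact: bounded_mfun_cst.
  - exact: bounded_mfun_cst.
  exists N; split => // x /= /not_implyP[xS]; apply: contra_notP => xN.
  by rewrite indicE memNset// mul0r.
apply: (Rintegral_eq0_bounded mS bT _ T0) => u uS.
by rewrite equator_intE//; apply: Rintegral_ge0 => y _; rewrite indicE ler0n.
Qed.

Lemma isotropic_equators_const (f : 'rV[R]_n -> R) : (3 <= n)%N ->
  bm (f : vecT R n -> R) -> (forall v, S v -> f (- v) = f v) ->
  {ae mu, forall u, S u -> forall a, S a ->
    (n%:R - 1) * Tr (fun y => f y * dotv a y ^+ 2) u = (1 - dotv a u ^+ 2) * Tr f u} ->
  exists c, {ae mu, forall x, S x -> f x = c}.
Proof.
move=> n3 bf ef iso.
have [muS0|muS] := eqVneq (mu S) 0%E.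
  by exists 0; exists S; split => // u /= /not_implyP[].
have muS_gt0 : 0 < fine (mu S).
  by apply: fine_gt0; rewrite lt0e muS measure_ge0/= -ge0_fin_numE// fin_num_measure.
pose c := (\int[mu]_(x in S) f x) / fine (mu S); exists c.
have bc : bm (cst c : vecT R n -> R) := bounded_mfun_cst S c.
pose g (x : 'rV[R]_n) := f x + c * (- 1).
have bcst : bm ((fun=> -1) : vecT R n -> R) := bounded_mfun_cst S (-1).
have bcc : bm ((fun=> c * -1) : vecT R n -> R) := bounded_mfun_cst S (c * -1).
have bg : bm (g : vecT R n -> R) by exact: (bounded_mfunD bf bcc).
have bX a k : bm (fun y : vecT R n => dotv a y ^+ k) by exact: bounded_mfun_dotvX.
have ga y a : g y * dotv a y ^+ 2 = f y * dotv a y ^+ 2 + - c * dotv a y ^+ 2.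
  by rewrite /g; ring.
(* For a constant function both sides of the identity agree because m_0 = (n - 1) m_1, so it passes
   from [f] to [g]. *)
have isog : {ae mu, forall u, S u -> forall a, S a ->
    (n%:R - 1) * Tr (fun y => g y * dotv a y ^+ 2) u = (1 - dotv a u ^+ 2) * Tr g u}.
  apply: filterS iso => u H uS a aS.
  have -> : Tr (fun y => g y * dotv a y ^+ 2) u =
      Tr (fun y => f y * dotv a y ^+ 2) u - c * ((1 - dotv a u ^+ 2) * m_ 1).
    rewrite (eq_equator_int sig e0 uS (fun y _ => ga y a)).
    rewrite (equator_intD sig e0 (bounded_mfunM bf (bX a 2))
      (bounded_mfunM (bounded_mfun_cst S (- c)) (bX a 2)) uS).
    rewrite (equator_intZ sig e0 (- c) (bX a 2) uS).
    have := equator_int_dotvX e0S e1S e10 sig_refl sig_perp a 1 uS.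
    by rewrite muln1 expr1 (aS : dotv a a = 1) => ->; rewrite mulNr.
  have -> : Tr g u = Tr f u - c * m_ 0.
    rewrite (equator_intD sig e0 bf bcc uS).
    have -> : Tr (fun=> c * -1) u = (- c) * Tr (fun=> 1) u.
      rewrite -(equator_intZ sig e0 (- c) (bounded_mfun_cst S 1) uS).
      by apply: eq_equator_int => // x _; rewrite mulrN1 mulr1.
    by rewrite (equator_int1 sig e0 e1 uS) mulNr.
  rewrite mulrBr H// (equator_moment1 e0S e1S e10 sig_refl sig_perp); ring.
have intg : \int[mu]_(x in S) g x = 0.
  rewrite (RintegralD_bounded mu mS bf bcc) Rintegral_cst// /c; field; lra.
have evg v : S v -> g (- v) = g v by move=> vS; rewrite /g ef.
suff g0 a N : S a -> \int[mu]_(y in S) (g y * dotv a y ^+ (2 * N)) = 0.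
  have := even_moments_unique mu_refl mu_opp muS e0S bg evg g0.
  apply: filterS => x H xS; have := H xS; rewrite /g; lra.
move=> aS.
pose w (y : 'rV[R]_n) := 1 - dotv a y ^+ 2.
have bw k : bm (fun y : vecT R n => w y ^+ k).
  apply: bounded_mfunX; apply: bounded_mfunB; first exact: bounded_mfun_cst.
  exact: bX.
pose A k := \int[mu]_(y in S) (g y * w y ^+ k).
have bgw k : bm (fun y : vecT R n => g y * w y ^+ k) by exact: (bounded_mfunM bg (bw k)).
have bTg := bounded_mfun_equator_int mu sig e0 bg.
have bga : bm (fun y : vecT R n => g y * dotv a y ^+ 2) by exact: (bounded_mfunM bg (bX a 2)).
have bTga := bounded_mfun_equator_int mu sig e0 bga.
(* The identity is integrated against <a,u>^(2k). Duality turns the left side into moments of g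
   <a,.>^2 = g (1 - w); on the right, the factor 1 - <a,u>^2 yields the duals of orders k and k +
   1. *)
have rec k : (n%:R - 1) * (m_ k * (A k - A k.+1)) = m_ k * A k - m_ k.+1 * A k.+1.
  have E1 := dual muS k aS bga; have E2 := dual muS k aS bg; have E3 := dual muS k.+1 aS bg.
  have E4 : \int[mu]_(y in S) (g y * dotv a y ^+ 2 * (1 - dotv a y ^+ 2) ^+ k) = A k - A k.+1.
    rewrite -(RintegralB_bounded mu mS (bgw k) (bgw k.+1)).
    by apply: eq_Rintegral => y _; rewrite /w [_ ^+ k.+1]exprS; ring.
  rewrite -E4 -E1 -[A k]/(\int[mu]_(y in S) (g y * (1 - dotv a y ^+ 2) ^+ k)) -E2.
  rewrite -[A k.+1]/(\int[mu]_(y in S) (g y * (1 - dotv a y ^+ 2) ^+ k.+1)) -E3.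
  have b1 := bounded_mfunM (bX a (2 * k)%N) bTga.
  have b2 := bounded_mfunM (bX a (2 * k)%N) bTg.
  have b3 := bounded_mfunM (bX a (2 * k.+1)%N) bTg.
  rewrite -(RintegralZl_bounded mu mS (n%:R - 1) b1) -(RintegralB_bounded mu mS b2 b3).
  apply: (Rintegral_ae_eq_bounded mS (bounded_mfunM (bounded_mfun_cst S _) b1) (bounded_mfunB b2 b3)).
  apply: filterS isog => u H uS; rewrite mulrCA H//.
  by rewrite mulnS exprD; ring.
have A0 k : A k = 0.
  elim: k => [|k IH].
    by rewrite -[RHS]intg; apply: eq_Rintegral => y _; rewrite expr0 mulr1.
  have := rec k; rewrite IH mulr0 !sub0r => E.
  have mk := mom_gt0 k; have mk1 := equator_momentS_le sig e1S k.
  have n3' : 3 <= n%:R :> R by rewrite ler_nat.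
  have : ((n%:R - 1) * m_ k - m_ k.+1) * A k.+1 = 0 by lra.
  move/eqP; rewrite mulf_eq0 => /orP[|/eqP//].
  (* The step that needs n >= 3: as m_(k+1) <= m_k, the coefficient is at least (n - 2) m_k. *)
  have : 0 < (n%:R - 1) * m_ k - m_ k.+1 by nra.
  by move=> /lt0r_neq0/negbTE ->.
(* Each factor <a,y>^2 = 1 - w trades one unit of [j] for a difference of two consecutive values of
   [k]. *)
have B0 j k : \int[mu]_(y in S) (g y * (dotv a y ^+ (2 * j) * w y ^+ k)) = 0.
  elim: j k => [|j IH] k.
    rewrite -[RHS](A0 k); apply: eq_Rintegral => y _.
    by rewrite expr0 mul1r.
  have bb i : bm (fun y : vecT R n => g y * (dotv a y ^+ (2 * j) * w y ^+ i)).
    exact: (bounded_mfunM bg (bounded_mfunM (bX a (2 * j)%N) (bw i))).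
  rewrite -[RHS](subrr 0) -{1}(IH k) -(IH k.+1).
  rewrite -(RintegralB_bounded mu mS (bb k) (bb k.+1)).
  apply: eq_Rintegral => y _; rewrite mulnS exprD [w y ^+ k.+1]exprS.
  by move: (w y ^+ k) (_ ^+ (2 * j)) => p q; rewrite /w; ring.
rewrite -[RHS](B0 N 0%N); apply: eq_Rintegral => y _.
by rewrite expr0 mulr1.
Qed.

End equator_isotropic.

(** * Hausdorff measures *)

Section euclidean_norm.
Context {R : realType}.

Lemma enorm_ge0 n (x : 'rV[R]_n) : 0 <= enorm x.
Proof. exact: sqrtr_ge0. Qed.

Lemma sqr_enorm n (x : 'rV[R]_n) : enorm x ^+ 2 = dotv x x.
Proof. by rewrite sqr_sqrtr// dotv_ge0. Qed.

Lemma enormN n (x : 'rV[R]_n) : enorm (- x) = enorm x.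
Proof. by rewrite /enorm dotvNl dotvNr opprK. Qed.

Lemma ler_enormD n (x y : 'rV[R]_n) : enorm (x + y) <= enorm x + enorm y.
Proof.
have x0 := enorm_ge0 x; have y0 := enorm_ge0 y.
rewrite -(@ler_pXn2r _ 2) ?nnegrE ?enorm_ge0 ?addr_ge0//.
rewrite sqr_enorm dotvDl !dotvDr (dotvC y x) sqrrD !sqr_enorm.
suff : dotv x y <= enorm x * enorm y by lra.
rewrite (le_trans (ler_norm _))// -(@ler_pXn2r _ 2) ?nnegrE ?mulr_ge0//.
by rewrite real_normK ?num_real// exprMn !sqr_enorm dotv_CS.
Qed.

Lemma coord_le_enorm n (x : 'rV[R]_n) i : `|x 0 i| <= enorm x.
Proof.
rewrite -(@ler_pXn2r _ 2) ?nnegrE ?enorm_ge0// real_normK ?num_real//.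
by rewrite sqr_enorm sqr_coord_le.
Qed.

Lemma enorm_le_sum n (x : 'rV[R]_n) : enorm x <= \sum_(i < n) `|x 0 i|.
Proof.
rewrite -(@ler_pXn2r _ 2) ?nnegrE ?enorm_ge0 ?sumr_ge0//.
rewrite sqr_enorm /dotv expr2 mulr_suml; apply: ler_sum => i _.
rewrite -expr2 -real_normK ?num_real// expr2 ler_wpM2l//.
by rewrite (bigD1 i)//= lerDl sumr_ge0.
Qed.

Lemma usphere_enorm n (x : 'rV[R]_n) : usphere x <-> enorm x = 1.
Proof.
rewrite /usphere /= -sqr_enorm; split => [/eqP|->]; last by rewrite expr1n.
by rewrite sqrf_eq1 => /orP[/eqP//|/eqP h]; have := enorm_ge0 x; rewrite h ler0N1.
Qed.

End euclidean_norm.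

(** * Covers, contractions and isometries *)

Section hausdorff_basics.
Context {R : realType}.
Local Open Scope ereal_scope.

Let lee_expe (x y : \bar R) k : 0 <= x -> x <= y -> x ^+ k <= y ^+ k.
Proof.
move=> x0 xy; elim: k => [|k IH]; first by rewrite !expe0.
by rewrite !expeS; apply: lee_pmul => //; exact: expe_ge0.
Qed.

Lemma le_ediam_ub n (A : set 'rV[R]_n) x y : A x -> A y -> (enorm (x - y))%:E <= ediam A.
Proof. by move=> Ax Ay; apply: ereal_sup_ubound; exists x => //; exists y. Qed.

Lemma ge_ediam n (A : set 'rV[R]_n) (d : \bar R) :
  (forall x y, A x -> A y -> (enorm (x - y))%:E <= d) -> ediam A <= d.
Proof. by move=> H; apply: ge_ereal_sup => _ [x Ax [y Ay <-]]; exact: H. Qed.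

Lemma ediam_ge0 n (A : set 'rV[R]_n) : A !=set0 -> 0 <= ediam A.
Proof. by move=> [x Ax]; apply: le_trans (le_ediam_ub Ax Ax); rewrite lee_fin enorm_ge0. Qed.

Lemma ediam_set0 n : ediam (set0 : set 'rV[R]_n) = -oo.
Proof.
rewrite /ediam (_ : [set _ | _ in _ & _ in _] = set0) ?ereal_sup0//.
by rewrite -subset0 => _ [x []].
Qed.

Lemma hausdorff_cost0 n s : hausdorff_cost s (set0 : set 'rV[R]_n) = 0.
Proof. by rewrite /hausdorff_cost eqxx. Qed.

Lemma le_hausdorff_cost n m s (A : set 'rV[R]_n) (B : set 'rV[R]_m) :
  (A !=set0 -> B !=set0) -> ediam A <= ediam B -> hausdorff_cost s A <= hausdorff_cost s B.
Proof.
move=> AB dAB; have [->|/set0P A0] := eqVneq A set0.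
  by rewrite hausdorff_cost0; exact: hausdorff_cost_ge0.
have B0 := AB A0.
have /set0P/negbTE A0' := A0; have /set0P/negbTE B0' := B0.
rewrite /hausdorff_cost A0' B0'; apply: lee_wpmul2l.
  by rewrite lee_fin divr_ge0 ?exprn_ge0 ?(ltW (ball_volume_gt0 _)).
by apply: lee_expe => //; exact: ediam_ge0.
Qed.

Lemma hausdorff_delta_cover n s (delta : R) (A : set 'rV[R]_n) (F : (set 'rV[R]_n)^nat) :
  (forall k, ediam (F k) <= delta%:E) -> A `<=` \bigcup_k F k ->
  hausdorff_delta s delta A <= \sum_(k <oo) hausdorff_cost s (F k).
Proof. by move=> Fd AF; apply: ereal_inf_lbound; exists F. Qed.

Lemma le_hausdorff_delta n s (delta : R) (A : set 'rV[R]_n) :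
  (0 < delta)%R -> hausdorff_delta s delta A <= hausdorff s A.
Proof. by move=> d0; apply: ereal_sup_ubound; exists delta. Qed.

Lemma ge_hausdorff n s (A : set 'rV[R]_n) (x : \bar R) :
  (forall delta, (0 < delta)%R -> hausdorff_delta s delta A <= x) -> hausdorff s A <= x.
Proof. by move=> H; apply: ge_ereal_sup => _ [d d0 <-]; exact: H. Qed.

Lemma hausdorff_delta_anti n s (d d' : R) (A : set 'rV[R]_n) : (d <= d')%R ->
  hausdorff_delta s d' A <= hausdorff_delta s d A.
Proof.
move=> dd'; apply: ereal_inf_le_tmp => _ [F [Fd AF] <-]; exists F => //; split => // k.
by apply: le_trans (Fd k) _; rewrite lee_fin.
Qed.

Lemma hausdorff_delta_ge0 n s (d : R) (A : set 'rV[R]_n) : 0 <= hausdorff_delta s d A.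
Proof.
apply: le_ereal_inf_tmp => _ [F _ <-]; apply: nneseries_ge0 => k _ _.
exact: hausdorff_cost_ge0.
Qed.

Lemma hausdorff_delta_lt n s (d : R) (A : set 'rV[R]_n) (x : \bar R) :
  hausdorff_delta s d A < x -> exists F : (set 'rV[R]_n)^nat,
  [/\ forall k, ediam (F k) <= d%:E, A `<=` \bigcup_k F k &
      \sum_(k <oo) hausdorff_cost s (F k) < x].
Proof. by move=> /ereal_inf_lt[_ [F [Fd AF] <-] Fx]; exists F. Qed.

(** The members of a cover are cut down to [A] before taking images, because [phi] is controlled on
    [A] only. *)
Lemma hausdorff_contraction n m s (phi : 'rV[R]_n -> 'rV[R]_m) (A : set 'rV[R]_n) :
  (forall x y, A x -> A y -> (enorm (phi x - phi y) <= enorm (x - y))%R) ->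
  hausdorff s (phi @` A) <= hausdorff s A.
Proof.
move=> phiA; apply: ge_hausdorff => d d0; apply: le_trans (le_hausdorff_delta s A d0).
apply: le_ereal_inf_tmp => _ [F [Fd AF] <-].
have dF k : ediam (phi @` (F k `&` A)) <= ediam (F k).
  apply: ge_ediam => _ _ [x [Fx Ax] <-] [y [Fy Ay] <-].
  by apply: le_trans (le_ediam_ub Fx Fy); rewrite lee_fin phiA.
apply: (@le_trans _ _ (\sum_(k <oo) hausdorff_cost s (phi @` (F k `&` A)))).
  apply: hausdorff_delta_cover => [k|_ [x Ax <-]]; first exact: le_trans (dF k) (Fd k).
  by have [k _ Fx] := AF x Ax; exists k => //; exists x.
apply: lee_nneseries => k _; first by move=> _; exact: hausdorff_cost_ge0.
by apply: le_hausdorff_cost => // -[_ [x [Fx _] _]]; exists x.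
Qed.

Lemma hausdorff_involution n s (phi : 'rV[R]_n -> 'rV[R]_n) (A : set 'rV[R]_n) :
  involutive phi -> (forall x y, enorm (phi x - phi y) = enorm (x - y)) ->
  hausdorff s (phi @^-1` A) = hausdorff s A.
Proof.
move=> phiK iso.
have pre B : phi @^-1` B = phi @` B.
  apply/seteqP; split => [x Bx|_ [x Bx <-]]; first by exists (phi x); rewrite ?phiK.
  by rewrite /= phiK.
apply/eqP; rewrite eq_le; apply/andP; split.
  by rewrite pre; apply: hausdorff_contraction => x y _ _; rewrite iso.
rewrite -{1}(_ : phi @^-1` (phi @^-1` A) = A); last first.
  by apply/seteqP; split => x /=; rewrite phiK.
by rewrite pre; apply: hausdorff_contraction => x y _ _; rewrite iso.
Qed.

Lemma enorm_refl n (w x y : 'rV[R]_n) : enorm (refl w x - refl w y) = enorm (x - y).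
Proof. by rewrite -reflN -reflD /enorm dotv_refl. Qed.

Lemma hausdorff_refl n s w (A : set 'rV[R]_n) : hausdorff s (refl w @^-1` A) = hausdorff s A.
Proof. by apply: hausdorff_involution => [|x y]; [exact: reflK|exact: enorm_refl]. Qed.

Lemma hausdorff_opp n s (A : set 'rV[R]_n) : hausdorff s (-%R @^-1` A) = hausdorff s A.
Proof.
apply: hausdorff_involution => [|x y]; first exact: opprK.
by rewrite -opprD enormN.
Qed.

End hausdorff_basics.

(** * Caratheodory's criterion: Borel sets are measurable for Hausdorff measures *)

Section hausdorff_metric_outer.
Context {R : realType} {n : nat} (s : nat).
Implicit Types (A P Q X : set 'rV[R]_n).
Local Open Scope ereal_scope.
Local Notation mu := (@hausdorff R n s).

Let mu_ge0 A : 0 <= mu A. Proof. exact: outer_measure_ge0. Qed.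

Lemma hausdorff_separated P Q (eta : R) : (0 < eta)%R ->
  (forall p q, P p -> Q q -> (eta <= enorm (p - q))%R) -> mu P + mu Q <= mu (P `|` Q).
Proof.
move=> eta0 sep.
(* With mesh below [eta] no member of a cover meets both [P] and [Q], so the cover splits. Two
   separate meshes allow the suprema for [P] and for [Q] to be taken one after the other. *)
have key (d1 d2 : R) : (0 < d1)%R -> (0 < d2)%R ->
    hausdorff_delta s d1 P + hausdorff_delta s d2 Q <= mu (P `|` Q).
  move=> d10 d20; pose d : R := Num.min (Num.min d1 d2) (eta / 2)%R.
  have e2 : (0 < eta / 2)%R by rewrite divr_gt0.
  have d0 : (0 < d)%R by rewrite !lt_min d10 d20.
  apply: le_trans (le_hausdorff_delta s (P `|` Q) d0).
  apply: (@le_trans _ _ (hausdorff_delta s d P + hausdorff_delta s d Q)).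
    by apply: leeD; apply: hausdorff_delta_anti; rewrite !ge_min lexx ?orbT.
  apply: le_ereal_inf_tmp => _ [F [Fd PQF] <-].
  pose G (B : set 'rV[R]_n) k := if `[< F k `&` B !=set0 >] then F k else set0.
  have Gd B k : ediam (G B k) <= d%:E.
    by rewrite /G; case: ifP => // _; rewrite ediam_set0 leNye.
  have GB B : B `<=` \bigcup_k F k -> B `<=` \bigcup_k G B k.
    move=> BF x Bx; have [k _ Fx] := BF x Bx; exists k => //.
    by rewrite /G ifT//; apply/asboolP; exists x.
  have hP : hausdorff_delta s d P <= \sum_(k <oo) hausdorff_cost s (G P k).
    by apply: hausdorff_delta_cover => //; apply: GB => x Px; apply: PQF; left.
  have hQ : hausdorff_delta s d Q <= \sum_(k <oo) hausdorff_cost s (G Q k).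
    by apply: hausdorff_delta_cover => //; apply: GB => x Qx; apply: PQF; right.
  apply: le_trans (leeD hP hQ) _.
  rewrite -nneseriesD; last 2 first.
  - by move=> k _ _; exact: hausdorff_cost_ge0.
  - by move=> k _ _; exact: hausdorff_cost_ge0.
  apply: lee_nneseries => k _.
    by move=> _; rewrite adde_ge0// hausdorff_cost_ge0.
  rewrite /G; case: asboolP => [[p [Fp Pp]]|_]; case: asboolP => [[q [Fq Qq]]|_];
    rewrite ?hausdorff_cost0 ?adde0 ?add0e ?hausdorff_cost_ge0//.
  exfalso; have := le_trans (le_ediam_ub Fp Fq) (Fd k); rewrite lee_fin => h.
  have := le_trans (sep p q Pp Qq) h; apply/negP; rewrite -ltNge.
  by rewrite (@le_lt_trans _ _ (eta / 2)%R)// ?ge_min ?lexx ?orbT// gtr_pMr// invf_lt1 ?ltr1n.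
have [->|Zfin] := eqVneq (mu (P `|` Q)) +oo; first by rewrite leey.
have Zf : mu (P `|` Q) \is a fin_num by rewrite ge0_fin_numE// lt_neqAle Zfin leey.
have fin B : B `<=` P `|` Q -> mu B \is a fin_num.
  move=> BPQ; rewrite ge0_fin_numE// (@le_lt_trans _ _ (mu (P `|` Q)))//.
    exact: le_outer_measure.
  by rewrite -ge0_fin_numE.
have Qf : mu Q \is a fin_num by apply: fin => x; right.
rewrite -leeBrDr//; apply: ge_hausdorff => d1 d10.
have Pf : hausdorff_delta s d1 P \is a fin_num.
  rewrite ge0_fin_numE ?hausdorff_delta_ge0//.
  by rewrite (le_lt_trans (le_hausdorff_delta s P d10))// -ge0_fin_numE//; apply: fin => x; left.
rewrite leeBrDr// addeC -leeBrDr//; apply: ge_hausdorff => d2 d20.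
by rewrite leeBrDr// addeC key.
Qed.

(** Each piece keeps a positive distance from all earlier ones, so the finite sums are measures of
    finite unions by [hausdorff_separated]. *)
Let series_le (i : 'I_n) X (G : (set 'rV[R]_n)^nat) : (forall k, G k `<=` X) ->
  (forall k, exists2 eta : R, (0 < eta)%R & forall j p q, (j < k)%N -> G j p -> G k q ->
     (eta <= p 0 i - q 0 i)%R) ->
  \sum_(k <oo) mu (G k) <= mu X.
Proof.
move=> GX sep.
have fin K : \sum_(0 <= k < K) mu (G k) <= mu (\big[setU/set0]_(k < K) G k).
  elim: K => [|K IH]; first by rewrite big_geq// big_ord0 outer_measure0.
  rewrite big_nat_recr//= big_ord_recr/=.
  apply: le_trans (leeD IH (lexx _)) _.
  have [eta eta0 H] := sep K; apply: (hausdorff_separated eta0) => p q.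
  rewrite -bigcup_mkord => -[j /= jK Gjp] Gq.
  apply: le_trans (H j p q jK Gjp Gq) _.
  have := coord_le_enorm (p - q) i; rewrite !mxE; apply: le_trans; exact: ler_norm.
apply: lime_le; first by apply: is_cvg_nneseries => k _ _; exact: mu_ge0.
apply: nearW => K; apply: le_trans (fin K) _; apply: le_outer_measure.
by rewrite -bigcup_mkord => x [k _]; exact: GX.
Qed.

(** The part of [X] just above the hyperplane is sliced into strips [G k] that shrink towards it.
    Adjacent strips touch, but those of even index are mutually separated, and so are those of odd
    index; hence both series converge and their tails tend to 0. *)
Lemma hausdorff_halfspace (i : 'I_n) (c : R) :
  (hausdorff s).-caratheodory [set x : 'rV[R]_n | (c < x 0 i)%R].
Proof.
apply: le_caratheodory_measurable => X /=.
have [->|XNoo] := eqVneq (mu X) +oo; first by rewrite leey.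
have Xf : mu X \is a fin_num by rewrite ge0_fin_numE// lt_neqAle XNoo leey.
pose r (k : nat) : R := (c + k.+1%:R^-1)%R.
pose G k := X `&` [set x : 'rV[R]_n | (r k.+1 < x 0 i <= r k)%R].
have GX k : G k `<=` X by move=> x [].
have rlt a b : (a < b)%N -> (r b < r a)%R.
  by move=> ab; rewrite ltrD2l ltf_pV2 ?posrE ?ltr0n// ltr_nat.
have rle a b : (a <= b)%N -> (r b <= r a)%R.
  by move=> ab; rewrite lerD2l lef_pV2 ?posrE ?ltr0n// ler_nat.
have sumG (f : nat -> nat) : (forall a b, (a < b)%N -> (f a).+1 < f b)%N ->
    \sum_(k <oo) mu (G (f k)) <= mu X.
  move=> fS; apply: (@series_le i) => // k.
  case: k => [|k]; first by exists 1%R.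
  exists (r (f k).+1 - r (f k.+1))%R; first by rewrite subr_gt0 rlt// fS.
  move=> j p q; rewrite ltnS => jk [_ /= /andP[p1 _]] [_ /= /andP[_ q2]].
  have : (r (f k).+1 <= r (f j).+1)%R.
    apply: rle; move: jk; rewrite leq_eqVlt => /predU1P[->//|/fS/ltnW/ltnW]; exact: leq_trans.
  lra.
have tail0 (f : nat -> nat) : (forall a b, (a < b)%N -> (f a).+1 < f b)%N ->
    \sum_(N <= k <oo) mu (G (f k)) @[N --> \oo] --> 0.
  move=> fS; apply: nneseries_tail_cvg => [|k _]; last exact: mu_ge0.
  by apply: le_lt_trans (sumG f fS) _; rewrite -ge0_fin_numE.
(* The part [A] above level r(2N) is at positive distance from the lower half-space; the rest of the
   upper part lies in the strips of index at least 2N. *)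
have key N : mu (X `&` [set x : 'rV[R]_n | (c < x 0 i)%R]) +
    mu (X `&` ~` [set x : 'rV[R]_n | (c < x 0 i)%R]) <=
    mu X + (\sum_(N <= k <oo) mu (G (2 * k)%N) + \sum_(N <= k <oo) mu (G (2 * k).+1)).
  pose A := X `&` [set x : 'rV[R]_n | (r (2 * N) < x 0 i)%R].
  have sub : X `&` [set x : 'rV[R]_n | (c < x 0 i)%R] `<=`
      A `|` (\bigcup_(k in ~` `I_N) G (2 * k)%N `|` \bigcup_(k in ~` `I_N) G (2 * k).+1).
    move=> x [Xx /= cx]; have [xr|xr] := ltP (r (2 * N)%N) (x 0 i)%R; [by left|right].
    have xc0 : (0 < x 0 i - c)%R by rewrite subr_gt0.
    (* As 1/(m + 1) < x_i - c <= 1/m, the point lies in the strip of index m - 1. *)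
    pose m := Num.trunc ((x 0 i - c)^-1)%R.
    have /andP[m1 m2] := truncn_itv (ltW (etrans (invr_gt0 _) xc0)).
    rewrite -/m in m1 m2.
    have xi : (x 0 i - c <= (2 * N).+1%:R^-1)%R by rewrite lerBlDl; exact: xr.
    have hm : ((2 * N).+1%:R <= (x 0 i - c)^-1 :> R)%R.
      by rewrite -[leLHS]invrK lef_pV2 ?posrE ?invr_gt0 ?ltr0n.
    have Nm : (2 * N < m)%N.
      by rewrite -ltnS -(ltr_nat R) (le_lt_trans hm).
    have Gm : G m.-1 x.
      split=> //=; rewrite /r prednK; last by apply: leq_ltn_trans Nm.
      rewrite -ltrBrDl -lerBlDl; apply/andP; split.
        by rewrite -[ltRHS]invrK ltf_pV2 ?posrE ?invr_gt0 ?ltr0n.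
      rewrite -[leLHS]invrK lef_pV2 ?posrE ?invr_gt0 ?ltr0n//.
      by apply: leq_ltn_trans Nm.
    have Nh : (~` `I_N) m.-1./2 by apply/negP; rewrite -leqNgt; rewrite geq_half_double -muln2 mulnC; lia.
    have [odd_m|even_m] := boolP (odd m.-1).
      right; exists m.-1./2 => //.
      by rewrite (_ : (2 * _).+1 = m.-1)// mul2n -[RHS]odd_double_half odd_m.
    left; exists m.-1./2 => //.
    by rewrite (_ : (2 * _)%N = m.-1)// mul2n -[RHS]odd_double_half (negbTE even_m).
  have AX : mu A + mu (X `&` ~` [set x : 'rV[R]_n | (c < x 0 i)%R]) <= mu X.
    apply: (@le_trans _ _ (mu (A `|` (X `&` ~` [set x : 'rV[R]_n | (c < x 0 i)%R])))).
      apply: (@hausdorff_separated _ _ (r (2 * N)%N - c)%R); first by rewrite subr_gt0 ltrDl invr_gt0 ltr0n.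
      move=> p q [_ /= p1] [_ /= /negP]; rewrite -leNgt => q1.
      have := coord_le_enorm (p - q) i; rewrite !mxE; apply: le_trans.
      apply: le_trans (ler_norm _); lra.
    by apply: le_outer_measure => x [[]|[]].
  have mub := outer_measure_sigma_subadditive_tail (@hausdorff R n s) N.
  have sub2 : mu (X `&` [set x : 'rV[R]_n | (c < x 0 i)%R]) <=
      mu A + (\sum_(N <= k <oo) mu (G (2 * k)%N) + \sum_(N <= k <oo) mu (G (2 * k).+1)).
    apply: le_trans (le_outer_measure _ _ _ sub) _.
    apply: le_trans (outer_measureU2 _ _ _) _; apply: leeD => //.
    apply: le_trans (outer_measureU2 _ _ _) _; apply: leeD.
      exact: (mub (fun k => G (2 * k)%N)).
    exact: (mub (fun k => G (2 * k).+1)).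
  apply: le_trans (leeD sub2 (lexx _)) _.
  by rewrite addeAC leeD.
have fE a b : (a < b)%N -> ((2 * a).+1 < 2 * b)%N by lia.
have fO a b : (a < b)%N -> ((2 * a).+2 < (2 * b).+1)%N by lia.
have cv : mu X + (\sum_(N <= k <oo) mu (G (2 * k)%N) + \sum_(N <= k <oo) mu (G (2 * k).+1))
    @[N --> \oo] --> mu X + (0 + 0).
  apply: cvgeD; [by rewrite add0e fin_num_adde_defl|exact: cvg_cst|].
  by apply: cvgeD => //; [exact: (tail0 (fun k => 2 * k)%N)|exact: (tail0 (fun k => (2 * k).+1))].
rewrite !adde0 in cv; rewrite -(cvg_lim _ cv)//; apply: lime_ge; first by apply/cvg_ex; exists (mu X).
exact: nearW.
Qed.

End hausdorff_metric_outer.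

(** * Borel regularity *)

Section caratheodory_vec.
Context {R : realType} {n : nat}.

Lemma measurable_id_caratheodory s :
  measurable_fun setT (id : caratheodory_type (@hausdorff R n s) -> vecT R n).
Proof.
apply: measurable_vecP => i.
apply: (measurability _ (RGenOInfty.measurableE R)) => _ [_ [c ->] <-].
rewrite setTI (_ : _ @^-1` _ = [set x : 'rV[R]_n | c < x 0 i]).
  exact: hausdorff_halfspace.
by apply/seteqP; split => x /=; rewrite in_itv/= andbT.
Qed.

Lemma measurable_caratheodory s (A : set (vecT R n)) : measurable A ->
  measurable (A : set (caratheodory_type (@hausdorff R n s))).
Proof.
by move=> mA; have := @measurable_id_caratheodory s measurableT A mA; rewrite setTI.
Qed.

Let cell m (k : {ffun 'I_n -> int}) : set (vecT R n) :=
  [set x : 'rV[R]_n | forall i, (k i)%:~R <= m.+1%:R * x 0 i < (k i + 1)%:~R].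

Let mcell m k : measurable (cell m k).
Proof.
rewrite (_ : cell m k = \big[setI/setT]_(i < n)
    ((fun x : vecT R n => m.+1%:R * (x : 'rV[R]_n) 0 i) @^-1` `[(k i)%:~R, (k i + 1)%:~R[%classic)).
  apply: bigsetI_measurable => i _; rewrite -[X in measurable X]setTI.
  have mi : measurable_fun setT (fun x : vecT R n => m.+1%:R * (x : 'rV[R]_n) 0 i).
    by apply: measurable_funM => //; exact: measurable_coord.
  by apply: mi => //; exact: measurable_itv.
rewrite -bigcap_seq; apply/seteqP; split => x /= H i.
  by move=> _; rewrite /= in_itv/=; exact: H.
by have := H i; rewrite /= mem_index_enum in_itv/=; exact.
Qed.

Let cell_diam m k x y : cell m k x -> cell m k y ->
  enorm ((x : 'rV[R]_n) - y) <= n%:R / m.+1%:R.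
Proof.
move=> Hx Hy; apply: le_trans (enorm_le_sum _) _.
apply: (@le_trans _ _ (\sum_(i < n) m.+1%:R^-1)); last first.
  by rewrite sumr_const card_ord -[leLHS]mulr_natl.
apply: ler_sum => i _; rewrite !mxE.
have m0 : 0 < m.+1%:R :> R by rewrite ltr0n.
rewrite -[leRHS]mulr1 ler_pdivlMl// -{1}(ger0_norm (ltW m0)) -normrM mulrBr.
have := Hx i; have := Hy i; rewrite intrD => /andP[a1 a2] /andP[b1 b2].
by rewrite ler_norml; apply/andP; split; lra.
Qed.

(** A set between [F] and its topological closure, hence with the diameter of [F], and Borel by
    construction: only countably many grid cells exist for each mesh. *)
Definition borel_closure (F : set 'rV[R]_n) : set (vecT R n) :=
  \bigcap_m \bigcup_(k in [set k | cell m k `&` F !=set0]) cell m k.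

Lemma measurable_borel_closure F : measurable (borel_closure F).
Proof.
apply: bigcapT_measurable => m.
rewrite (_ : \bigcup_(_ in _) _ = \bigcup_j
    (if unpickle j is Some k then if `[< cell m k `&` F !=set0 >] then cell m k else set0
     else set0)).
  by apply: bigcupT_measurable => j; case: (unpickle j) => [k|//]; case: ifP.
apply/seteqP; split => x [k].
  by move=> /= kF kx; exists (pickle k) => //; rewrite pickleK ifT//; exact/asboolP.
by move=> _; case: (unpickle k) => [j|//]; case: asboolP => // jF jx; exists j.
Qed.

Lemma sub_borel_closure F : F `<=` borel_closure F.
Proof.
move=> x Fx m _; exists [ffun i => Num.floor (m.+1%:R * x 0 i)].
  by exists x; split => // i; rewrite ffunE floor_itv ?num_real.
by move=> i; rewrite ffunE floor_itv ?num_real.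
Qed.

Lemma borel_closure_nonempty F : borel_closure F !=set0 -> F !=set0.
Proof. by move=> [x /(_ 0%N I)[k [y [_ Fy]] _]]; exists y. Qed.

Lemma ediam_borel_closure F : (ediam (borel_closure F : set 'rV[R]_n) <= ediam F)%E.
Proof.
apply: ge_ediam => x y Hx Hy.
have [x0 Fx0] : F !=set0 by apply: borel_closure_nonempty; exists x.
have [->|dfin] := eqVneq (ediam F) +oo%E; first by rewrite leey.
have dF : ediam F \is a fin_num.
  by rewrite ge0_fin_numE ?lt_neqAle ?dfin ?leey//; apply: ediam_ge0; exists x0.
rewrite -(fineK dF) lee_fin; apply/ler_addgt0Pr => e e0.
pose m := Num.trunc (2 * n%:R / e).
have hm : 2 * (n%:R / m.+1%:R) <= e.
  have := truncnS_gt (2 * n%:R / e); rewrite -/m ltr_pdivrMr// => H.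
  by rewrite mulrA ler_pdivrMr ?ltr0n// (le_trans (ltW H))// mulrC.
have [k [x' [kx' Fx']] kx] := Hx m I; have [j [y' [jy' Fy']] jy] := Hy m I.
have := le_ediam_ub Fx' Fy'; rewrite -(fineK dF) lee_fin => xy'.
have := cell_diam kx kx'; have := cell_diam jy' jy => h1 h2.
have -> : (x : 'rV[R]_n) - y = ((x : 'rV[R]_n) - x') + ((x' : 'rV[R]_n) - y') + ((y' : 'rV[R]_n) - y).
  by rewrite !addrA !subrK.
apply: le_trans (ler_enormD _ _) _.
have h3 := ler_enormD ((x : 'rV[R]_n) - x') ((x' : 'rV[R]_n) - y').
move: (n%:R / m.+1%:R) hm h1 h2 => q hm h1 h2; lra.
Qed.

(** Nearly optimal covers of mesh 1/(m + 1) are replaced by their Borel closures, which cost no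
    more, and the unions are intersected over m. *)
Lemma borel_hull s (A : set 'rV[R]_n) : (hausdorff s A < +oo)%E ->
  exists B : set (vecT R n), [/\ measurable B, A `<=` B & (hausdorff s B <= hausdorff s A)%E].
Proof.
move=> Afin.
have Af : hausdorff s A \is a fin_num by rewrite ge0_fin_numE// outer_measure_ge0.
have mp (m : nat) : 0 < m.+1%:R^-1 :> R by rewrite invr_gt0 ltr0n.
have /choice[F HF] : forall m, exists F : (set 'rV[R]_n)^nat,
    [/\ forall k, (ediam (F k) <= (m.+1%:R^-1)%:E)%E, A `<=` \bigcup_k F k &
      (\sum_(k <oo) hausdorff_cost s (F k) < hausdorff s A + (m.+1%:R^-1)%:E)%E].
  move=> m; apply: hausdorff_delta_lt.
  by rewrite (le_lt_trans (le_hausdorff_delta s A (mp m)))// lteDl// lte_fin.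
exists (\bigcap_m \bigcup_k borel_closure (F m k)); split.
- apply: bigcapT_measurable => m; apply: bigcupT_measurable => k.
  exact: measurable_borel_closure.
- move=> x Ax m _; have [_ AF _] := HF m; have [k _ Fx] := AF x Ax.
  by exists k => //; exact: sub_borel_closure.
apply: ge_hausdorff => d d0; apply/lee_addgt0Pr => e e0.
pose m := Num.trunc (Num.min d e)^-1.
have de0 : 0 < Num.min d e by rewrite lt_min d0.
have hm : m.+1%:R^-1 <= Num.min d e.
  rewrite -[leRHS]invrK lef_pV2 ?posrE ?invr_gt0// ?ltr0n// ltW//.
  exact: truncnS_gt.
have [md me] : m.+1%:R^-1 <= d /\ m.+1%:R^-1 <= e.
  by move: hm; rewrite le_min => /andP.
have [Fd AF Fs] := HF m.
apply: (@le_trans _ _ (\sum_(k <oo) hausdorff_cost s (F m k))%E); last first.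
  by apply: le_trans (ltW Fs) _; rewrite leeD2l// lee_fin.
apply: (@le_trans _ _ (\sum_(k <oo) hausdorff_cost s (borel_closure (F m k) : set 'rV[R]_n))%E).
  apply: hausdorff_delta_cover => [k|x /(_ m I)//].
  by apply: le_trans (ediam_borel_closure _) _; apply: le_trans (Fd k) _; rewrite lee_fin.
apply: lee_nneseries => k _; first by move=> _; exact: hausdorff_cost_ge0.
apply: le_hausdorff_cost; [exact: borel_closure_nonempty|exact: ediam_borel_closure].
Qed.

End caratheodory_vec.

(** * The sphere has finite volume *)

Section hausdorff_finite.
Context {R : realType}.

Lemma hausdorff_cost_le n s (A : set 'rV[R]_n) (d : R) : 0 <= d -> (ediam A <= d%:E)%E ->
  (hausdorff_cost s A <= (ball_volume s / 2 ^+ s * d ^+ s)%:E)%E.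
Proof.
move=> d0 Ad; have b0 : 0 <= ball_volume s / 2 ^+ s :> R.
  by rewrite divr_ge0 ?exprn_ge0// ltW// ball_volume_gt0.
have [->|/set0P A0] := eqVneq A set0.
  by rewrite hausdorff_cost0 lee_fin mulr_ge0// exprn_ge0.
have /set0P/negbTE A0' := A0; rewrite /hausdorff_cost A0'.
have dA := ediam_ge0 A0.
have Af : ediam A \is a fin_num by rewrite ge0_fin_numE// (le_lt_trans Ad) ?ltry.
rewrite -(fineK Af) -EFin_expe -EFinM lee_fin ler_wpM2l//.
by rewrite lerXn2r ?nnegrE// ?fine_ge0// -lee_fin fineK.
Qed.

Lemma hausdorff_delta_finite_cover n s (d : R) (A : set 'rV[R]_n) (I : finType)
  (F : I -> set 'rV[R]_n) : 0 <= d -> (forall i, ediam (F i) <= d%:E)%E ->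
  (forall x, A x -> exists i, F i x) ->
  (hausdorff_delta s d A <= (#|I|%:R * (ball_volume s / 2 ^+ s * d ^+ s))%:E)%E.
Proof.
move=> d0 Fd AF; set c := ball_volume s / 2 ^+ s * d ^+ s.
have c0 : 0 <= c.
  by rewrite mulr_ge0 ?exprn_ge0// divr_ge0 ?exprn_ge0// ltW// ball_volume_gt0.
pose G k := nth set0 [seq F i | i <- enum I] k.
have sz : size [seq F i | i <- enum I] = #|I| by rewrite size_map -cardE.
have Gk k : (k < #|I|)%N -> exists i, G k = F i.
  rewrite /G -sz size_map => kI; have [i0 _] : exists i : I, True.
    by case: (enum I) kI => [//|i]; exists i.
  by exists (nth i0 (enum I) k); rewrite (nth_map i0).
have Gbig k : (#|I| <= k)%N -> G k = set0 by move=> Ik; rewrite /G nth_default// sz.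
apply: (@le_trans _ _ (\sum_(k <oo) hausdorff_cost s (G k))%E).
  apply: hausdorff_delta_cover => [k|x /AF[i Fx]].
    have [kI|kI] := ltnP k #|I|; first by have [i ->] := Gk k kI.
    by rewrite Gbig// ediam_set0 leNye.
  exists (index i (enum I)) => //; rewrite /G (nth_map i) ?index_mem ?mem_enum//.
  by rewrite nth_index// mem_enum.
have part K : (\sum_(0 <= k < K) hausdorff_cost s (G k) <= ((minn K #|I|)%:R * c)%:E)%E.
  elim: K => [|K IH]; first by rewrite big_geq// min0n mul0r.
  rewrite big_nat_recr//=; have [KI|KI] := ltnP K #|I|.
    rewrite (minn_idPl KI) -natr1 mulrDl mul1r EFinD; apply: leeD.
      by move: IH; rewrite (minn_idPl (ltnW KI)).
    by have [i ->] := Gk K KI; exact: hausdorff_cost_le.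
  rewrite (minn_idPr (leqW KI)) Gbig// hausdorff_cost0 adde0.
  by move: IH; rewrite (minn_idPr KI).
apply: lime_le; first by apply: is_cvg_nneseries => k _ _; exact: hausdorff_cost_ge0.
apply: nearW => K; apply: le_trans (part K) _.
by rewrite lee_fin ler_wpM2r// ler_nat geq_minr.
Qed.

(** The factor (N + 1)^s in the number of sets cancels against the s-th power of their diameter,
    which leaves a bound independent of N. *)
Lemma hausdorff_lty n s (A : set 'rV[R]_n) (C D : R) : 0 <= C -> 0 <= D ->
  (forall N : nat, exists (I : finType) (F : I -> set 'rV[R]_n),
    [/\ #|I|%:R <= C * N.+1%:R ^+ s,
        forall i, (ediam (F i) <= (D / N.+1%:R)%:E)%E &
        forall x, A x -> exists i, F i x]) ->
  (hausdorff s A < +oo)%E.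
Proof.
move=> C0 D0 H; set b : R := ball_volume s / 2 ^+ s.
have b0 : 0 <= b by rewrite divr_ge0 ?exprn_ge0// ltW// ball_volume_gt0.
apply: (@le_lt_trans _ _ (C * (b * D ^+ s))%:E); last by rewrite ltry.
apply: ge_hausdorff => d d0.
pose N := Num.trunc (D / d).
have N0 : 0 < N.+1%:R :> R by rewrite ltr0n.
have hN : D / N.+1%:R <= d.
  have := truncnS_gt (D / d); rewrite -/N ltr_pdivrMr// => h.
  by rewrite ler_pdivrMr// mulrC ltW.
apply: le_trans (hausdorff_delta_anti s A hN) _.
have [I [F [cI dF AF]]] := H N.
have DN : 0 <= D / N.+1%:R by rewrite divr_ge0// ltW.
apply: le_trans (hausdorff_delta_finite_cover s DN dF AF) _.
rewrite lee_fin -/b; apply: (@le_trans _ _ (C * N.+1%:R ^+ s * (b * (D / N.+1%:R) ^+ s))).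
  by rewrite ler_wpM2r// mulr_ge0// exprn_ge0.
rewrite le_eqVlt; apply/orP; left; apply/eqP.
rewrite expr_div_n; field; by rewrite expf_neq0// lt0r_neq0.
Qed.

(** Some coordinate of a unit vector of R^n has absolute value at least 1/n. Where that holds for a
    fixed coordinate and sign, the sphere is a Lipschitz graph over the other coordinates, and a
    grid there gives the cover. *)
Lemma hausdorff_usphere_lty m : (hausdorff m (usphere : set 'rV[R]_m.+1) < +oo)%E.
Proof.
pose n : R := m.+1%:R; have n0 : 0 < n by rewrite ltr0n.
have n1 : 1 <= n by rewrite ler1n.
(* There are 2n charts with (2M + 1)^m <= (3M)^m cells each, where M = N + 1. In the diameter, n
   comes from the m free coordinates and n^2 from the remaining one. *)
apply: (@hausdorff_lty _ _ _ (n * 2 * 3 ^+ m) (n + n ^+ 2)).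
- by rewrite !mulr_ge0 ?exprn_ge0// ltW.
- by rewrite addr_ge0 ?exprn_ge0// ltW.
move=> N; set M : R := N.+1%:R.
have M0 : 0 < M by rewrite ltr0n.
have M1 : 1 <= M by rewrite ler1n.
pose I := ('I_m.+1 * bool * {ffun 'I_m -> 'I_(2 * N.+1).+1})%type.
pose F (z : I) : set 'rV[R]_m.+1 := usphere `&`
  [set v : 'rV[R]_m.+1 | n^-1 <= (-1) ^+ z.1.2 * v 0 z.1.1 /\
   forall j : 'I_m, (z.2 j)%:R <= M * (v 0 (lift z.1.1 j) + 1) < (z.2 j).+1%:R].
exists I, F; split.
- rewrite !card_prod card_ord card_bool card_ffun !card_ord !natrM natrX -/n.
  rewrite -[leRHS]mulrA -exprMn ler_wpM2l ?mulr_ge0 ?(ltW n0)// lerXn2r ?nnegrE ?mulr_ge0 ?(ltW M0)//.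
  by rewrite -natr1 natrM -/M; lra.
- move=> [[i b] k]; apply: ge_ediam => x y [xS [/= x1 x2]] [yS [/= y1 y2]].
  rewrite lee_fin; apply: le_trans (enorm_le_sum _) _.
  have hj j : `|x 0 (lift i j) - y 0 (lift i j)| <= M^-1.
    have := x2 j; have := y2 j => /andP[a1 a2] /andP[b1 b2].
    rewrite -[leRHS]mulr1 ler_pdivlMl// -{1}(ger0_norm (ltW M0)) -normrM mulrBr.
    rewrite -natr1 in a2 b2.
    by rewrite ler_norml; apply/andP; split; lra.
  have bd1 v : usphere v -> forall l, `|v 0 l| <= 1 :> R.
    move=> vS l; apply: le_trans (coord_le_enorm v l) _.
    by move/usphere_enorm : vS => ->.
  have sumj (a : R) : 0 <= a -> \sum_(j < m) a <= n * a.
    by move=> a0; rewrite sumr_const card_ord -[leLHS]mulr_natl ler_wpM2r// ler_nat.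
  (* The squared norms agree, so x_i^2 - y_i^2 is controlled by the other coordinates and is at most
     2n/M in absolute value; division by |x_i + y_i| >= 2/n gives n^2/M. *)
  have hi : `|x 0 i - y 0 i| <= n ^+ 2 / M.
    have e : x 0 i ^+ 2 - y 0 i ^+ 2 =
        - \sum_(j < m) (x 0 (lift i j) ^+ 2 - y 0 (lift i j) ^+ 2).
      have := etrans (xS : dotv x x = 1) (esym (yS : dotv y y = 1)).
      rewrite /dotv (bigD1_ord i)//= [in RHS](bigD1_ord i)//= sumrB.
      rewrite (eq_bigr (fun j => x 0 (lift i j) ^+ 2)); last by move=> j _; rewrite expr2.
      rewrite [in X in _ = X -> _](eq_bigr (fun j => y 0 (lift i j) ^+ 2)); last first.
        by move=> j _; rewrite expr2.
      rewrite !expr2; lra.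
    have S1 : `|x 0 i ^+ 2 - y 0 i ^+ 2| <= 2 * n / M.
      rewrite e normrN; apply: le_trans (ler_norm_sum _ _ _) _.
      apply: (@le_trans _ _ (\sum_(j < m) (2 / M))); last first.
        have M2 : 0 <= 2 / M by rewrite divr_ge0// ltW.
        by apply: le_trans (sumj _ M2) _; rewrite mulrCA mulrA.
      apply: ler_sum => j _; rewrite subr_sqr normrM mulrC ler_pM//.
      rewrite (_ : 2 = 1 + 1)//; apply: le_trans (ler_normD _ _) _.
      by rewrite lerD// bd1.
    have S2 : 2 / n <= `|x 0 i + y 0 i|.
      have -> : `|x 0 i + y 0 i| = `|(-1) ^+ b * x 0 i + (-1) ^+ b * y 0 i|.
        by rewrite -mulrDr normrM normrX normrN1 expr1n mul1r.
      apply: (le_trans _ (ler_norm _)); have -> : 2 / n = n^-1 + n^-1 by rewrite -mulr2n mulr_natl.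
      by rewrite lerD.
    have S3 : `|x 0 i ^+ 2 - y 0 i ^+ 2| = `|x 0 i - y 0 i| * `|x 0 i + y 0 i|.
      by rewrite subr_sqr normrM.
    rewrite S3 in S1.
    have S4 : `|x 0 i - y 0 i| * (2 / n) <= 2 * n / M.
      by apply: le_trans S1; rewrite ler_wpM2l.
    rewrite mulrA ler_pdivrMr// in S4.
    have -> : n ^+ 2 / M = 2 * n / M * n / 2 by field; lra.
    by move: (2 * n / M * n) S4 => q S4; lra.
  rewrite (bigD1_ord i)//= !mxE addrC [leRHS]mulrDl; apply: lerD => //.
  apply: (@le_trans _ _ (\sum_(j < m) M^-1)); last by apply: sumj; rewrite invr_ge0 ltW.
  by apply: ler_sum => j _; rewrite !mxE.
- move=> x xS.
  have bd l : - 1 <= x 0 l <= 1.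
    rewrite -ler_norml; apply: le_trans (coord_le_enorm x l) _.
    by move/usphere_enorm : (xS) => ->.
  have [i hi] : exists i, n^-1 <= `|x 0 i|.
    apply: contrapT => /forallNP H.
    have : \sum_(i < m.+1) `|x 0 i| < \sum_(i < m.+1) n^-1.
      apply: ltr_sum => [|i _]; last by rewrite ltNge; apply/negP/H.
      by apply/hasP; exists ord0; rewrite // mem_index_enum.
    rewrite sumr_const card_ord -[X in _ < X -> _]mulr_natl mulfV ?gt_eqF//.
    apply/negP; rewrite -leNgt; move/usphere_enorm : (xS) => {1}<-.
    exact: enorm_le_sum.
  have hv j : 0 <= M * (x 0 (lift i j) + 1) < (2 * N.+1).+1%:R.
    have /andP[v1 v2] := bd (lift i j).
    rewrite -[(2 * N.+1).+1%:R]natr1 natrM -/M mulr_ge0 ?(ltW M0)//=; last lra.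
    have v3 : x 0 (lift i j) + 1 <= 2 by lra.
    by have := ler_wpM2l (ltW M0) v3; lra.
  have lt j : (Num.trunc (M * (x 0 (lift i j) + 1))%R < (2 * N.+1).+1)%N.
    by have /andP[h0 h1] := hv j; rewrite truncn_lt_nat.
  exists (i, x 0 i < 0, [ffun j => Ordinal (lt j)]); split => //=; split.
    have [s0|s0] := ltP (x 0 i) 0; first by rewrite expr1 mulN1r -(ltr0_norm s0).
    by rewrite expr0 mul1r -(ger0_norm s0).
  by move=> j; rewrite ffunE /=; have /andP[h0 h1] := hv j; exact: truncn_itv.
Qed.

End hausdorff_finite.

(** * The equator has positive volume *)

Section hausdorff_positive.
Context {R : realType}.

(** Induction on the dimension by slicing: the inequality for each slice is integrated over the last
    coordinate. The predicate [P] selects the cubes that meet the slice, and points are sequences so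
    that the dimension can vary. *)
Lemma box_cover_volume (c : R) (c0 : 0 <= c) s : forall (P : nat -> bool)
    (a : nat -> nat -> R) (l : nat -> R), (forall k, 0 <= l k) ->
  (forall x : nat -> R, (forall i, (i < s)%N -> 0 <= x i <= c) ->
     exists2 k, P k & forall i, (i < s)%N -> a k i <= x i <= a k i + l k) ->
  ((c ^+ s)%:E <= \sum_(k <oo) (if P k then l k ^+ s else 0)%:E)%E.
Proof.
elim: s => [|s IH] P a l l0 cov.
  (* In dimension 0 some cube is selected, and its term is l_k^0 = 1. *)
  have [//|k Pk _] := cov (fun=> 0).
  have := @nneseries_lim_ge R (fun k => (if P k then l k ^+ 0 else 0)%:E) xpredT 0%N k.+1.
  move=> H; apply: le_trans (H _); last by move=> i _ _; case: ifP.
  rewrite big_nat_recr//= Pk !expr0 leeDr// sume_ge0// => i _.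
  by case: ifP.
have w0 k : 0 <= (if P k then l k ^+ s else 0) by case: ifP => // _; rewrite exprn_ge0.
pose w k : R := if P k then l k ^+ s else 0.
pose I k : set R := `[a k s, a k s + l k]%classic.
pose f k (t : R) : \bar R := ((w k)%:E * (\1_(I k) t)%:E)%E.
have mI k : measurable (I k) by exact: measurable_itv.
have mf k D : measurable_fun D (f k).
  apply/measurable_EFinP; exact: measurable_funM.
have f0 k t : (0 <= f k t)%E by rewrite /f -EFinM lee_fin mulr_ge0// w0.
have Icc : lebesgue_measure (`[0, c]%classic : set R) = c%:E.
  rewrite lebesgue_measure_itv/= lte_fin; case: ltP => [_|c0']; first by rewrite sube0.
  by congr EFin; apply/eqP; rewrite eq_le c0 c0'.
have Ik k : lebesgue_measure (I k) = (l k)%:E.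
  rewrite lebesgue_measure_itv/= lte_fin; case: ltP => [_|c0'].
    by rewrite -EFinB addrAC subrr add0r.
  by congr EFin; apply/eqP; rewrite eq_le l0/= -(lerD2l (a k s)) addr0 c0'.
have pt t : 0 <= t <= c -> ((c ^+ s)%:E <= \sum_(k <oo) f k t)%E.
  move=> tc; have := IH (fun k => P k && (t \in I k)) a l l0 _.
  rewrite (eq_eseriesr (g := fun k => f k t)).
    apply=> x xc.
    have [i|k Pk H] := cov (fun i => if i == s then t else x i).
      by rewrite ltnS leq_eqVlt; case: eqP => //= _; exact: xc.
    exists k.
      rewrite Pk/=; apply/mem_set; rewrite /I /= in_itv/=.
      by have := H s (ltnSn s); rewrite eqxx.
    by move=> i ilt; have := H i (leqW ilt); rewrite ltn_eqF.
  move=> k _; rewrite /f /w indicE; case: (P k) => /=; last by rewrite mul0e.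
  by case: (t \in I k); rewrite ?mule1 ?mule0.
rewrite exprSr EFinM -Icc -integral_cst//.
apply: (@le_trans _ _ (\int[lebesgue_measure]_(t in `[0%R, c]) \sum_(k <oo) f k t)%E).
  apply: ge0_le_integral => //.
  - by move=> t _; rewrite lee_fin exprn_ge0.
  - apply: ge0_emeasurable_sum => // k _; exact: mf.
rewrite (integral_nneseries lebesgue_measure (measurable_itv _) (fun k => mf k _) (fun k t _ => f0 k t)).
apply: lee_nneseries => [k _ _|k _]; first by apply: integral_ge0 => t _; exact: f0.
rewrite /f ge0_integralZl_EFin//; last 2 first.
- apply/measurable_EFinP; exact: measurable_indic (mI k).
- exact: w0.
rewrite integral_indic//.
apply: (@le_trans _ _ ((w k)%:E * (l k)%:E)%E).
  apply: lee_wpmul2l; first by rewrite lee_fin w0.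
  rewrite -Ik; apply: le_measure; [|exact: mem_set (mI k)|by move=> t []].
  by apply: mem_set; apply: measurableI; [exact: mI|exact: measurable_itv].
by rewrite -EFinM lee_fin /w; case: ifP => // _; rewrite ?mul0r// exprSr.
exact: mI.
Qed.

(** A set of diameter d lies in a cube of side 2d around any of its points, so [box_cover_volume]
    bounds every cover from below. The doubled side turns the 2^s of the Hausdorff cost into 4^s. *)
Lemma hausdorff_cube_gt0 s (c : R) : 0 < c ->
  (0 < hausdorff s [set x : 'rV[R]_s | forall i, (0 <= x 0 i <= c)%R])%E.
Proof.
move=> c0; set Q := [set x | _].
have b0 : 0 < ball_volume s / 4 ^+ s :> R by rewrite divr_gt0 ?exprn_gt0// ball_volume_gt0.
apply: lt_le_trans (le_hausdorff_delta s Q ltr01).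
apply: (@lt_le_trans _ _ (ball_volume s / 4 ^+ s * c ^+ s)%:E).
  by rewrite lte_fin mulr_gt0// exprn_gt0.
apply: le_ereal_inf_tmp => _ [F [Fd QF] <-].
have dfin k : F k !=set0 -> ediam (F k) \is a fin_num.
  by move=> Fk; rewrite ge0_fin_numE ?ediam_ge0// (le_lt_trans (Fd k)) ?ltry.
pose P k := `[< F k !=set0 >].
have /choice[y Hy] : forall k, exists y, P k -> F k y.
  move=> k; have [[y Fy]|nF] := pselect (F k !=set0); first by exists y.
  by exists 0 => /asboolP.
pose d k : R := if P k then fine (ediam (F k)) else 0.
have d0 k : 0 <= d k.
  by rewrite /d; case: ifPn => // /asboolP Fk; rewrite fine_ge0// ediam_ge0.
have l0 k : 0 <= 2 * d k by rewrite mulr_ge0.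
pose a k (i : nat) : R := (if insub i is Some j then y k 0 j else 0) - d k.
have cov (x : nat -> R) : (forall i, (i < s)%N -> 0 <= x i <= c) ->
    exists2 k, P k & forall i, (i < s)%N -> a k i <= x i <= a k i + 2 * d k.
  move=> xc; have [|k _ Fk] := QF (\row_(i < s) x i).
    by move=> i; rewrite mxE; exact: xc.
  have Pk : P k by apply/asboolP; exists (\row_(i < s) x i).
  exists k => // i ilt; rewrite /a insubT.
  have Fk0 : F k !=set0 by exact/asboolP.
  have := le_ediam_ub Fk (Hy k Pk); rewrite -(fineK (dfin k Fk0)) lee_fin => h.
  have dk : d k = fine (ediam (F k)) by rewrite /d Pk.
  have := coord_le_enorm (\row_(i < s) x i - y k) (Ordinal ilt).
  rewrite !mxE /= => /le_trans/(_ h); rewrite -dk ler_norml => /andP[h1 h2].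
  by apply/andP; split; lra.
have := box_cover_volume (ltW c0) l0 cov => H.
have bE : (0 <= (ball_volume s / 4 ^+ s)%:E :> \bar R)%E by rewrite lee_fin ltW.
rewrite EFinM; apply: le_trans (lee_wpmul2l bE H) _.
rewrite -nneseriesZl//; last by move=> k _; rewrite lee_fin; case: ifP => // _; rewrite exprn_ge0.
apply: lee_nneseries => k _.
  by move=> _; rewrite mule_ge0// lee_fin; case: ifP => // _; rewrite exprn_ge0.
case: ifP => [Pk|_]; last by rewrite mule0 hausdorff_cost_ge0.
have Fk0 : F k !=set0 by exact/asboolP.
have /set0P/negbTE Fk := Fk0.
rewrite /hausdorff_cost Fk /d Pk -{2}(fineK (dfin k Fk0)) -EFin_expe -!EFinM lee_fin.
rewrite exprMn mulrA ler_wpM2r ?exprn_ge0 ?fine_ge0 ?ediam_ge0//.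
rewrite (_ : 4 = 2 * 2) ?exprMn; last by rewrite -natrM.
by rewrite le_eqVlt; apply/orP; left; apply/eqP; field; rewrite expf_neq0.
Qed.

Definition consv n (a : R) (x : 'rV[R]_n) : 'rV[R]_n.+1 :=
  \row_j oapp (x 0) a (unlift ord0 j).

Definition tailv n (x : 'rV[R]_n.+1) : 'rV[R]_n := \row_j x 0 (lift ord0 j).

Lemma dotv_consv n a b (x y : 'rV[R]_n) : dotv (consv a x) (consv b y) = a * b + dotv x y.
Proof.
rewrite /dotv big_ord_recl !mxE unlift_none; congr (_ + _).
by apply: eq_bigr => i _; rewrite !mxE liftK.
Qed.

Lemma consv_tailv n (x : 'rV[R]_n.+1) : consv (x 0 ord0) (tailv x) = x.
Proof.
apply/rowP => j; rewrite mxE; case: unliftP => [i ->|->] //=.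
by rewrite mxE.
Qed.

Lemma tailv_consv n a (x : 'rV[R]_n) : tailv (consv a x) = x.
Proof. by apply/rowP => j; rewrite !mxE liftK. Qed.

Lemma enorm_tailv n (x y : 'rV[R]_n.+1) : enorm (tailv x - tailv y) <= enorm (x - y).
Proof.
have -> : tailv x - tailv y = tailv (x - y) by apply/rowP => j; rewrite !mxE.
rewrite /enorm ler_wsqrtr// -{3 4}(consv_tailv (x - y)) dotv_consv lerDr.
by rewrite -expr2 sqr_ge0.
Qed.

Definition equator0 m : set 'rV[R]_m.+2 := usphere `&` [set x | x 0 ord0 = 0].
Arguments equator0 m _ : clear implicits.

(** The equator is an isometric copy of the unit sphere of one dimension less. *)
Lemma hausdorff_equator_lty m : (hausdorff m (equator0 m) < +oo)%E.
Proof.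
apply: le_lt_trans (hausdorff_usphere_lty m).
apply: (@le_trans _ _ (hausdorff m (consv 0 @` (usphere : set 'rV[R]_m.+1)))).
  apply: le_outer_measure => x [xS /= x0]; exists (tailv x).
    rewrite /usphere /=; have := xS; rewrite /usphere /= -{1 2}(consv_tailv x) dotv_consv x0.
    by rewrite mul0r add0r.
  by rewrite -{2}(consv_tailv x) x0.
apply: hausdorff_contraction => x y _ _.
have -> : consv 0 x - consv 0 y = consv 0 (x - y).
  by apply/rowP => j; rewrite !mxE; case: unliftP => [i _|_] /=; rewrite ?mxE ?subrr.
by rewrite /enorm dotv_consv mul0r add0r.
Qed.

(** Dropping the first two coordinates is a contraction whose image of the equator contains a cube:
    the first coordinate is 0 and the second is solved for. The side 1/(m + 1) keeps |x|^2 at most 1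
    on the cube. *)
Lemma hausdorff_equator_gt0 m : (0 < hausdorff m (equator0 m))%E.
Proof.
pose c : R := m.+1%:R^-1; have c0 : 0 < c by rewrite invr_gt0 ltr0n.
apply: lt_le_trans (hausdorff_cube_gt0 m c0) _.
pose psi (x : 'rV[R]_m.+2) : 'rV[R]_m := tailv (tailv x).
apply: (@le_trans _ _ (hausdorff m (psi @` equator0 m))); last first.
  apply: hausdorff_contraction => x y _ _; apply: le_trans (enorm_tailv _ _) _.
  exact: enorm_tailv.
apply: le_outer_measure => x /= xc.
have x1 : dotv x x <= 1.
  apply: (@le_trans _ _ (\sum_(i < m) c)).
    apply: ler_sum => i _; have /andP[h1 h2] := xc i.
    have c1 : c <= 1 by rewrite invf_le1 ?ltr0n// ler1n.
    by rewrite -[leRHS]mul1r ler_pM// (le_trans h2).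
  rewrite sumr_const card_ord -[leLHS]mulr_natl ler_pdivrMr ?ltr0n// mul1r.
  by rewrite ler_nat.
exists (consv 0 (consv (Num.sqrt (1 - dotv x x)) x)); last by rewrite /psi !tailv_consv.
split; last by rewrite /= mxE unlift_none.
rewrite /usphere /= !dotv_consv mul0r add0r -expr2 sqr_sqrtr ?subr_ge0//.
by rewrite subrK.
Qed.

End hausdorff_positive.
Arguments equator0 {R} m _.

(** * Borel versions of Caratheodory measurable functions *)

Section hausdorff_vec.
Context {R : realType} {n : nat} (s : nat).

(** One set function, two structures: Borel sets here, where the monotone class arguments apply, and
    Caratheodory sets in [hausdorff_cara], where the theorem is stated. *)
Definition hausdorff_vec (A : set (vecT R n)) : \bar R := hausdorff s A.

Let hausdorff_vec0 : hausdorff_vec set0 = 0%E.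
Proof. exact: outer_measure0. Qed.

Let hausdorff_vec_ge0 A : (0 <= hausdorff_vec A)%E.
Proof. exact: outer_measure_ge0. Qed.

Let hausdorff_vec_sigma_additive : semi_sigma_additive hausdorff_vec.
Proof.
move=> F mF tF mUF.
apply: (@caratheodory_measure_sigma_additive R _ (@hausdorff R n s)) => //.
- by move=> k; exact: measurable_caratheodory.
- exact: measurable_caratheodory.
Qed.

HB.instance Definition _ := isMeasure.Build _ _ _ hausdorff_vec
  hausdorff_vec0 hausdorff_vec_ge0 hausdorff_vec_sigma_additive.

Definition hausdorff_outer : {outer_measure set 'rV[R]_n -> \bar R} := @hausdorff R n s.

Definition hausdorff_cara : {measure set (caratheodory_type hausdorff_outer) -> \bar R} :=
  (hausdorff_outer : set (caratheodory_type hausdorff_outer) -> \bar R).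

Lemma null_hull (A : set 'rV[R]_n) : hausdorff s A = 0%E ->
  exists N : set (vecT R n), [/\ measurable N, A `<=` N & hausdorff s N = 0%E].
Proof.
move=> A0; have [|N [mN AN N0]] := @borel_hull R n s A; first by rewrite A0 ltry.
exists N; split => //; apply/eqP; rewrite eq_le outer_measure_ge0 andbT.
by rewrite -A0.
Qed.

Lemma ae_null_hull (P : 'rV[R]_n -> Prop) : {ae hausdorff_cara, forall x, P x} ->
  exists N : set (vecT R n), [/\ measurable N, hausdorff s N = 0%E & forall x, ~ N x -> P x].
Proof.
move=> [A [_ A0 PA]]; have [N [mN AN N0]] := null_hull A0.
exists N; split => // x Nx; apply: contrapT => nP; apply: Nx; apply: AN; exact: PA.
Qed.

(** The superlevel sets [A j] at rational levels have Borel hulls [B j] of the same measure. Off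
    Borel null sets containing the differences, {c < f} is the union of the [B j] over the levels
    q_j >= c. *)
Lemma caratheodory_borel_fun (S : set (vecT R n)) (f : 'rV[R]_n -> R) :
  measurable S -> (hausdorff s S < +oo)%E ->
  measurable_fun (S : set (caratheodory_type hausdorff_outer)) f ->
  exists N : set (vecT R n), [/\ measurable N, hausdorff s N = 0%E &
    measurable_fun (S `\` N) (f : vecT R n -> R)].
Proof.
move=> mS Sfin mf.
pose q j : R := ratr (odflt 0 (unpickle j : option rat)).
pose A j := S `&` [set x | q j < f x].
have mSc := measurable_caratheodory s mS.
have mA j : measurable (A j : set (caratheodory_type hausdorff_outer)).
  rewrite (_ : A j = S `&` f @^-1` `]q j, +oo[%classic); first by apply: mf.
  by congr setI; apply/seteqP; split => x /=; rewrite in_itv/= andbT.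
have Afin j : (hausdorff s (A j) < +oo)%E.
  by apply: le_lt_trans Sfin; apply: le_outer_measure => x [].
have /choice[B HB] : forall j, exists B : set (vecT R n),
    [/\ measurable B, A j `<=` B & (hausdorff s B <= hausdorff s (A j))%E].
  by move=> j; exact: borel_hull.
(* Measurability of [A j] splits its hull additively, and finiteness permits the subtraction. *)
have D0 j : hausdorff s (B j `\` A j) = 0%E.
  have [mB AB BA] := HB j.
  have := mA j (B j); rewrite setDE => e.
  have Af : hausdorff s (A j) \is a fin_num by rewrite ge0_fin_numE// outer_measure_ge0.
  have : (hausdorff s (A j) + hausdorff s (B j `&` ~` A j) <= hausdorff s (A j))%E.
    apply: le_trans BA; rewrite [leRHS]e; apply: leeD => //.
    by rewrite setIidr.
  rewrite -leeBrDl// subee// => h; apply/eqP; rewrite eq_le h outer_measure_ge0//.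
have /choice[N HN] : forall j, exists N : set (vecT R n),
    [/\ measurable N, (B j `\` A j) `<=` N & hausdorff s N = 0%E].
  by move=> j; exact: null_hull.
exists (\bigcup_j N j); split.
- by apply: bigcupT_measurable => j; have [] := HN j.
- apply/eqP; rewrite eq_le outer_measure_ge0 andbT.
  apply: le_trans (outer_measure_sigma_subadditive _ _) _.
  by rewrite eseries0// => j _ _; have [] := HN j.
apply: (measurability _ (RGenOInfty.measurableE R)) => _ [_ [c ->] <-].
have mN : measurable (\bigcup_j N j) by apply: bigcupT_measurable => j; have [] := HN j.
rewrite (_ : _ `&` _ = \bigcup_j
    (if c <= q j then B j `&` (S `\` \bigcup_j N j) else set0)).
  apply: bigcupT_measurable => j; case: ifP => // _; have [mB _ _] := HB j.
  by apply: measurableI => //; exact: measurableD.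
apply/seteqP; split => x.
  move=> [[Sx nNx]]; rewrite /= in_itv/= andbT => cf.
  have [r] := @rat_in_itvoo R _ _ cf; rewrite in_itv/= => /andP[r1 r2].
  exists (pickle r) => //; rewrite /q pickleK /= ifT ?ltW//.
  have [_ AB _] := HB (pickle r); split => //; apply: AB; split => //=.
  by rewrite /q pickleK.
move=> [j _]; case: ifP => // cq [Bx [Sx nNx]]; split => //=; rewrite in_itv/= andbT.
apply: le_lt_trans cq _; apply: contrapT => nf; apply: nNx; exists j => //.
by have [_ + _] := HN j; apply; split => // -[].
Qed.

End hausdorff_vec.
Arguments hausdorff_cara {R n} s.
Arguments hausdorff_outer {R n} s.

(** * The volumes of the sphere and of its equators *)

Section sphere_measures.
Context {R : realType} {m : nat}.
Local Notation T := (vecT R m.+2).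
Local Notation S := (usphere : set (vecT R m.+2)).
Let mS : measurable S := measurable_usphere.

Let mE : measurable (equator0 m : set T).
Proof.
apply: measurableI; first exact: mS.
have := measurable_coord (n := m.+2) (R := R) ord0 measurableT (measurable_set1 0).
by rewrite setTI; apply.
Qed.

Let finS : (hausdorff_vec m.+1 S < +oo)%E := @hausdorff_usphere_lty R m.+1.
Let finE : (hausdorff_vec m (equator0 m : set T) < +oo)%E := @hausdorff_equator_lty R m.

Definition sphere_vol : {finite_measure set T -> \bar R} := mfrestr mS finS.
Definition equator_vol : {finite_measure set T -> \bar R} := mfrestr mE finE.

Lemma sphere_volE A : sphere_vol A = hausdorff m.+1 (A `&` S).
Proof. by []. Qed.

Lemma equator_volE A : equator_vol A = hausdorff m (A `&` equator0 m).
Proof. by []. Qed.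

Lemma sphere_vol_refl w (A : set T) : measurable A -> sphere_vol (refl w @^-1` A) = sphere_vol A.
Proof.
move=> _; rewrite !sphere_volE -{1}(usphere_refl w) -preimage_setI.
exact: hausdorff_refl.
Qed.

Lemma sphere_vol_opp (A : set T) : measurable A -> sphere_vol (-%R @^-1` A) = sphere_vol A.
Proof.
move=> _; rewrite !sphere_volE -{1}usphereN -preimage_setI.
exact: hausdorff_opp.
Qed.

Definition pole : 'rV[R]_m.+2 := delta_mx 0 ord0.

Lemma usphere_delta (i : 'I_m.+2) : usphere (delta_mx 0 i : 'rV[R]_m.+2).
Proof. by rewrite /usphere /= dotv_delta mxE !eqxx. Qed.

Lemma equator0E (x : 'rV[R]_m.+2) : equator0 m x <-> usphere x /\ dotv x pole = 0.
Proof. by rewrite dotvC dotv_delta. Qed.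

Lemma equator_vol_refl w (A : set T) : dotv w pole = 0 -> measurable A ->
  equator_vol (refl w @^-1` A) = equator_vol A.
Proof.
move=> we _; rewrite !equator_volE.
rewrite (_ : _ `&` _ = refl w @^-1` (A `&` equator0 m)); first exact: hausdorff_refl.
rewrite preimage_setI; congr setI; apply/seteqP; split => x /=.
  move=> /equator0E[xS xe]; apply/equator0E; split; first exact/usphere_reflP.
  by rewrite -refl_dotvr refl_perp// dotvC.
move=> /equator0E[/usphere_reflP xS xe]; apply/equator0E; split => //.
by rewrite -xe -refl_dotvr refl_perp// dotvC.
Qed.

Lemma equator_vol_opp (A : set T) : measurable A -> equator_vol (-%R @^-1` A) = equator_vol A.
Proof.
move=> _; rewrite !equator_volE.
rewrite (_ : _ `&` _ = -%R @^-1` (A `&` equator0 m)); first exact: hausdorff_opp.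
rewrite preimage_setI; congr setI; apply/seteqP; split => x /=.
  move=> /equator0E[xS xe]; apply/equator0E; split; first exact/usphereNP.
  by rewrite dotvNl xe oppr0.
move=> /equator0E[/usphereNP xS xe]; apply/equator0E; split => //.
by apply/eqP; rewrite -oppr_eq0 -dotvNl xe.
Qed.

Lemma equator_vol_perp : {ae equator_vol, forall y, S y -> dotv y pole = 0}.
Proof.
exists (S `\` (equator0 m : set T)); split; first exact: (measurableD mS mE).
  rewrite equator_volE (_ : _ `&` _ = set0) ?outer_measure0//.
  by apply/seteqP; split => // x [[_ nE] E].
by move=> y /= /not_implyP[yS ye]; split => // /equator0E[].
Qed.

Lemma equator_vol_gt0 : equator_vol S != 0%E.
Proof.
rewrite equator_volE (_ : _ `&` _ = equator0 m).
  by rewrite gt_eqF//; exact: hausdorff_equator_gt0.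
by apply/seteqP; split => x; [case|move=> [xS x0]].
Qed.

(* The integral over the equator of [u], taken in the sense of Caratheodory
   measurability, is [equator_int] once a Borel version is chosen. *)
Lemma caratheodory_equator_int (N : set T) (f f' : 'rV[R]_m.+2 -> R) (u : T) :
  measurable N -> S u -> equator_int equator_vol pole \1_N u = 0 ->
  measurable_fun ((S `&` [set x | dotv x u = 0]) : set (caratheodory_type (@hausdorff_outer R m.+2 m))) f ->
  bounded_mfun S (f' : T -> R) -> (forall x, S x -> ~ N x -> f x = f' x) ->
  \int[hausdorff_cara m]_(x in S `&` [set x | dotv x u = 0]) f x =
  equator_int equator_vol pole f' u.
Proof.
move=> mN uS TN mf bf' ff'.
set w := u - pole; set E := S `&` [set x | dotv x u = 0].
have rE : refl w @^-1` (equator0 m) = E.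
  have ru : refl w pole = u.
    by apply: refl_subr; rewrite (uS : dotv u u = 1) (usphere_delta ord0).
  apply/seteqP; split => x.
    by move=> /equator0E[/usphere_reflP xS]; rewrite -refl_dotvr ru => xu; split.
  move=> [xS /= xu]; apply/equator0E; split; first exact/usphere_reflP.
  by rewrite -refl_dotvr ru.
have mr := measurable_reflr w : measurable_fun setT (refl w : T -> T).
have mEu : measurable (E : set T).
  by rewrite -rE -[X in measurable X]setTI; exact: mr.
(* The hypothesis on T 1_N says, after undoing the reflection, that [N] is null in the equator of
   [u]. *)
have NE0 : hausdorff m (N `&` E) = 0%E.
  have -> : hausdorff m (N `&` E) = equator_vol (S `&` refl w @^-1` N).
    rewrite equator_volE -(hausdorff_refl m w); congr (hausdorff _ _).
    rewrite preimage_setI -rE -comp_preimage (_ : refl w \o refl w = id); last first.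
      by apply/funext => x /=; rewrite reflK.
    rewrite preimage_id; apply/seteqP; split => x; first by move=> [xN [xS x0]].
    by move=> [[xS xN] xE].
  have mrN : measurable (S `&` refl w @^-1` N).
    by apply: measurableI => //; rewrite -[X in measurable X]setTI; exact: mr.
  have := TN; rewrite equator_intE// (_ : Rintegral _ _ _ =
     \int[equator_vol]_(y in S) \1_(refl w @^-1` N) y).
    rewrite /Rintegral integral_indic//; last first.
      by rewrite -[X in measurable X]setTI; exact: mr.
    rewrite setIC => /eqP; rewrite fine_eq0 ?fin_num_measure// => /eqP.
    exact.
  by apply: eq_Rintegral => y _; rewrite !indicE.
have [mf' [M fM]] := bf'.
have mf'c D : measurable_fun (D : set (caratheodory_type (@hausdorff_outer R m.+2 m))) f'.
  apply: measurable_funTS.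
  exact: (measurableT_comp mf' (@measurable_id_caratheodory R m.+2 m)).
have mEc := measurable_caratheodory m mEu.
transitivity (\int[hausdorff_cara m]_(x in E) f' x).
  have mff : measurable_fun (E : set (caratheodory_type (@hausdorff_outer R m.+2 m))) (EFin \o f).
    exact/measurable_EFinP.
  have mff' : measurable_fun (E : set (caratheodory_type (@hausdorff_outer R m.+2 m))) (EFin \o f').
    by apply/measurable_EFinP; exact: mf'c.
  have ae : ae_eq (hausdorff_cara m) E (EFin \o f) (EFin \o f').
    exists (N `&` E); split.
    - exact: measurableI (measurable_caratheodory m mN) mEc.
    - exact: NE0.
    - move=> x /= /not_implyP[xE]; apply: contra_notP => h; rewrite ff'//; first by case: xE.
      by move=> Nx; apply: h; split.
  exact: (congr1 fine (ae_eq_integral _ _ mEc mff mff' ae)).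
have bfr : bounded_mfun S (fun y : T => f' (refl w y)) := bounded_mfun_reflr w bf'.
transitivity (\int[equator_vol]_(y in (equator0 m : set T)) f' (refl w y)); last first.
  rewrite equator_intE// -/w.
  rewrite -[X in Rintegral _ X _](_ : S `&` equator0 m = _); last first.
    by apply/seteqP; split => x; [case|move=> [xS x0]].
  rewrite Rintegral_mkcondr.
  have bE : bounded_mfun S ((fun y : T => f' (refl w y)) \_ (equator0 m)).
    split; first by apply/(measurable_restrictT (fun y : T => f' (refl w y))) => //;
      exact: measurable_funTS bfr.1.
    case: bfr => _ [M' M'b]; exists `|M'| => x xS; rewrite /restrict; case: ifP => _.
      by rewrite (le_trans (M'b x xS))// ler_norm.
    by rewrite normr0.
  apply: Rintegral_ae_eq_bounded => //.
  apply: filterS equator_vol_perp => y H yS; rewrite /restrict mem_set//.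
  by apply/equator0E; split => //; exact: H.
(* The reflection, read as a map from the Caratheodory to the Borel structure. The image measure
   agrees with [equator_vol] on subsets of the equator of [pole]. *)
pose rc : caratheodory_type (@hausdorff_outer R m.+2 m) -> T := refl w.
have mrc : measurable_fun setT rc := measurableT_comp mr (@measurable_id_caratheodory R m.+2 m).
have rcE : rc @^-1` (equator0 m) = E by exact: rE.
congr fine.
transitivity (\int[pushforward (hausdorff_cara m) rc]_(y in (equator0 m : set T)) (f' (refl w y))%:E)%E.
  rewrite integral_pushforward//.
  - rewrite rcE; apply: eq_integral => x _ /=; rewrite /rc reflK//.
  - by apply/measurable_EFinP; case: bfr.
  - rewrite rcE; apply: (@le_integrable _ _ _ _ _ _ _ (cst M%:E)) => //.
    + apply/measurable_EFinP; have := mf'c E; apply: eq_measurable_fun => x _.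
      by rewrite /= /rc reflK.
    + by move=> x [xS _]; rewrite /= /rc reflK lee_fin (le_trans (fM x xS))// ler_norm.
    apply: (@measurable_bounded_integrable _ _ _ (hausdorff_cara m) (cst M) E) => //.
    + rewrite /hausdorff_cara /= -(hausdorff_refl m w E) -rE -comp_preimage.
      rewrite (_ : refl w \o refl w = id); last by apply/funext => x /=; rewrite reflK.
      by rewrite preimage_id; exact: finE.
    + by exists `|M|; split; rewrite ?num_real// => M' MM' x _ /=; rewrite ltW.
apply: eq_measure_integral => A mA AE.
apply: (@etrans _ _ (hausdorff m A)); first exact: hausdorff_refl.
by rewrite -[RHS]/(hausdorff m (A `&` equator0 m)) setIidl.
Qed.

End sphere_measures.

(** * Isotropic restrictions *)

Section isotropic_restrictions.
Context {R : realType} {m : nat} (m_gt0 : (0 < m)%N).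
Local Notation T := (vecT R m.+2).
Local Notation S := (usphere : set (vecT R m.+2)).
Let mS : measurable S := measurable_usphere.
Let equator (u : 'rV[R]_m.+2) : set T := S `&` [set x | dotv x u = 0].
Let e1 : 'rV[R]_m.+2 := delta_mx 0 (lift ord0 ord0).
Let e1S : usphere e1 := usphere_delta _.
Let poleS : usphere (pole : 'rV[R]_m.+2) := usphere_delta _.
Let e1pole : dotv e1 pole = 0.
Proof. by rewrite dotv_delta mxE. Qed.
Local Notation mu := (@sphere_vol R m).
Local Notation sig := (@equator_vol R m).
Local Notation Tr := (equator_int sig pole).

Let equator_null N : measurable N -> mu N = 0%E -> {ae mu, forall u, S u -> Tr \1_N u = 0} :=
  null_equator_int (@sphere_vol_refl R m) (@sphere_vol_opp R m) poleS e1S e1pole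
    (@equator_vol_refl R m) (@equator_vol_opp R m) (@equator_vol_perp R m) (N := N).

Let equators_const f := @isotropic_equators_const R m.+2 mu sig
  (@sphere_vol_refl R m) (@sphere_vol_opp R m) pole e1 poleS e1S e1pole
  (@equator_vol_refl R m) (@equator_vol_opp R m) (@equator_vol_perp R m) (@equator_vol_gt0 R m) f.

(** Isotropy evaluates the quadratic form p -> T (f' <p,.>^2) u on unit vectors orthogonal to u;
    scaling and [proj] give it everywhere as (|p|^2 - <p,u>^2) c. *)
Lemma equator_int_isotropic (f' : 'rV[R]_m.+2 -> R) (u a : T) (c : R) :
  bounded_mfun S (f' : T -> R) -> S u -> S a ->
  (forall x, equator u x -> Tr (fun y => f' y * dotv x y ^+ 2) u = c) ->
  (forall p, Tr (fun y => f' y * dotv p y ^+ 2) u =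
     Tr (fun y => f' y * dotv (p - dotv p u *: (u : 'rV[R]_m.+2)) y ^+ 2) u) ->
  (m.+2%:R - 1) * Tr (fun y => f' y * dotv a y ^+ 2) u = (1 - dotv a u ^+ 2) * Tr f' u.
Proof.
move=> bf' uS aS isoc proj.
have bX p : bounded_mfun S (fun y : T => f' y * dotv p y ^+ 2).
  by apply: bounded_mfunM => //; exact: bounded_mfun_dotvX.
have TrE p : Tr (fun y => f' y * dotv p y ^+ 2) u = (dotv p p - dotv p u ^+ 2) * c.
  rewrite proj; set q := p - _.
  have qu : dotv q u = 0 by rewrite dotvBl dotvZl (uS : dotv u u = 1) mulr1 subrr.
  have qq : dotv q q = dotv p p - dotv p u ^+ 2.
    rewrite {2}/q dotvBr dotvZr qu mulr0 subr0 dotvBl dotvZl (dotvC u p) expr2 //.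
  rewrite -qq; have [q0|q0] := eqVneq q 0.
    rewrite q0 dotv0l mul0r equator_intE//.
    transitivity (\int[sig]_(y in S) (0 : R)); last by rewrite Rintegral_cst// mul0r.
    by apply: eq_Rintegral => y _; rewrite dotv0l expr0n mulr0.
  have qp : 0 < dotv q q by rewrite lt_neqAle eq_sym dotv_eq0 q0 dotv_ge0.
  pose r := Num.sqrt (dotv q q); have r0 : 0 < r by rewrite sqrtr_gt0.
  have rr : r ^+ 2 = dotv q q by rewrite sqr_sqrtr// ltW.
  pose x := r^-1 *: q.
  have xS : equator u x.
    split; last by rewrite /= dotvZl qu mulr0.
    by rewrite /usphere /= dotvZl dotvZr -rr; field; rewrite lt0r_neq0.
  rewrite -(isoc x xS) -rr -(equator_intZ sig pole (r ^+ 2) (bX x) uS).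
  apply: eq_equator_int => // y _; rewrite /x dotvZl exprMn; field.
  by rewrite lt0r_neq0.
rewrite TrE (aS : dotv a a = 1).
(* The trace of the quadratic form over the standard basis determines c. *)
have -> : Tr f' u = (m.+2%:R - 1) * c; last by ring.
transitivity (\sum_(i < m.+2) Tr (fun y => f' y * dotv (delta_mx 0 i) y ^+ 2) u).
  rewrite equator_intE//.
  rewrite (eq_bigr (fun i => \int[sig]_(y in S) (f' (refl ((u : 'rV[R]_m.+2) - pole) y) *
     dotv (delta_mx 0 i) (refl ((u : 'rV[R]_m.+2) - pole) y) ^+ 2))); last first.
    by move=> i _; rewrite equator_intE.
  rewrite -Rintegral_sum_bounded//; last first.
    by move=> i; exact: (bounded_mfun_reflr _ (bX (delta_mx 0 i))).
  apply: eq_Rintegral => y /set_mem yS; rewrite -mulr_sumr sum_dotv_delta dotv_refl.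
  by rewrite (yS : dotv y y = 1) mulr1.
rewrite (eq_bigr (fun i => (1 - (u : 'rV[R]_m.+2) 0 i ^+ 2) * c)); last first.
  by move=> i _; rewrite TrE !dotv_delta mxE !eqxx.
rewrite -mulr_suml sumrB sumr_const card_ord; congr ((_ - _) * _).
by rewrite -[RHS](uS : dotv u u = 1); apply: eq_bigr => i _; rewrite expr2.
Qed.

Lemma isotropic_restrictions_const (f : 'rV[R]_m.+2 -> R) :
  measurable_fun (S : set (caratheodory_type (hausdorff_outer m.+1))) f ->
  (exists M : R, {ae hausdorff_cara m.+1, forall x, S x -> `|f x| <= M}) ->
  (forall x, S x -> f (- x) = f x) ->
  {ae hausdorff_cara m.+1, forall u, S u ->
     measurable_fun (equator u : set (caratheodory_type (hausdorff_outer m))) f /\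
     exists c : R, forall x, equator u x ->
       \int[hausdorff_cara m]_(y in equator u) (dotv x y ^+ 2 * f y) = c} ->
  exists c : R, {ae hausdorff_cara m.+1, forall x, S x -> f x = c}.
Proof.
move=> mf [M fb] fe fiso.
have [N1 [mN1 N10 HN1]] := ae_null_hull fb.
have [N3 [mN3 N30 HN3]] := ae_null_hull fiso.
have [N2 [mN2 N20 mfN2]] := caratheodory_borel_fun mS (hausdorff_usphere_lty m.+1) mf.
pose N0 : set T := N1 `|` N2.
(* The null set is made symmetric so that [f'], which is 0 on it, is even at every point of the
   sphere. *)
pose N : set T := N0 `|` -%R @^-1` N0.
have mN0 : measurable N0 by exact: measurableU.
have mN0o : measurable (-%R @^-1` N0 : set T).
  by rewrite -[X in measurable X]setTI; exact: measurable_oppv.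
have mN : measurable N by exact: measurableU.
have N00 : hausdorff m.+1 N0 = 0%E.
  apply/eqP; rewrite eq_le outer_measure_ge0 andbT.
  have h : (hausdorff m.+1 N0 <= hausdorff m.+1 N1 + hausdorff m.+1 N2)%E := outer_measureU2 _ _ _.
  by apply: le_trans h _; rewrite N10 N20 adde0.
have HN : hausdorff m.+1 N = 0%E.
  apply/eqP; rewrite eq_le outer_measure_ge0 andbT.
  have h : (hausdorff m.+1 N <= hausdorff m.+1 N0 + hausdorff m.+1 (-%R @^-1` N0))%E :=
    outer_measureU2 _ _ _.
  by apply: le_trans h _; rewrite hausdorff_opp N00 adde0.
have volN (A : set T) : hausdorff m.+1 A = 0%E -> mu A = 0%E.
  move=> A0; rewrite sphere_volE; apply/eqP; rewrite eq_le outer_measure_ge0 andbT.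
  by rewrite -A0; apply: le_outer_measure => x [].
have NN x : N (- x) <-> N x.
  by split=> -[h|h]; [right|left|right|left] => //=; rewrite /= ?opprK in h *.
pose f' : 'rV[R]_m.+2 -> R := f \_ (S `\` N).
have f'E x : S x -> ~ N x -> f x = f' x.
  by move=> xS xN; rewrite /f' /restrict mem_set.
have bf' : bounded_mfun S (f' : T -> R).
  split.
    apply/(measurable_restrictT (f : T -> R)); first exact: (measurableD mS mN).
    apply: measurable_funS mfN2; first exact: (measurableD mS mN2).
    by move=> x [xS xN]; split => // xN2; apply: xN; left; right.
  exists `|M| => x xS; rewrite /f' /restrict; case: ifPn => [/set_mem[_ xN]|_].
    rewrite (le_trans (HN1 x _ xS)) ?ler_norm// => xN1; by apply: xN; left; left.
  by rewrite normr0.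
have ef' v : S v -> f' (- v) = f' v.
  move=> vS; have [vN|vN] := pselect (N v).
    rewrite /f' /restrict !memNset// => -[_]; [exact|by move/NN].
  by rewrite -!f'E// ?fe//; [exact/usphereNP|move/NN].
have [//|//|c Hc] := equators_const (f := f') _ bf' ef' _.
  have aeN3 : {ae mu, forall u, ~ N3 u}.
    by exists N3; split => // [|u /= /contrapT//]; exact: volN.
  apply: filterS2 aeN3 (equator_null mN (volN _ HN)) => u uN3 TN uS a aS.
  have [mfu [c isoc]] := HN3 u uN3 uS.
  have mD p : measurable_fun (equator u : set (caratheodory_type (hausdorff_outer m)))
      (fun y => f y * dotv p y ^+ 2).
    have mX : measurable_fun (equator u : set (caratheodory_type (hausdorff_outer m)))
        (fun y : 'rV[R]_m.+2 => dotv p y ^+ 2).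
      apply: measurable_funTS.
      exact: (measurableT_comp (bounded_mfun_dotvX p 2).1 (@measurable_id_caratheodory R m.+2 m)).
    exact: (measurable_funM mfu mX).
  have bX p : bounded_mfun S (fun y : T => f' y * dotv p y ^+ 2).
    exact: (bounded_mfunM bf' (bounded_mfun_dotvX p 2)).
  have CE p : \int[hausdorff_cara m]_(y in equator u) (f y * dotv p y ^+ 2) =
      Tr (fun y => f' y * dotv p y ^+ 2) u.
    apply: (caratheodory_equator_int mN uS (TN uS) (mD p) (bX p)) => x xS xN.
    by rewrite f'E.
  apply: (equator_int_isotropic (c := c)) => //.
    move=> x xu; rewrite -CE -(isoc x xu); apply: eq_Rintegral => y _.
    by rewrite mulrC.
  move=> p; rewrite -!CE; apply: eq_Rintegral => y /set_mem[_ /= yu].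
  by rewrite dotvBl dotvZl (dotvC u y) yu mulr0 subr0.
exists c; have [A [mA A0 HA]] := Hc.
(* [A] is null for the volume restricted to the sphere, so only its part in [S] is known to be
   Hausdorff null. *)
exists ((A `&` S) `|` N); split.
- apply: measurable_caratheodory; apply: measurableU => //; exact: measurableI.
- apply/eqP; rewrite eq_le measure_ge0 andbT.
  have h : (hausdorff m.+1 ((A `&` S) `|` N) <= hausdorff m.+1 (A `&` S) + hausdorff m.+1 N)%E :=
    outer_measureU2 _ _ _.
  by apply: le_trans h _; rewrite (A0 : hausdorff m.+1 (A `&` S) = 0%E) HN adde0.
move=> x /= /not_implyP[xS fx]; have [xN|xN] := pselect (N x); first by right.
left; split => //; apply: HA => /= H; apply: fx.
by rewrite f'E//; exact: H.
Qed.

End isotropic_restrictions.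

Theorem theorem1p9 (R : realType) (n : nat) (n_ge3 : (3 <= n)%N)
    (f : 'rV[R]_n -> R)
    (f_measurable : measurable_fun
       (unit_sphere {: 'rV[R]_n}%VS : set (sphere_type {: 'rV[R]_n}%VS)) f)
    (f_bounded : exists M : R,
       {ae sphere_measure {: 'rV[R]_n}%VS,
        forall x, unit_sphere {: 'rV[R]_n}%VS x -> `|f x| <= M})
    (f_even : forall x, unit_sphere {: 'rV[R]_n}%VS x -> f (- x) = f x)
    (f_isotropic :
       {ae sphere_measure {: 'rV[R]_n}%VS,
        forall u, unit_sphere {: 'rV[R]_n}%VS u -> isotropic (perpv u) f}) :
  exists c : R,
    {ae sphere_measure {: 'rV[R]_n}%VS,
     forall x, unit_sphere {: 'rV[R]_n}%VS x -> f x = c}.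
Proof.

have [m [nm m0]] : exists m, n = m.+2 /\ (0 < m)%N.
  by case: n n_ge3 {f f_measurable f_bounded f_even f_isotropic} => [|[|[|m]]]//; exists m.+1.
subst n.
have Sfull : unit_sphere {: 'rV[R]_m.+2}%VS = usphere.
  by apply/seteqP; split => x; [case=> _ /usphere_enorm|move/usphere_enorm; split; rewrite ?memvf].
have Sperp u : unit_sphere (perpv u) = usphere `&` [set x | dotv x u = 0].
  apply/seteqP; split => x.
    by move=> [xu /usphere_enorm xS]; split => //; move: xu; rewrite mem_perpv => /eqP.
  by move=> [/usphere_enorm xS xu]; split => //; rewrite mem_perpv; apply/eqP.
(* The dimension of the Hausdorff measure is only provably equal to m + 1, and the sigma-algebra
   depends on it; generalising over [s] makes the substitution well typed. *)
have key s : s = m.+1 ->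
    measurable_fun (usphere : set (caratheodory_type (hausdorff_outer s))) f ->
    (exists M : R, {ae hausdorff_cara s, forall x : 'rV[R]_m.+2, usphere x -> `|f x| <= M}) ->
    {ae hausdorff_cara s, forall u : 'rV[R]_m.+2, usphere u -> isotropic (perpv u) f} ->
    exists c : R, {ae hausdorff_cara s, forall x : 'rV[R]_m.+2, usphere x -> f x = c}.
  move=> -> mf fb fi; apply: isotropic_restrictions_const => //.
    by move=> x xS; apply: f_even; rewrite Sfull.
  case: fi => A [mA A0 HA]; exists A; split => // u /= nP; apply: HA => /= H; apply: nP => uS.
  have [int _ [c Hc]] := H uS.
  have u0 : u != 0.
    apply/eqP => u0; have := uS; rewrite /usphere /= u0 dotv0l => /eqP.
    by rewrite eq_sym oner_eq0.
  have dim : (\dim (perpv u)).-1 = m by rewrite dim_perpv.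
  (* The same generalisation for the equator, whose dimension comes from [dim_perpv]. *)
  have conv s' : s' = m ->
      measurable_fun (unit_sphere (perpv u) : set (caratheodory_type (hausdorff_outer s'))) f ->
      (forall x, unit_sphere (perpv u) x ->
        \int[hausdorff_cara s']_(y in unit_sphere (perpv u)) (dotv x y ^+ 2 * f y) = c) ->
      measurable_fun (usphere `&` [set x | dotv x u = 0] :
        set (caratheodory_type (hausdorff_outer m))) f /\
      exists c : R, forall x, (usphere `&` [set x | dotv x u = 0]) x ->
       \int[hausdorff_cara m]_(y in usphere `&` [set x | dotv x u = 0]) (dotv x y ^+ 2 * f y) = c.
    by move=> ->; rewrite Sperp => ? ?; split => //; exists c.
  apply: (conv _ dim); last exact: Hc.
  by apply/measurable_EFinP; case/integrableP : int.
have dim : (\dim {: 'rV[R]_m.+2}).-1 = m.+1 by rewrite dim_fullv_row.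
rewrite Sfull in f_measurable f_bounded f_isotropic *.
exact: (key _ dim).
Qed.
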